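(* Let $d \ge 2$ be an integer, $0< s \le 1$, $1<\gamma<+\infty$, $1\le p, q < + \infty$, $1 <\alpha<d$, and $0< \beta_1, \beta_2 < + \infty$ be such that $$\beta_1p+2\beta_2q =1 \quad\text{and}\quad (d-sp)\beta_1+(d+\alpha)\beta_2 = \frac{d}{\gamma},$$ and $p(d+\alpha)-2q(d-sp)\neq 0$. Assume that either $$\beta_1 \gamma + \frac{d+\alpha-2}{d-1}\, \beta_2 \gamma > 1,$$ or $$\beta_1 \gamma + \frac{d+\alpha-2}{d-1}\, \beta_2 \gamma = 1 \ \text{ and }\ q(1-sp)=p .$$ Then there exists a constant $C>0$ such that for all $g \in C^1_{c,\mathrm{rad}}(\mathbb{R}^d)$, $$\| g\|_{L^\gamma(\mathbb{R}^d)} \leq C\, \| g\|_{\dot W^{s, p}(\mathbb{R}^d)}^{\beta_1 p} \left(\int_{\mathbb{R}^d}\int_{\mathbb{R}^d} \frac{|g(x)|^q|g(y)|^q}{|x-y|^{d-\alpha}}\,dx\,dy\right)^{\beta_2}.$$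
   Context: $C^1_{c,\mathrm{rad}}(\mathbb{R}^d)$ denotes the space of all radial, continuously differentiable, compactly supported functions on $\mathbb{R}^d$. The notation $\|g\|_{\dot W^{s,p}(\mathbb{R}^d)}$ means $\left(\int_{\mathbb{R}^d}\int_{\mathbb{R}^d} \frac{|g(x)-g(y)|^p}{|x-y|^{d+sp}}\,dx\,dy\right)^{1/p}$ if $0<s<1$, and $\left(\int_{\mathbb{R}^d}|\nabla g(x)|^p\,dx\right)^{1/p}$ if $s=1$. *)

(* Defs.v *)
From HB Require Import structures.
From mathcomp Require Import all_boot all_order all_algebra.
From mathcomp Require Import all_classical all_reals all_analysis.
From mathcomp Require Import measurable_realfun.

Set Implicit Arguments.
Unset Strict Implicit.
Unset Printing Implicit Defensive.

Import Order.TTheory GRing.Theory Num.Theory.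
Import numFieldNormedType.Exports.

Local Open Scope classical_set_scope.
Local Open Scope ring_scope.

Definition rV_display : measure_display.
Proof. exact: default_measure_display. Qed.

(** ['rV[R]_n] carries the product sigma-algebra, generated by the coordinate
    functions; [measurable_rVE] below shows that it is the Borel one. *)
Section measurable_rV.
Context (R : realType) (n : nat).

Let coord (i : 'I_n) (x : 'rV[R]_n) : measurableTypeR R := x ord0 i.

Let rV_set0 : g_sigma_preimage coord set0.
Proof. exact: sigma_algebra0. Qed.

Let rV_setC A : g_sigma_preimage coord A -> g_sigma_preimage coord (~` A).
Proof. exact: sigma_algebraC. Qed.

Let rV_bigcup (F : (set 'rV[R]_n)^nat) :
  (forall i, g_sigma_preimage coord (F i)) ->
  g_sigma_preimage coord (\bigcup_i (F i)).
Proof. exact: sigma_algebra_bigcup. Qed.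

HB.instance Definition _ := @isMeasurable.Build rV_display
  'rV[R]_n (g_sigma_preimage coord) rV_set0 rV_setC rV_bigcup.

Lemma measurable_rV_coord (i : 'I_n) :
  measurable_fun [set: 'rV[R]_n] (fun x => x ord0 i : measurableTypeR R).
Proof.
move=> _ Y mY; rewrite setTI; apply: sub_sigma_algebra => /=.
rewrite -bigcup_seq/=; exists i => /=; first by rewrite mem_index_enum.
by exists Y => //; rewrite setTI.
Qed.

Lemma rV_sigma_algebra_sub (G : set (set 'rV[R]_n)) :
  sigma_algebra setT G ->
  (forall (i : 'I_n) (B : set (measurableTypeR R)), measurable B ->
    G [set x : 'rV[R]_n | B (x ord0 i)]) ->
  (@measurable _ 'rV[R]_n) `<=` G.
Proof.
move=> sG GB; apply: smallest_sub => //.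
rewrite -bigcup_seq => A [i _ [B mB <-]]; rewrite setTI; exact: GB.
Qed.

Lemma measurable_fun_rVP d (T : measurableType d) (f : T -> 'rV[R]_n) :
  measurable_fun setT f <->
  forall i, measurable_fun setT (fun t => f t ord0 i : measurableTypeR R).
Proof.
split=> [mf i|mf]; first exact: (measurableT_comp (measurable_rV_coord i) mf).
move=> _ Y mY; rewrite setTI.
apply: (@rV_sigma_algebra_sub [set Y | measurable (f @^-1` Y)]) mY.
- split => /=.
  + by rewrite preimage_set0; exact: measurable0.
  + by move=> A mA; rewrite setTD preimage_setC; exact: measurableC.
  + by move=> F mF; rewrite preimage_bigcup; exact: bigcupT_measurable.
- by move=> i B mB /=; rewrite -[X in measurable X]setTI; exact: mf.
Qed.

Lemma measurable_rV_box (A : 'I_n -> set (measurableTypeR R)) :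
  (forall i, measurable (A i)) ->
  measurable [set x : 'rV[R]_n | forall i, A i (x ord0 i)].
Proof.
move=> mA.
rewrite (_ : [set _ | _] =
    \big[setI/setT]_(i < n) [set x : 'rV[R]_n | A i (x ord0 i)]).
  by apply: bigsetI_measurable => i _; rewrite -[X in measurable X]setTI;
     exact: measurable_rV_coord.
apply/seteqP; split => x /=.
  by move=> Ax; elim/big_ind : _ => // i _; exact: Ax.
by move=> + i; rewrite (bigD1 i)//= => -[].
Qed.

Lemma measurable_rVE : @measurable _ 'rV[R]_n = <<s (@open 'rV[R]_n) >>.
Proof.
apply/seteqP; split.
  apply: rV_sigma_algebra_sub => [|i B mB]; first exact: smallest_sigma_algebra.
  have : measurable_fun setT (fun x : g_sigma_algebraType (@open 'rV[R]_n) =>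
      (x : 'rV[R]_n) ord0 i : measurableTypeR R).
    apply: (measurability _ (RGenOpens.measurableE R)).
    move=> _ [_ [a [b ->]] <-]; rewrite setTI; apply: sub_sigma_algebra.
    apply: (@open_comp _ _ (fun x : 'rV[R]_n => x ord0 i)).
      by move=> x _; exact: coord_continuous.
    exact: interval_open.
  by move=> /(_ measurableT B mB); rewrite setTI.
apply: smallest_sub; first exact: sigma_algebra_measurable.
move=> U oU.
pose bx (c : 'rV[rat]_n * nat) :=
  [set x : 'rV[R]_n | forall i,
     ball (ratr (c.1 ord0 i) : R) (c.2.+1%:R^-1) (x ord0 i)].
rewrite (_ : U = \bigcup_(c in [set c | bx c `<=` U]) bx c).
  rewrite bigcup_mkcond; apply: countable_bigcupT_measurable => // c.
  case: ifPn => _; [|by []].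
  apply: (@measurable_rV_box (fun i => ball (ratr (c.1 ord0 i) : R) c.2.+1%:R^-1)).
  by move=> i; exact: measurable_ball.
apply/seteqP; split; last by move=> x [c cU] /cU.
move=> x Ux.
have /nbhs_ballP[e /= e0 xeU] := open_nbhs_nbhs (conj oU Ux).
have [k ke] : exists k, k.+1%:R^-1 < e / 2.
  have /ltr_add_invr[k] : 0 < e / 2 by rewrite divr_gt0.
  by rewrite add0r; exists k.
have /choice[q xq] : forall i, exists q : rat,
    ball (ratr q : R) (k.+1%:R^-1) (x ord0 i).
  move=> i; have /rat_in_itvoo[q] : x ord0 i < x ord0 i + k.+1%:R^-1.
    by rewrite ltrDl invr_gt0.
  rewrite in_itv/= => /andP[xq qx]; exists q.
  by rewrite /ball/= gtr0_norm ?subr_gt0// ltrBlDl.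
exists (\row_i q i, k); last by move=> i /=; rewrite mxE; exact: xq.
move=> y /= yq; apply: xeU; split => // i j; rewrite ord1.
apply: le_ball (_ : k.+1%:R^-1 + k.+1%:R^-1 <= e) _ _.
  by rewrite [leRHS]splitr lerD// ltW.
apply: ball_triangle; first by apply: ball_sym; exact: xq.
by have := yq j; rewrite mxE.
Qed.

End measurable_rV.

Section lebesgue_rV.
Context (R : realType).

Definition rV_cons n (z : measurableTypeR R * 'rV[R]_n) : 'rV[R]_n.+1 :=
  row_mx (z.1)%:M z.2.

Lemma rV_cons0 n (z : measurableTypeR R * 'rV[R]_n) :
  rV_cons z ord0 ord0 = z.1.
Proof.
rewrite /rV_cons; have -> : ord0 = lshift n (ord0 : 'I_1) by exact: val_inj.
by rewrite (@row_mxEl _ 1 1 n) mxE eqxx mulr1n.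
Qed.

Lemma rV_consS n (z : measurableTypeR R * 'rV[R]_n) i :
  rV_cons z ord0 (lift ord0 i) = z.2 ord0 i.
Proof.
rewrite /rV_cons; have -> : lift ord0 i = rshift 1 i by exact: val_inj.
by rewrite (@row_mxEr _ 1 1 n).
Qed.

Lemma measurable_rV_cons n :
  measurable_fun setT (@rV_cons n).
Proof.
apply/measurable_fun_rVP => i; case: (unliftP ord0 i) => [j|] ->.
  under eq_fun do rewrite rV_consS.
  exact: (measurableT_comp (measurable_rV_coord j) measurable_snd).
under eq_fun do rewrite rV_cons0.
exact: measurable_fst.
Qed.

Section step.
Variables (n : nat) (m : {sigma_finite_measure set 'rV[R]_n -> \bar R}).

Definition lebesgue_rV_step : set 'rV[R]_n.+1 -> \bar R :=
  pushforward (@lebesgue_measure R \x m)%E (@rV_cons n).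

Let step0 : lebesgue_rV_step set0 = 0%E.
Proof. by rewrite /lebesgue_rV_step /pushforward preimage_set0 measure0. Qed.

Let step_ge0 A : (0 <= lebesgue_rV_step A)%E.
Proof. by rewrite /lebesgue_rV_step /pushforward measure_ge0. Qed.

Let step_sigma_additive : semi_sigma_additive lebesgue_rV_step.
Proof.
move=> F mF tF mUF; rewrite /lebesgue_rV_step /pushforward preimage_bigcup.
have mpre A : measurable A -> measurable (@rV_cons n @^-1` A).
  by move=> mA; rewrite -[X in measurable X]setTI; exact: measurable_rV_cons.
apply: measure_semi_sigma_additive => [k||]; first exact: mpre.
  apply/trivIsetP => i j _ _ ij; rewrite -preimage_setI.
  by move/trivIsetP : tF => /(_ _ _ _ _ ij) ->//; rewrite preimage_set0.
by rewrite -preimage_bigcup; exact: mpre.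
Qed.

HB.instance Definition _ := isMeasure.Build _ _ _
  lebesgue_rV_step step0 step_ge0 step_sigma_additive.

Let step_sigma_finite : sigma_finite setT lebesgue_rV_step.
Proof.
have [F FT mF] : sigma_finite setT (@lebesgue_measure R \x m)%E.
  have /sigma_finiteP[F [TF ndF Foo]] := sigma_finiteT (@lebesgue_measure R).
  have /sigma_finiteP[G [TG ndG Goo]] := sigma_finiteT m.
  exists (fun k => F k `*` G k).
    rewrite -setXTT TF TG predeqE => -[x y]; split; last first.
      by move=> [k _ []/= ? ?]; split; exists k.
    move=> [/= [k _ Fkx] [l _ Gly]]; exists (maxn k l) => //; split.
    - by move: x Fkx; exact/subsetPset/ndF/leq_maxl.
    - by move: y Gly; exact/subsetPset/ndG/leq_maxr.
  move=> k; have [? ?] := Foo k; have [? ?] := Goo k.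
  split; first exact: measurableX.
  by rewrite product_measure1E// lte_mul_pinfty// ge0_fin_numE.
pose h (x : 'rV[R]_n.+1) : measurableTypeR R * 'rV[R]_n :=
  (x ord0 ord0, \row_j x ord0 (lift ord0 j)).
have mh : measurable_fun setT h.
  apply: measurable_fun_pair; first exact: measurable_rV_coord.
  apply/measurable_fun_rVP => j; under eq_fun do rewrite mxE.
  exact: measurable_rV_coord.
have hK z : h (rV_cons z) = z.
  rewrite /h rV_cons0 [RHS]surjective_pairing; congr pair.
  by apply/rowP => j; rewrite mxE rV_consS.
exists (fun k => h @^-1` F k); first by rewrite -preimage_bigcup -FT.
move=> k; have [mFk Foo] := mF k; split.
  by rewrite -[X in measurable X]setTI; exact: mh.
rewrite /lebesgue_rV_step /pushforward.
rewrite (_ : _ @^-1` _ = F k)//.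
by apply/seteqP; split => z /=; rewrite hK.
Qed.

HB.instance Definition _ := @Measure_isSigmaFinite.Build _ _ _
  lebesgue_rV_step step_sigma_finite.

End step.

(** Lebesgue measure on [R^n]: the [n]-fold product of the Lebesgue measure of
    [R], transported to row vectors. *)
Fixpoint lebesgue_rV n : {sigma_finite_measure set 'rV[R]_n -> \bar R} :=
  match n with
  | 0 => \d_(0 : 'rV[R]_0)
  | m.+1 => lebesgue_rV_step (lebesgue_rV m)
  end.

Lemma lebesgue_rV_box n (A : 'I_n -> set (measurableTypeR R)) :
  (forall i, measurable (A i)) ->
  (lebesgue_rV n [set x | forall i, A i (x ord0 i)] =
   \prod_(i < n) lebesgue_measure (A i))%E.
Proof.
elim: n A => [|n IHn] A mA.
  by rewrite big_ord0 /= diracE mem_set//= => -[].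
rewrite big_ord_recl /= /lebesgue_rV_step /pushforward.
rewrite -(IHn (fun i => A (lift ord0 i)))//.
rewrite -product_measure1E//; last first.
  exact: (@measurable_rV_box R n (fun i => A (lift ord0 i))).
congr (_ _); apply/seteqP; split => z /=.
  move=> zA; split => /=; first by have := zA ord0; rewrite rV_cons0.
  by move=> i; have := zA (lift ord0 i); rewrite rV_consS.
move=> -[z1 z2] i; case: (unliftP ord0 i) => [j|] ->; first by rewrite rV_consS.
by rewrite rV_cons0.
Qed.

End lebesgue_rV.

Section spaces.
Context (R : realType) (d : nat).
Implicit Types (x y : 'rV[R]_d) (g : 'rV[R]_d -> R) (s p q alpha : R).

(** The library norm [`|x|] of a row vector is the sup norm. *)
Definition enorm x : R := Num.sqrt (\sum_(i < d) x ord0 i ^+ 2).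

Definition gradient g x : 'rV[R]_d := \row_i 'D_(delta_mx ord0 i) g x.

Definition C1 g : Prop :=
  (forall x, differentiable g x) /\
  (forall i : 'I_d, continuous (fun x => 'D_(delta_mx ord0 i) g x)).

Definition compactly_supported g : Prop :=
  compact (closure [set x | g x != 0]).

Definition radial g : Prop := forall x y, enorm x = enorm y -> g x = g y.

Definition C1c_rad : set ('rV[R]_d -> R) :=
  [set g | [/\ C1 g, compactly_supported g & radial g]].

(** Only meaningful for [0 < s <= 1].  On the diagonal [x = y], which is
    Lebesgue-negligible for [0 < d], the kernel takes the value [0]. *)
Definition Wdot_norm s p g : \bar R :=
  if s == 1 then
    ((\int[lebesgue_rV R d]_x (enorm (gradient g x) `^ p)%:E) `^ p^-1)%E
  else
    ((\int[lebesgue_rV R d]_x \int[lebesgue_rV R d]_y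
       (`|g x - g y| `^ p / enorm (x - y) `^ (d%:R + s * p))%:E) `^ p^-1)%E.

Definition coulomb_energy alpha q g : \bar R :=
  (\int[lebesgue_rV R d]_x \int[lebesgue_rV R d]_y
     (`|g x| `^ q * `|g y| `^ q / enorm (x - y) `^ (d%:R - alpha))%:E)%E.

End spaces.

(* Main.v *)
Require Import Defs.
From HB Require Import structures.
From mathcomp Require Import all_boot all_order all_algebra.
From mathcomp Require Import all_classical all_reals all_analysis.
From mathcomp Require Import measurable_realfun ring lra.
(** A radial function is a function of the radius, so the inequality becomes a
    one-dimensional weighted one.  Restricting the double integrals to thin tubes
    around a coordinate axis bounds the seminorm and the Coulomb energy from below
    by energies of the profile on dyadic annuli; an amplitude [u r^(-m1)] is
    attached to the former and [v r^(-m2)] to the latter, where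
    [m1 = (d - s p) / p] and [m2 = (d + alpha) / (2 q)].  On one annulus, chaining
    averages over shrinking intervals gives an interpolation inequality between the
    two energies, valid for an interpolation parameter in a neighbourhood of
    [beta1 p]: this is where the radial condition on the exponents is used.  Since
    [m1 <> m2], the two amplitudes coincide at a single radius; moving the
    interpolation parameter slightly up or down on either side of it produces
    geometric decay, so that the sum over the annuli converges. *)

Set Implicit Arguments.
Unset Strict Implicit.
Unset Printing Implicit Defensive.
Import Order.TTheory GRing.Theory Num.Theory.
Import numFieldNormedType.Exports.
Local Open Scope classical_set_scope.
Local Open Scope ring_scope.

(** Put tau = [beta1 * p]. Homogeneity gives 1 - tau = 2 [beta2] q, and the scaling relation says
    that tau m1 + (1 - tau) m2 = d / [gamma]. The radial condition, multiplied by (d - 1) / [gamma]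
    and reduced by the scaling relation, becomes s tau - tau / p + 1 / [gamma] - (1 - tau) / q > 0:
    strict subcriticality for Gagliardo-Nirenberg in dimension one, an open condition on tau. In the
    equality case q (1 - s p) = p forces [gamma] = q and 1 / q = 1 / p - s, an endpoint embedding
    that serves every parameter. The local inequality bounds only the oscillation around the mean of
    an annulus. The means need their own argument: the Coulomb energy bounds them directly, whereas
    the seminorm bounds only differences of neighbouring means, which are telescoped from the
    balancing radius or from infinity. For s = 1 the seminorm is weakened to a fractional one of
    order slightly below 1, so that one chaining argument covers every s. Integrals over R^d are
    compared with radial ones by inequalities up to a dimensional constant; no exact polar formula
    is established. *)

(** * Comparison of integrals through expansive maps *)

Section expansive.
Context {R : realType}.
Notation mu := (@lebesgue_measure R).

Lemma lebesgue_measure_diam (D : set (measurableTypeR R)) (l : R) : 0 <= l ->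
  (forall x y, D x -> D y -> `|x - y| <= l) -> measurable D ->
  (mu D <= l%:E)%E.
Proof.
move=> l0 Dl mD; have [->|/set0P[x0 Dx0]] := eqVneq D set0.
  by rewrite measure0 lee_fin.
have ubD : has_sup D.
  split; first by exists x0.
  exists (x0 + l) => y Dy; have := Dl _ _ Dy Dx0.
  by rewrite ler_norml => /andP[_]; rewrite lerBlDl.
have DI : D `<=` `[sup D - l, sup D].
  move=> x Dx; rewrite /= in_itv/=; apply/andP; split; last by apply: ub_le_sup => //; exact: ubD.2.
  rewrite lerBlDr; apply: ge_sup; first by exists x0.
  move=> y Dy; have := Dl _ _ Dy Dx.
  by rewrite ler_norml => /andP[_]; rewrite lerBlDl.
apply: (@le_trans _ _ (mu `[sup D - l, sup D])).
  by apply: le_measure => //; rewrite inE.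
rewrite lebesgue_measure_itv/= lte_fin; case: ifPn => _; last by rewrite lee_fin.
by rewrite -EFinB opprB addrCA subrr addr0.
Qed.

(** Lebesgue measure is an infimum over countable covers by half-open intervals, so a bound for [nu]
    on such intervals passes to every measurable set by subadditivity. *)
Lemma le_lebesgue_measure (nu : {measure set (measurableTypeR R) -> \bar R})
    (K : R) : 0 < K ->
  (forall a b : R, a <= b -> (nu `]a, b]%classic <= (K * (b - a))%:E)%E) ->
  forall A, measurable A -> (nu A <= K%:E * mu A)%E.
Proof.
move=> K0 nuK A mA; rewrite -lee_pdivrMl//.
rewrite /lebesgue_measure /lebesgue_stieltjes_measure /measure_extension /mu_ext/=.
apply: le_ereal_inf_tmp => _ [F [mF AF] <-].
rewrite lee_pdivrMl// -nneseriesZl; last first.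
  by move=> n _; exact: wlength_ge0.
have mF' n : @measurable _ (measurableTypeR R) (F n).
  by apply: sub_sigma_algebra; exact: mF.
apply: (le_trans (measure_sigma_subadditive nu mF' mA AF)).
apply: lee_nneseries => // n _.
have [[a b] ab <-] := mF n.
rewrite /=; have [ab'|ba] := leP a b; last first.
  rewrite set_itv_ge ?measure0; first by rewrite mule_ge0// ?lee_fin ?ltW ?wlength_ge0.
  by rewrite bnd_simp -leNgt ltW.
by rewrite wlength_itv_bnd// -EFinM nuK.
Qed.

(* A one-sided change of variables in which [phi] is only required to be expansive,
   so that no derivative of [phi] appears. *)
Lemma integral_expansive_le (D V : set (measurableTypeR R))
    (phi : measurableTypeR R -> measurableTypeR R) (K : R)
    (G : measurableTypeR R -> \bar R) : 0 < K -> measurable D -> measurable V ->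
  measurable_fun setT phi ->
  (forall x y, D x -> D y -> `|x - y| <= K * `|phi x - phi y|) ->
  (forall x, D x -> V (phi x)) ->
  measurable_fun setT G -> (forall x, 0 <= G x)%E ->
  (\int[mu]_(x in D) G (phi x) <= K%:E * \int[mu]_(x in V) G x)%E.
Proof.
move=> K0 mD mV mphi Dphi DV mG G0.
have mpre A : measurable A -> measurable (phi @^-1` A).
  by move=> mA; rewrite -[X in measurable X]setTI; exact: mphi.
(* [nu] is the image under [phi] of Lebesgue measure on [D]. Expansiveness says that the part of [D]
   sent into an interval of length h has diameter at most K h, hence measure at most K h. *)
pose nu0 : {measure set (measurableTypeR R) -> \bar R} := mrestr mu mD.
pose nu : {measure set (measurableTypeR R) -> \bar R} :=
  @measure_function_pushforward__canonical__measure_function_Measure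
  _ _ _ _ R nu0 _ mphi.
have nuE A : nu A = mu (phi @^-1` A `&` D) by [].
have -> : (\int[mu]_(x in D) G (phi x) = \int[nu]_(x in V) G x)%E.
  have mphiV : measurable (phi @^-1` V).
    exact: mpre.
  have mGphi : measurable_fun setT (G \o phi) by exact: measurableT_comp.
  transitivity (\int[nu0]_(x in phi @^-1` V) (G \o phi) x)%E; last first.
    have E := @ge0_integral_pushforward _ _ _ _ _ _ mphi nu0 V G mV.
    by symmetry; apply: E => //; exact: measurable_funTS.
  have E := @ge0_negligible_integral _ _ _ nu0 (phi @^-1` V) (~` D) (G \o phi).
  rewrite E//=; last 3 first.
  - exact: measurableC.
  - exact: measurable_funTS.
  - by rewrite /mrestr setICl measure0.
  rewrite setDE setCK setIidr//.
  by apply: eq_measure_integral => A mA AD; rewrite /= /mrestr setIidl.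
rewrite [leRHS](_ : _ = \int[mscale (NngNum (ltW K0)) mu]_(x in V) G x)%E; last first.
  by rewrite ge0_integral_mscale//; exact: measurable_funTS.
apply: ge0_le_measure_integral => // A mA.
rewrite /mscale/=.
apply: (@le_lebesgue_measure nu K K0) => // a b ab.
rewrite nuE; apply: lebesgue_measure_diam.
- by rewrite mulr_ge0 ?subr_ge0// ltW.
- move=> x y [/= xab Dx] [/= yab Dy]; rewrite (le_trans (Dphi _ _ Dx Dy))// ler_pM2l//.
  move: xab yab; rewrite !in_itv/= ler_norml => /andP[? ?] /andP[? ?].
  by apply/andP; split; lra.
- by apply: measurableI => //; exact: mpre.
Qed.
End expansive.

(** * Tonelli's theorem on product sets *)

Section tonelli.
Context d1 d2 (T1 : measurableType d1) (T2 : measurableType d2) {R : realType}.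
Variables (m1 : {sigma_finite_measure set T1 -> \bar R})
  (m2 : {sigma_finite_measure set T2 -> \bar R}).
Variable f : T1 * T2 -> \bar R.
Hypotheses (mf : measurable_fun setT f) (f0 : forall z, (0 <= f z)%E).
Variables (D1 : set T1) (D2 : set T2).
Hypotheses (mD1 : measurable D1) (mD2 : measurable D2).

Let g z := (f z * (\1_(D1 `*` D2) z)%:E)%E.

Let mg : measurable_fun setT g.
Proof.
apply: emeasurable_funM => //; apply/measurable_EFinP.
by apply: measurable_indic; exact: measurableX.
Qed.

Let g0 z : (0 <= g z)%E.
Proof. by rewrite mule_ge0// lee_fin. Qed.

Let gE x y : g (x, y) = (f (x, y) * (\1_D2 y)%:E * (\1_D1 x)%:E)%E.
Proof. by rewrite /g !indicE in_setX/= -muleA -EFinM -natrM mulnb andbC. Qed.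

Lemma tonelli_in : (\int[m1]_(x in D1) \int[m2]_(y in D2) f (x, y) =
  \int[m2]_(y in D2) \int[m1]_(x in D1) f (x, y))%E.
Proof.
transitivity (\int[m1]_x \int[m2]_y g (x, y))%E.
  rewrite integral_mkcond; apply: eq_integral => x _; rewrite epatch_indic/=.
  under [RHS]eq_integral do rewrite gE.
  rewrite ge0_integralZr//; last 2 first.
  - apply: emeasurable_funM; first exact: measurableT_comp.
    by apply/measurable_EFinP; exact: measurable_indic.
  - by move=> y _; rewrite mule_ge0// lee_fin.
  congr (_ * _)%E; rewrite [LHS]integral_mkcond; apply: eq_integral => y _.
  by rewrite epatch_indic.
rewrite (fubini_tonelli g)//.
rewrite [RHS]integral_mkcond; apply: eq_integral => y _; rewrite epatch_indic/=.
under [LHS]eq_integral do rewrite gE -muleA (muleC (_ _)%:E) muleA.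
rewrite ge0_integralZr//; last 2 first.
- apply: emeasurable_funM; first exact: measurableT_comp.
  by apply/measurable_EFinP; exact: measurable_indic.
- by move=> x _; rewrite mule_ge0// lee_fin.
congr (_ * _)%E; rewrite [RHS]integral_mkcond; apply: eq_integral => x _.
by rewrite epatch_indic.
Qed.

Lemma measurable_integral_in :
  measurable_fun setT (fun x => \int[m2]_(y in D2) f (x, y))%E.
Proof.
pose h z := (f z * (\1_D2 z.2)%:E)%E.
have -> : (fun x => \int[m2]_(y in D2) f (x, y))%E = fubini_F m2 h.
  apply/funext => x; rewrite integral_mkcond; apply: eq_integral => y _.
  by rewrite epatch_indic.
apply: measurable_fun_fubini_tonelli_F; last first.
  by move=> z; rewrite mule_ge0// lee_fin.
apply: emeasurable_funM => //; apply/measurable_EFinP.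
by apply: measurableT_comp => //; exact: measurable_indic.
Qed.

End tonelli.

(** * Substitutions along hypotenuses *)

Section change_of_variables.
Context {R : realType}.
Notation mu := (@lebesgue_measure R).
Implicit Types (F : R -> \bar R) (c : R).

Lemma measurable_sqrtr : measurable_fun setT (@Num.sqrt R).
Proof. exact: continuous_measurable_fun (@sqrt_continuous R). Qed.

Lemma measurable_hypot c : measurable_fun setT (fun x : R => Num.sqrt (x ^+ 2 + c ^+ 2)).
Proof.
apply: (measurableT_comp measurable_sqrtr).
by apply: measurable_funD => //; exact: measurable_funX.
Qed.

(** The substitution y = sqrt(t^2 - c^2) has derivative t / y >= 1, so it is expansive with constant
    1. *)
Lemma le_integral_hypot F c : measurable_fun setT F -> (forall x, 0 <= F x)%E ->
  0 <= c -> (\int[mu]_(t in `]c, +oo[) F t <=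
             \int[mu]_(y in `]0%R, +oo[) F (Num.sqrt (y ^+ 2 + c ^+ 2)))%E.
Proof.
move=> mF F0 c0.
pose phi (t : R) := Num.sqrt (t ^+ 2 - c ^+ 2).
have phi2 (t : R) : c < t -> phi t ^+ 2 = t ^+ 2 - c ^+ 2.
  by move=> ct; rewrite sqr_sqrtr// subr_ge0 ler_sqr ?nnegrE ?(le_trans c0)// ltW.
have -> : (\int[mu]_(t in `]c, +oo[) F t = \int[mu]_(t in `]c, +oo[)
   (fun y => F (Num.sqrt (y ^+ 2 + c ^+ 2))) (phi t))%E.
  apply: eq_integral => t; rewrite inE/= in_itv/= andbT => ct.
  by rewrite phi2// subrK sqrtr_sqr ger0_norm// (le_trans c0)// ltW.
rewrite -[leRHS]mul1e; apply: integral_expansive_le => //.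
- apply: (measurableT_comp measurable_sqrtr).
  by apply: measurable_funB => //; exact: measurable_funX.
- move=> x y; rewrite /= !in_itv/= !andbT.
  wlog xy : x y / y <= x.
    move=> H cx cy; have /orP[xy|yx] := le_total x y; last exact: H.
    by rewrite distrC (distrC (phi x)); exact: H.
  move=> cx cy; rewrite mul1r.
  have hx := phi2 _ cx; have hy := phi2 _ cy.
  have x0 : 0 <= phi x := sqrtr_ge0 _.
  have y0 : 0 <= phi y := sqrtr_ge0 _.
  have lx : phi x <= x by nra.
  have ly : phi y <= y by nra.
  rewrite ger0_norm ?subr_ge0//; apply: le_trans (ler_norm _).
  nra.
- move=> x; rewrite /= !in_itv/= !andbT => cx; rewrite sqrtr_gt0 subr_gt0.
  by rewrite ltr_sqr ?nnegrE ?(le_trans c0)// ltW.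
- exact: (measurableT_comp mF (measurable_hypot c)).
Qed.

(** On y >= c the derivative y / sqrt(y^2 + c^2) is at least 1 / sqrt 2, which the constant 2
    absorbs; near y = 0 the substitution would degenerate. *)
Lemma integral_hypot_le F c : measurable_fun setT F -> (forall x, 0 <= F x)%E ->
  0 <= c -> (\int[mu]_(y in `[c, +oo[) F (Num.sqrt (y ^+ 2 + c ^+ 2)) <=
             2%:E * \int[mu]_(t in `[c, +oo[) F t)%E.
Proof.
move=> mF F0 c0.
pose phi (t : R) := Num.sqrt (t ^+ 2 + c ^+ 2).
have phi2 (t : R) : phi t ^+ 2 = t ^+ 2 + c ^+ 2.
  by rewrite sqr_sqrtr// addr_ge0// sqr_ge0.
apply: (integral_expansive_le (phi := phi)) => //.
- exact: measurable_hypot.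
- move=> x y; rewrite /= !in_itv/= !andbT.
  wlog xy : x y / y <= x.
    move=> H cx cy; have /orP[xy|yx] := le_total x y; last exact: H.
    by rewrite distrC (distrC (phi x)); exact: H.
  move=> cx cy.
  have hx := phi2 x; have hy := phi2 y.
  have x0 : 0 <= phi x := sqrtr_ge0 _.
  have y0 : 0 <= phi y := sqrtr_ge0 _.
  have lx : phi x <= 2 * x by nra.
  have ly : phi y <= 2 * y by nra.
  rewrite ger0_norm ?subr_ge0//.
  apply: (@le_trans _ _ (2 * (phi x - phi y))); last by rewrite ler_pM2l// ler_norm.
  nra.
- move=> x; rewrite /= !in_itv/= !andbT => cx.
  have := phi2 x; have : 0 <= phi x := sqrtr_ge0 _; nra.
Qed.

Lemma integral_norm_le F : measurable_fun setT F -> (forall x, 0 <= F x)%E ->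
  (\int[mu]_x F `|x|%R <= 2%:E * \int[mu]_(t in `]0%R, +oo[) F t)%E.
Proof.
move=> mF F0.
have mFn : measurable_fun setT (fun x : R => F `|x|%R).
  by apply: (measurableT_comp mF); exact: normr_measurable.
rewrite (@ge0_negligible_integral _ _ _ mu setT [set 0])//=; last first.
  by rewrite lebesgue_measure_set1.
have -> : [set: R] `\` [set 0] = `]-oo, 0[ `|` `]0, +oo[.
  apply/seteqP; split => x /=; rewrite !in_itv/= andbT.
    by move=> [_ /eqP]; rewrite neq_lt => /orP.
  by move=> H; split => // x0; move: H; rewrite x0 ltxx => -[].
rewrite ge0_integral_setU//=; last 2 first.
- by apply: measurable_funTS.
- rewrite disj_set2E; apply/eqP/seteqP; split => x //=; rewrite !in_itv/= andbT => -[a b].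
  by move: (lt_trans a b); rewrite ltxx.
rewrite (_ : 2%:E = 1%:E + 1%:E)%E; last by rewrite -EFinD.
rewrite ge0_muleDl ?lee_fin//; apply: leeD; last first.
  rewrite mul1e; apply: ge0_le_integral => //.
  - exact: measurable_funTS.
  - exact: measurable_funTS.
  - by move=> x; rewrite /= in_itv/= andbT => x0; rewrite gtr0_norm.
apply: (@integral_expansive_le R _ _ (fun x => `|x|) 1 F) => //=.
- exact: normr_measurable.
- move=> x y; rewrite !in_itv/= => x0 y0; rewrite mul1r (ltr0_norm x0) (ltr0_norm y0).
  by rewrite -opprD normrN.
- by move=> x; rewrite !in_itv/= andbT => x0; rewrite normr_gt0 lt_eqF.
Qed.

End change_of_variables.

(** * Integrals of radial functions *)

Section polar.
Context {R : realType}.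
Notation mu := (@lebesgue_measure R).
Local Notation leb := (lebesgue_rV R).

Lemma enorm_ge0 n (x : 'rV[R]_n) : 0 <= enorm x.
Proof. exact: sqrtr_ge0. Qed.

Lemma enorm_sqr n (x : 'rV[R]_n) : enorm x ^+ 2 = \sum_(i < n) x ord0 i ^+ 2.
Proof. by rewrite sqr_sqrtr// sumr_ge0// => i _; exact: sqr_ge0. Qed.

Lemma enorm_cons n (a : R) (u : 'rV[R]_n) :
  enorm (rV_cons (a, u)) = Num.sqrt (a ^+ 2 + enorm u ^+ 2).
Proof.
rewrite enorm_sqr /enorm big_ord_recl rV_cons0/=.
by under eq_bigr do rewrite rV_consS/=.
Qed.

Lemma measurable_enorm n : measurable_fun setT (@enorm R n).
Proof.
apply: (measurableT_comp measurable_sqrtr).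
apply: (@measurable_sum _ _ _ _ _ _ (fun i (x : 'rV[R]_n) => x ord0 i ^+ 2)) => i.
by apply: measurable_funX; exact: measurable_rV_coord.
Qed.

Let swapR (z : measurableTypeR R * measurableTypeR R) : measurableTypeR R * measurableTypeR R := (z.2, z.1).

Let measurable_swapR : measurable_fun setT swapR.
Proof. exact: measurable_swap. Qed.

Section cons.
Variables (n : nat) (G : 'rV[R]_n.+1 -> \bar R).
Hypotheses (mG : measurable_fun setT G) (G0 : forall x, (0 <= G x)%E).

Lemma integral_rV_consP : (\int[leb n.+1]_x G x =
  \int[mu \x leb n]_z G (rV_cons z))%E.
Proof.
have E := @ge0_integral_pushforward _ _ _ _ _ _ (@measurable_rV_cons R n)
  (mu \x leb n)%E setT G measurableT mG.
rewrite preimage_setT in E.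
apply: E => y _; exact: G0.
Qed.

Lemma measurable_rV_cons_comp :
  measurable_fun setT (fun z : measurableTypeR R * 'rV[R]_n => G (rV_cons z)).
Proof. exact: (measurableT_comp mG (@measurable_rV_cons R n)). Qed.

Lemma integral_rV_cons : (\int[leb n.+1]_x G x =
  \int[mu]_a \int[leb n]_u G (rV_cons (a, u)))%E.
Proof.
by rewrite integral_rV_consP (fubini_tonelli1 (fun z => G (rV_cons z)))//;
  exact: measurable_rV_cons_comp.
Qed.

Lemma integral_rV_cons_swap : (\int[leb n.+1]_x G x =
  \int[leb n]_u \int[mu]_a G (rV_cons (a, u)))%E.
Proof.
by rewrite integral_rV_consP (fubini_tonelli2 (fun z => G (rV_cons z)))//;
  exact: measurable_rV_cons_comp.
Qed.

End cons.

Lemma measurable_le_pair :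
  measurable [set w : measurableTypeR R * measurableTypeR R | w.1 <= w.2].
Proof.
rewrite -[X in measurable X]setTI.
exact: (@measurable_fun_le _ _ R setT fst snd).
Qed.

Lemma integral_tail (q : R -> \bar R) (x : R) : 0 < x ->
  (\int[mu]_(r in `[x, +oo[) q r =
   \int[mu]_(r in `]0%R, +oo[) (q r * (\1_[set w : R * R | (w.1 <= w.2)%R] (x, r))%:E))%E.
Proof.
move=> x0; rewrite [LHS]integral_mkcond [RHS]integral_mkcond.
apply: eq_integral => r _; rewrite !epatch_indic/= -muleA -EFinM !indicE -natrM mulnb.
congr (_ * (_%:R)%:E)%E; congr nat_of_bool; apply/idP/idP.
  rewrite inE/= in_itv/= andbT => xr; apply/andP; split; rewrite inE//=.
  by rewrite in_itv/= andbT (lt_le_trans x0).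
by move=> /andP[]; rewrite inE /= => xr _; rewrite inE/= in_itv/= andbT.
Qed.

(** The two halves on either side of the diagonal are exchanged by symmetry. Where x <= y, the
    substitution r = sqrt(x^2 + y^2) in y costs a factor 2; after Tonelli, x runs over (0, r], which
    produces the weight r of the plane. *)
Lemma integral_quadrant_le (H : R -> \bar R) : measurable_fun setT H ->
  (forall x, 0 <= H x)%E ->
  (\int[mu]_(x in `]0%R, +oo[) \int[mu]_(y in `]0%R, +oo[) H (Num.sqrt (x ^+ 2 + y ^+ 2))
   <= 4%:E * \int[mu]_(r in `]0%R, +oo[) (H r * r%:E))%E.
Proof.
move=> mH H0.
pose S := [set w : measurableTypeR R * measurableTypeR R | w.1 <= w.2].
have mS1 : measurable_fun setT (fun z => (\1_S z)%:E : \bar R).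
  by apply/measurable_EFinP; apply: measurable_indic; exact: measurable_le_pair.
pose k (z : measurableTypeR R * measurableTypeR R) := (H z.2 * (\1_S z)%:E)%E.
have mk : measurable_fun setT k.
  by apply: emeasurable_funM => //; apply: measurableT_comp => //; exact: measurable_snd.
have k0 z : (0 <= k z)%E by rewrite mule_ge0// lee_fin.
pose Q (z : measurableTypeR R * measurableTypeR R) := H (Num.sqrt (z.1 ^+ 2 + z.2 ^+ 2)).
have mQ : measurable_fun setT Q.
  apply: measurableT_comp => //; apply: (measurableT_comp measurable_sqrtr).
  by apply: measurable_funD; apply: measurable_funX.
pose Q1 z := (Q z * (\1_S z)%:E)%E.
have mQ1 : measurable_fun setT Q1 by exact: emeasurable_funM.
have Q10 z : (0 <= Q1 z)%E by rewrite mule_ge0// ?lee_fin// /Q H0.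
have mQ1s : measurable_fun setT (Q1 \o swapR).
  by apply: measurableT_comp => //; exact: measurable_swapR.
have half : (\int[mu]_(x in `]0%R, +oo[) \int[mu]_(y in `]0%R, +oo[) Q1 (x, y) <=
    2%:E * \int[mu]_(r in `]0%R, +oo[) (H r * r%:E))%E.
  apply: (@le_trans _ _ (\int[mu]_(x in `]0%R, +oo[) (2%:E * \int[mu]_(r in `]0%R, +oo[) k (x, r)))%E).
    apply: ge0_le_integral => //=.
    - by move=> x _; exact: integral_ge0.
    - by apply: measurable_funTS; exact: measurable_integral_in.
    - apply: measurable_funTS; apply: measurable_funeM.
      exact: measurable_integral_in.
    - move=> x; rewrite in_itv/= andbT => x0.
      rewrite -(@integral_tail (fun y => Q (x, y)))// -(@integral_tail H)//.
      rewrite /Q/=; under eq_integral do rewrite addrC.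
      by apply: integral_hypot_le => //; exact: ltW.
  rewrite ge0_integralZl//; last 2 first.
    - by apply: measurable_funTS; exact: measurable_integral_in.
    - by move=> x _; exact: integral_ge0.
  rewrite lee_pmul2l// tonelli_in//.
  apply: ge0_le_integral => //=.
  - by move=> x _; exact: integral_ge0.
  - apply: measurable_funTS.
    apply: (@measurable_integral_in _ _ _ _ _ mu (k \o swapR)) => //.
      exact: (measurableT_comp mk measurable_swapR).
    by move=> z; exact: k0.
  - by apply: measurable_funTS; apply: emeasurable_funM => //.
  - move=> r; rewrite in_itv/= andbT => r0.
    rewrite /k/= ge0_integralZl ?H0//; last first.
      apply: measurable_funTS.
      by apply: (measurableT_comp mS1).
    rewrite lee_wpmul2l ?H0//.
    have -> : (\int[mu]_(x in `]0%R, +oo[) (\1_S (x, r))%:E =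
        \int[mu]_(x in `]0%R, +oo[) (\1_(`]-oo, r]%classic) x)%:E)%E.
      apply: eq_integral => x _; rewrite !indicE; congr ((_%:R)%:E); congr nat_of_bool.
    rewrite integral_indic// (_ : _ `&` _ = `]0, r]%classic).
      apply: (@le_trans _ _ (@lebesgue_measure R `]0%R, r]%classic)) => //.
      by rewrite lebesgue_measure_itv/= lte_fin r0 -EFinB subr0.
    by apply/seteqP; split => x /=; rewrite !in_itv/= ?andbT; [move=> [-> ->]|move=> /andP[-> ->]].
rewrite (_ : 4%:E = 2%:E + 2%:E)%E; last by rewrite -EFinD; congr EFin; lra.
rewrite ge0_muleDl ?lee_fin//.
apply: (@le_trans _ _ (\int[mu]_(x in `]0%R, +oo[) (\int[mu]_(y in `]0%R, +oo[) Q1 (x, y) +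
   \int[mu]_(y in `]0%R, +oo[) Q1 (y, x)))%E).
  apply: ge0_le_integral => //=.
  - by move=> x _; apply: integral_ge0 => y _; exact: H0.
  - apply: measurable_funTS; apply: (@measurable_integral_in _ _ _ _ _ mu Q) => //.
    by move=> z; exact: H0.
  - apply: measurable_funTS; apply: emeasurable_funD.
      exact: measurable_integral_in.
    by apply: (@measurable_integral_in _ _ _ _ _ mu (Q1 \o swapR)) => // z; exact: Q10.
  - move=> x _; rewrite -ge0_integralD//=; last 2 first.
    + apply: measurable_funTS.
      by apply: (measurableT_comp mQ1).
    + apply: measurable_funTS.
      by apply: (measurableT_comp mQ1).
    apply: ge0_le_integral => //=.
    + have mQx : measurable_fun setT (fun y : measurableTypeR R => Q (x, y)).
        by apply: (measurableT_comp mQ).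
      exact: (measurable_funTS mQx).
    + apply: measurable_funTS; apply: emeasurable_funD.
        exact: (measurableT_comp mQ1).
      by apply: (measurableT_comp mQ1).
    + move=> y _; rewrite /Q1/= !indicE.
      have [xy|yx] := leP x y.
        by rewrite mem_set ?mule1//= leeDl// mule_ge0// ?lee_fin// H0.
      rewrite [X in (_ <= _ + X)%E](_ : _ = Q (x, y)); first by rewrite leeDr// mule_ge0// ?lee_fin// H0.
      have yxS : S (y, x) by exact: ltW.
      by rewrite mem_set// mule1 /Q/= addrC.
rewrite ge0_integralD//=; last 4 first.
- by move=> x _; exact: integral_ge0.
- by apply: measurable_funTS; exact: measurable_integral_in.
- by move=> x _; exact: integral_ge0.
- apply: measurable_funTS.
  by apply: (@measurable_integral_in _ _ _ _ _ mu (Q1 \o swapR)) => // z; exact: Q10.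
apply: leeD; first exact: half.
by rewrite (@tonelli_in _ _ _ _ _ mu mu (Q1 \o swapR))// => z; exact: Q10.
Qed.

(** Induction on the dimension, splitting off the first coordinate a: the bound in one dimension
    less applies to r -> F(sqrt(a^2 + r^2)), its weight r^n is absorbed into [H] because sqrt(a^2 +
    r^2) >= r, and the quadrant bound supplies one more power of the radius. *)
Lemma integral_enorm_le n : exists2 C : R, 0 < C & forall F : R -> \bar R,
  measurable_fun setT F -> (forall x, 0 <= F x)%E ->
  (\int[leb n.+1]_x F (enorm x) <=
   C%:E * \int[mu]_(r in `]0%R, +oo[) (F r * (r ^+ n)%:E))%E.
Proof.
elim: n => [|n [C C0 IH]].
  exists 2 => // F mF F0.
  rewrite integral_rV_cons_swap//; last first.
    by apply: (measurableT_comp mF); exact: measurable_enorm.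
  rewrite /= integral_dirac//; last first.
    rewrite (_ : (fun _ => _) = cst (\int[mu]_a F (enorm (rV_cons (a, 0%R : 'rV[R]_0))))%E).
      exact: measurable_cst.
    by apply/funext => u; rewrite (_ : u = 0)//; apply/rowP => -[].
  rewrite diracT mul1e.
  under eq_integral do rewrite enorm_cons enorm_sqr big_ord0 addr0 sqrtr_sqr.
  under [in leRHS]eq_integral do rewrite expr0 mule1.
  exact: integral_norm_le.
(* The 2 folds the line of the new coordinate onto a half-line; the 4 is the constant of
   [integral_quadrant_le]. *)
exists (C * 2 * 4); first by rewrite !mulr_gt0.
move=> F mF F0.
rewrite integral_rV_cons//; last first.
  by apply: (measurableT_comp mF); exact: measurable_enorm.
pose H r := (F r * (`|r| ^+ n)%:E)%E.
have mH : measurable_fun setT H.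
  apply: emeasurable_funM => //; apply/measurable_EFinP; apply: measurable_funX.
  exact: normr_measurable.
have H0 r : (0 <= H r)%E by rewrite mule_ge0 ?lee_fin// exprn_ge0.
pose K (x : R) : \bar R := (\int[mu]_(y in `]0%R, +oo[) H (Num.sqrt (x ^+ 2 + y ^+ 2)))%E.
have mK : measurable_fun setT K.
  apply: (@measurable_integral_in _ _ _ _ _ mu (fun z : measurableTypeR R * measurableTypeR R => H (Num.sqrt (z.1 ^+ 2 + z.2 ^+ 2)))) => //.
  apply: measurableT_comp => //; apply: (measurableT_comp measurable_sqrtr).
  by apply: measurable_funD; apply: measurable_funX.
have K0 x : (0 <= K x)%E by apply: integral_ge0.
apply: (@le_trans _ _ (\int[mu]_a (C%:E * K `|a|%R))%E).
  apply: ge0_le_integral => //=.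
  - by move=> a _; exact: integral_ge0.
  - apply: (measurable_fun_fubini_tonelli_F (fun z => F (enorm (rV_cons z)))).
      apply: (measurableT_comp mF); apply: (measurableT_comp (@measurable_enorm _)).
      exact: measurable_rV_cons.
    by move=> z; exact: F0.
  - apply: measurable_funeM.
    by apply: (measurableT_comp mK); exact: normr_measurable.
  - move=> a _; under eq_integral do rewrite enorm_cons.
    have mFa : measurable_fun setT (fun r : R => F (Num.sqrt (a ^+ 2 + r ^+ 2))).
      apply: (measurableT_comp mF); under eq_fun do rewrite addrC.
      exact: measurable_hypot.
    apply: (le_trans (IH _ mFa _)) => //.
    rewrite lee_wpmul2l ?lee_fin ?(ltW C0)//.
    rewrite /K real_normK ?num_real//.
    apply: ge0_le_integral => //=.
    + move=> r; rewrite in_itv/= andbT => r0.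
      by rewrite mule_ge0// lee_fin exprn_ge0// ltW.
    + apply: measurable_funTS; apply: emeasurable_funM => //.
      by apply/measurable_EFinP; exact: measurable_funX.
    + apply: measurable_funTS; apply: (measurableT_comp mH).
      apply: (measurableT_comp measurable_sqrtr).
      by apply: measurable_funD => //; exact: measurable_funX.
    + move=> r; rewrite in_itv/= andbT => r0.
      rewrite lee_wpmul2l// lee_fin lerXn2r ?nnegrE ?normr_ge0 ?(ltW r0)//.
      rewrite (le_trans _ (ler_norm _))// -[leLHS]gtr0_norm// -sqrtr_sqr.
      by rewrite ler_wsqrtr// lerDr sqr_ge0.
have -> : (\int[mu]_a (C%:E * K `|a|%R) = C%:E * \int[mu]_a K `|a|%R)%E.
  apply: (@ge0_integralZl _ _ _ mu setT measurableT (fun a => K `|a|)).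
  - by apply: (measurableT_comp mK); exact: normr_measurable.
  - by move=> a _; exact: K0.
  - by rewrite lee_fin ltW.
rewrite !EFinM -!muleA lee_wpmul2l ?lee_fin ?(ltW C0)//.
apply: (le_trans (integral_norm_le mK K0)).
rewrite lee_wpmul2l// (le_trans (integral_quadrant_le mH H0))// lee_wpmul2l//.
apply: ge0_le_integral => //=.
- by move=> r; rewrite in_itv/= andbT => r0; rewrite mule_ge0// lee_fin ltW.
- by apply: measurable_funTS; apply: emeasurable_funM.
- apply: measurable_funTS; apply: emeasurable_funM => //.
  by apply/measurable_EFinP; exact: measurable_funX.
- move=> r; rewrite in_itv/= andbT => r0.
  by rewrite /H gtr0_norm// -muleA -EFinM -exprSr.
Qed.

(** A cylinder over a cube, around a half-line parallel to the first axis. It stands in for a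
    conical sector because it is a product set, so that Tonelli applies to it directly. *)
Definition tube n (v : 'rV[R]_n) (del : R) : set 'rV[R]_n.+1 :=
  [set y | 0 < y ord0 ord0 /\ forall i, `|y ord0 (lift ord0 i) - v ord0 i| < del].

Lemma measurable_tube n (v : 'rV[R]_n) (del : R) : measurable (tube v del).
Proof.
pose A (i : 'I_n.+1) := if unlift ord0 i is Some j then ball (v ord0 j) del else `]0, +oo[%classic.
rewrite (_ : tube v del = [set y | forall i, A i (y ord0 i)]).
  apply: (@measurable_rV_box R n.+1 A) => i; rewrite /A; case: unlift => [j|].
    exact: measurable_ball.
  exact: measurable_itv.
apply/seteqP; split => y.
  move=> -[y0 yB] i; rewrite /A; case: unliftP => [j|] ->; last by rewrite /= in_itv/= y0.
  by rewrite /ball/= distrC.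
move=> yA; split.
  by have := yA ord0; rewrite /A; case: unliftP => [j|]; [move=> /val_eqP|rewrite /= in_itv/= andbT].
by move=> i; have := yA (lift ord0 i); rewrite /A liftK /ball/= distrC.
Qed.

(** On the line at transverse position u the radius is sqrt(a^2 + |u|^2), and [le_integral_hypot]
    bounds the integral from below by the one over ]|u|, +oo[, which contains ]r, +oo[. The factor
    is the volume of the transverse cube of side 2 [del]. *)
Lemma le_integral_enorm n (F : R -> \bar R) (v : 'rV[R]_n) (r del : R) :
  measurable_fun setT F -> (forall x, 0 <= F x)%E -> 0 < del -> 0 <= r ->
  (forall u : 'rV[R]_n, (forall i, `|u ord0 i - v ord0 i| < del) -> enorm u <= r) ->
  (((2 * del) ^+ n)%:E * \int[mu]_(t in `]r, +oo[) F t <=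
   \int[leb n.+1]_(y in tube v del) F (enorm y))%E.
Proof.
move=> mF F0 del0 r0 vr.
pose B := [set u : 'rV[R]_n | forall i, ball (v ord0 i) del (u ord0 i)].
have mB : measurable B.
  apply: (@measurable_rV_box R n (fun i => ball (v ord0 i) del)) => i.
  exact: measurable_ball.
have lB : leb n B = ((2 * del) ^+ n)%:E.
  rewrite /B (@lebesgue_rV_box R n (fun i => ball (v ord0 i) del)); last first.
    by move=> i; exact: measurable_ball.
  under eq_bigr do rewrite lebesgue_measure_ball ?ltW//.
  by rewrite prodEFin prodr_const card_ord [2 * _]mulrC mulr_natr.
set S := tube v del.
have SE (y : 'rV[R]_n.+1) : S y = (0 < y ord0 ord0 /\ forall i, ball (v ord0 i) del (y ord0 (lift ord0 i))) :> Prop.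
  by rewrite /S/tube/= /ball/=; under eq_forall do rewrite distrC.
have mS : measurable S by exact: measurable_tube.
have mFS : measurable_fun setT (fun y : 'rV[R]_n.+1 => (F (enorm y) * (\1_S y)%:E)%E).
  apply: emeasurable_funM; first by apply: (measurableT_comp mF); exact: measurable_enorm.
  by apply/measurable_EFinP; exact: measurable_indic.
have FS0 (y : 'rV[R]_n.+1) : (0 <= F (enorm y) * (\1_S y)%:E)%E by rewrite mule_ge0// lee_fin.
have -> : (\int[leb n.+1]_(y in S) F (enorm y) = \int[leb n.+1]_y (F (enorm y) * (\1_S y)%:E))%E.
  by rewrite [LHS]integral_mkcond; apply: eq_integral => y _; rewrite epatch_indic.
rewrite integral_rV_cons_swap//.
apply: (@le_trans _ _ (\int[leb n]_(u in B) \int[mu]_(t in `]r, +oo[) F t)%E).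
  have -> : (\int[leb n]_(u in B) \int[mu]_(t in `]r, +oo[) F t =
      \int[mu]_(t in `]r, +oo[) F t * leb n B)%E by exact: integral_cst.
  by rewrite lB muleC.
rewrite integral_mkcond; apply: ge0_le_integral => //=.
- by move=> u _; rewrite patchE; case: ifP => // _; exact: integral_ge0.
- by apply/(measurable_restrict _ _ _).1 => //.
- exact: (measurable_fun_fubini_tonelli_G _ (measurable_rV_cons_comp mFS)).
- move=> u _; rewrite epatch_indic/= indicE.
  have [uB|uB] := pselect (B u); last by rewrite memNset// mule0 integral_ge0.
  rewrite mem_set//.
  rewrite mule1.
  apply: (@le_trans _ _ (\int[mu]_(t in `]enorm u, +oo[) F t)%E).
    apply: ge0_subset_integral => //.
    - exact: measurable_funTS.
    - move=> t; rewrite /= !in_itv/= !andbT; apply: le_lt_trans.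
      by apply: vr => i; have := uB i; rewrite /ball/= distrC.
  apply: (le_trans (le_integral_hypot mF F0 (enorm_ge0 u))).
  rewrite integral_mkcond; apply: ge0_le_integral => //=.
  + by move=> a _; rewrite patchE; case: ifP.
  + apply/(measurable_restrict _ _ _).1 => //.
    apply: measurable_funTS; apply: (measurableT_comp mF).
    exact: measurable_hypot.
  + apply: (measurableT_comp (measurable_rV_cons_comp mFS)).
    exact: pair2_measurable.
  + move=> a _; rewrite epatch_indic/= indicE enorm_cons.
    rewrite lee_wpmul2l// lee_fin indicE ler_nat.
    case: (boolP (a \in _)) => // /set_mem /=; rewrite in_itv/= andbT => a0.
    rewrite mem_set// SE rV_cons0; split => // i; rewrite rV_consS; exact: uB.
Qed.
End polar.

(** * Chaining and pointwise interpolation *)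

Section chaining.
Context {R : realType}.
Implicit Types (p q a e t x y : R).

Lemma powR_expR a x : 0 < a -> a `^ x = expR (x * ln a).
Proof. by move=> a0; rewrite /powR gt_eqF. Qed.

Lemma ln2_gt0 : 0 < ln 2 :> R.
Proof. by apply: ln_gt0; rewrite ltr1n. Qed.

Lemma powR_natX (k : nat) x : (2 ^+ k : R) `^ x = (2 `^ x) ^+ k.
Proof.
elim: k => [|k IH]; first by rewrite !expr0 powR1.
by rewrite !exprS powRM ?exprn_ge0// IH.
Qed.

Lemma geometric_mean3_le t A B E k l : 0 <= t -> 0 < A -> 0 < B -> 0 < E ->
  t <= A -> t <= B -> t <= E -> 0 <= k -> k <= l -> l <= 1 ->
  t <= A `^ k * B `^ (l - k) * E `^ (1 - l).
Proof.
rewrite le_eqVlt => /predU1P[<- *|t0 A0 B0 E0 tA tB tE k0 kl l1].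
  by rewrite !mulr_ge0// powR_ge0.
have -> : t = t `^ k * t `^ (l - k) * t `^ (1 - l).
  by rewrite !powR_expR// -!expRD -{1}(lnK t0); congr expR; ring.
have le b x : t <= b -> 0 < b -> 0 <= x -> t `^ x <= b `^ x.
  by move=> tb b0 x0; apply: ge0_ler_powR => //; rewrite nnegrE ltW.
by rewrite !ler_pM ?mulr_ge0 ?powR_ge0// le ?subr_ge0.
Qed.

Lemma dyadic_geometric_sum_le (r : R) (n : nat) : 0 <= r -> r < 1 ->
  \sum_(j < n) r ^+ j <= (1 - r)^-1.
Proof.
move=> r0 r1; rewrite -[leRHS]mul1r ler_pdivlMr ?subr_gt0//.
rewrite mulrC -[leLHS]opprK -mulNr opprB -subrX1 opprB gerBl; exact: exprn_ge0.
Qed.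

(** Each difference of consecutive [y j] obeys three bounds, with dependence 2^(-j sg), 2^(j (1/p -
    sg)) and 2^(j/q) on j. Their geometric mean with weights k, l - k and 1 - l is proportional to
    2^(-j eta), and eta > 0 is the last hypothesis; the telescoping sum is then dominated by a
    convergent geometric series, uniformly in n. *)
Lemma chaining_le (p q sg l k C1 : R) : 0 < p -> 0 < q -> 0 < C1 ->
  0 <= k -> k <= l -> l <= 1 -> 0 < sg * l - (l - k) / p - (1 - l) / q ->
  exists2 C2, 0 < C2 & forall (a e X fx w : R) (y : nat -> R) (n : nat),
    0 < a -> 0 < e -> 0 <= X ->
    (forall j, (j <= n)%N ->
      `|fx - y j| <= C1 * (a * (1 + X) `^ p^-1) * (2 ^+ j) `^ (- sg)) ->
    (forall j, (j < n)%N -> `|y j - y j.+1| <= C1 * a * (2 ^+ j) `^ (p^-1 - sg)) ->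
    (forall j, (j <= n)%N -> `|y j| <= C1 * e * (2 ^+ j) `^ q^-1) ->
    `|fx - y n| <= w ->
    `|fx - y 0%N| <= w + C2 * (a `^ l * e `^ (1 - l) * (1 + X) `^ (k / p)).
Proof.
move=> p0 q0 C10 k0 kl l1; set eta := (X in 0 < X) => eta0.
pose r : R := 2 `^ (- eta).
have r0 : 0 < r by rewrite powR_gt0.
have r1 : r < 1.
  by rewrite /r powR_expR// -[ltRHS]expR0 ltr_expR mulNr oppr_lt0 mulr_gt0// ln2_gt0.
(* [C3] dominates the constants of all three bounds, including the factor lost when the term of
   index j + 1 is compared with that of index j. *)
pose C3 := C1 * (1 + 2 `^ `|sg| + 2 `^ q^-1).
have C130 : C1 <= C3.
  by rewrite ler_peMr ?(ltW C10)// -addrA lerDl addr_ge0// powR_ge0.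
have C30 : 0 < C3 by apply: lt_le_trans C130.
exists (C3 * (1 - r)^-1); first by rewrite mulr_gt0// invr_gt0 subr_gt0.
move=> a e X fx w y n a0 e0 X0 HX HY HZ HW.
have X1 : 0 < 1 + X by rewrite ltr_pwDl.
pose G := a `^ l * e `^ (1 - l) * (1 + X) `^ (k / p).
have G0 : 0 < G by rewrite !mulr_gt0// powR_gt0.
have tj : forall j, (j < n)%N -> `|y j - y j.+1| <= C3 * G * r ^+ j.
  move=> j jn; have p2j : (0 : R) < 2 ^+ j by rewrite exprn_gt0.
  have HA : `|y j - y j.+1| <= C3 * (a * (1 + X) `^ p^-1) * (2 ^+ j) `^ (- sg).
    apply: (@le_trans _ _ (`|fx - y j| + `|fx - y j.+1|)).
      rewrite (_ : y j - y j.+1 = (fx - y j.+1) - (fx - y j)); last by ring.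
      by rewrite (le_trans (ler_normB _ _))// addrC.
    apply: (le_trans (lerD (HX _ (ltnW jn)) (HX _ jn))).
    rewrite exprS powRM ?exprn_ge0//.
    set A := a * _; set u := (2 ^+ j) `^ _.
    have A0 : 0 < A by rewrite mulr_gt0// powR_gt0.
    have u0 : 0 < u by rewrite powR_gt0.
    have le2 : 2 `^ (- sg) <= 2 `^ `|sg| :> R.
      by rewrite ler_powR ?ler1n// -normrN ler_norm.
    have q20 : 0 <= 2 `^ q^-1 :> R by exact: powR_ge0.
    rewrite (_ : _ + _ = C1 * (1 + 2 `^ (- sg)) * A * u); last by ring.
    rewrite !ler_wpM2r ?(ltW u0) ?(ltW A0)// /C3 ler_wpM2l ?(ltW C10)//; lra.
  have HB : `|y j - y j.+1| <= C3 * a * (2 ^+ j) `^ (p^-1 - sg).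
    apply: (le_trans (HY _ jn)); rewrite ler_wpM2r ?powR_ge0//.
    by rewrite ler_wpM2r// ltW.
  have HE : `|y j - y j.+1| <= C3 * e * (2 ^+ j) `^ q^-1.
    apply: (le_trans (ler_normB _ _)).
    apply: (le_trans (lerD (HZ _ (ltnW jn)) (HZ _ jn))).
    rewrite exprS powRM ?exprn_ge0//.
    have u0 : 0 < (2 ^+ j) `^ q^-1 :> R by rewrite powR_gt0.
    have q20 : 0 <= 2 `^ `|sg| :> R by exact: powR_ge0.
    set u := (2 ^+ j) `^ _ in u0 *.
    rewrite (_ : _ + _ = C1 * (1 + 2 `^ q^-1) * e * u); last by ring.
    rewrite !ler_wpM2r ?(ltW u0) ?(ltW e0)// /C3 ler_wpM2l ?(ltW C10)//; lra.
  have := geometric_mean3_le (normr_ge0 _) _ _ _ HA HB HE k0 kl l1.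
  rewrite !mulr_gt0 ?powR_gt0// => /(_ isT isT isT) /le_trans; apply.
  clearbody C3.
  rewrite /G (_ : r ^+ j = (2 ^+ j) `^ (- eta)); last by rewrite /r powR_natX.
  set P := 2 ^+ j in p2j *; set Y := 1 + X in X1 *.
  have Yp : 0 < Y `^ p^-1 by rewrite powR_gt0.
  rewrite (powR_expR _ (mulr_gt0 (mulr_gt0 C30 (mulr_gt0 a0 Yp)) (powR_gt0 (- sg) p2j))).
  rewrite (powR_expR _ (mulr_gt0 (mulr_gt0 C30 a0) (powR_gt0 (p^-1 - sg) p2j))).
  rewrite (powR_expR _ (mulr_gt0 (mulr_gt0 C30 e0) (powR_gt0 q^-1 p2j))).
  rewrite !lnM ?posrE ?mulr_gt0 ?powR_gt0// !ln_powR.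
  rewrite !powR_expR// -[C3 in leRHS](lnK C30) -!expRD ler_expR.
  rewrite le_eqVlt; apply/orP; left; apply/eqP.
  rewrite /eta; field.
  by rewrite ?gt_eqF.
have sumle m : (m <= n)%N -> `|y 0%N - y m| <= \sum_(j < m) (C3 * G * r ^+ j).
  elim: m => [|m IH] mn; first by rewrite big_ord0 subrr normr0.
  rewrite big_ord_recr/= -(subrK (y m) (y 0%N)) -addrA (le_trans (ler_normD _ _))//.
  by rewrite lerD ?tj// IH// ltnW.
rewrite -(subrK (y n) fx) -addrA (le_trans (ler_normD _ _))// lerD//.
rewrite distrC (le_trans (sumle _ (leqnn _)))// -mulr_sumr.
rewrite -/G (_ : C3 / (1 - r) * G = C3 * G * (1 - r)^-1); last by rewrite mulrAC.
apply: ler_wpM2l; first by apply: mulr_ge0; exact: ltW.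
by apply: dyadic_geometric_sum_le => //; exact: ltW.
Qed.

(** The endpoint l = 1, k = 1 - sg p of the chaining: there eta = 0 and the geometric mean is no
    longer summable. As in Hedberg's argument the sum is cut where 2^j is comparable to 1 + X.
    Coarser differences form a growing geometric series dominated by its last term; all the finer
    ones are bounded at once by the first hypothesis on [fx - y j]. *)
Lemma chaining_critical_le (p sg C1 : R) : 0 < p -> 0 < sg -> 0 < C1 -> sg * p < 1 ->
  exists2 C2, 0 < C2 & forall (a X fx w : R) (y : nat -> R) (n : nat),
    0 < a -> 0 <= X ->
    (forall j, (j <= n)%N ->
      `|fx - y j| <= C1 * (a * (1 + X) `^ p^-1) * (2 ^+ j) `^ (- sg)) ->
    (forall j, (j < n)%N -> `|y j - y j.+1| <= C1 * a * (2 ^+ j) `^ (p^-1 - sg)) ->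
    `|fx - y n| <= w ->
    `|fx - y 0%N| <= w + C2 * (a * (1 + X) `^ (p^-1 - sg)).
Proof.
move=> p0 sg0 C10 sgp; pose b := p^-1 - sg.
have b0 : 0 < b by rewrite subr_gt0 -[p^-1]mul1r ltr_pdivlMr.
pose r : R := 2 `^ b.
have r1 : 1 < r.
  by rewrite /r powR_expR// -[ltLHS]expR0 ltr_expR mulr_gt0// ln2_gt0.
have r10 : 0 < r - 1 by rewrite subr_gt0.
pose K := C1 / (r - 1).
have K0 : 0 < K by rewrite divr_gt0.
exists (K + C1 * 2 `^ sg); first by rewrite addr_gt0// mulr_gt0// powR_gt0.
move=> a X fx w y n a0 X0 HX HY HW.
have X1 : 1 <= 1 + X by rewrite lerDl.
have X10 : 0 < 1 + X by exact: lt_le_trans X1.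
have w0 : 0 <= w by apply: le_trans HW.
have sumle m : (m <= n)%N -> `|y 0%N - y m| <= K * a * r ^+ m.
  elim: m => [|m IH] mn.
    by rewrite subrr normr0 expr0 mulr1 mulr_ge0// ltW.
  rewrite -(subrK (y m) (y 0%N)) -addrA (le_trans (ler_normD _ _))//.
  apply: (le_trans (lerD (IH (ltnW mn)) (HY _ mn))).
  rewrite powR_natX -/b -/r exprS.
  rewrite (_ : K * a * (r * r ^+ m) = K * a * r ^+ m + K * (r - 1) * a * r ^+ m); last by ring.
  by rewrite lerD2l /K divfK// gt_eqF.
(* The cut index, or n itself when 2^n is still below 1 + X; in that case the terminal bound w takes
   over. *)
have [j jn [j1 j2]] : exists2 j, (j <= n)%N & (2 ^+ j <= 1 + X) /\ (j = n \/ 1 + X < 2 ^+ j.+1).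
  elim: n {HX HY HW sumle} => [|n [j jn [j1 j2]]].
    by exists 0%N => //; rewrite expr0; split => //; left.
  case: j2 => [jn'|j2]; last by exists j; [exact: leqW|split => //; right].
  have [h|h] := leP (2 ^+ n.+1) (1 + X); first by exists n.+1 => //; split => //; left.
  by exists n => //; rewrite -jn'; split => //; right; rewrite jn'.
have yj : `|y j - y 0%N| <= K * a * (1 + X) `^ b.
  rewrite distrC (le_trans (sumle _ jn))//.
  have Ka : 0 <= K * a by rewrite mulr_ge0// ltW.
  rewrite ler_wpM2l//.
  rewrite /r -powR_natX ge0_ler_powR ?nnegrE ?exprn_ge0 ?(ltW b0) ?(ltW X10)//.
have {}yj : `|y j - y 0%N| <= K * (a * (1 + X) `^ b) by rewrite mulrA.
have tri : `|fx - y 0%N| <= `|fx - y j| + `|y j - y 0%N| := ler_distD _ _ _.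
have CT0 : 0 <= C1 * 2 `^ sg * (a * (1 + X) `^ b).
  by rewrite !mulr_ge0 ?powR_ge0// ltW.
apply: (le_trans tri); rewrite mulrDl -/b.
case: j2 => [jE|j2].
  by rewrite jE in yj *; rewrite addrA; apply: ler_wpDr => //; exact: lerD.
apply: ler_wpDl => //; rewrite addrC; apply: lerD => //.
apply: (le_trans (HX _ jn)).
rewrite (_ : _ * (2 ^+ j) `^ (- sg) = C1 * a * ((1 + X) `^ p^-1 * (2 ^+ j) `^ (- sg))); last by ring.
rewrite (_ : C1 * 2 `^ sg * _ = C1 * a * (2 `^ sg * (1 + X) `^ b)); last by ring.
apply: ler_wpM2l; first by apply: mulr_ge0; exact: ltW.
have jj : (1 + X) / 2 <= 2 ^+ j by rewrite ler_pdivrMr// -exprSr ltW.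
have X20 : 0 < (1 + X) / 2 by rewrite divr_gt0.
apply: (@le_trans _ _ ((1 + X) `^ p^-1 * ((1 + X) / 2) `^ (- sg))).
  rewrite ler_wpM2l ?powR_ge0// !powRN lef_pV2 ?posrE ?powR_gt0 ?exprn_gt0//.
  by rewrite ge0_ler_powR ?nnegrE ?exprn_ge0 ?(ltW sg0) ?(ltW X20).
rewrite !powR_expR// -!expRD ler_expR lnM ?posrE ?invr_gt0// lnV ?posrE//.
rewrite le_eqVlt; apply/orP; left; apply/eqP; rewrite /b; ring.
Qed.

(* [fx] stands for a value [f x], [y j] for the average of [f] on an interval of
   length comparable to [2^-j] around [x], and [X] for the value at [x] of a
   normalized density of the fractional energy of [f]. *)
Definition chaining_bound (p q sg l k : R) := forall C1, 0 < C1 ->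
  exists2 C2, 0 < C2 & forall (a e X fx w : R) (y : nat -> R) (n : nat),
    0 < a -> 0 < e -> 0 <= X ->
    (forall j, (j <= n)%N ->
      `|fx - y j| <= C1 * (a * (1 + X) `^ p^-1) * (2 ^+ j) `^ (- sg)) ->
    (forall j, (j < n)%N -> `|y j - y j.+1| <= C1 * a * (2 ^+ j) `^ (p^-1 - sg)) ->
    (forall j, (j <= n)%N -> `|y j| <= C1 * e * (2 ^+ j) `^ q^-1) ->
    `|fx - y n| <= w ->
    `|fx - y 0%N| <= w + C2 * (a `^ l * e `^ (1 - l) * (1 + X) `^ (k / p)).

Lemma chaining_bound_critical p q sg : 0 < p -> 0 < sg -> sg * p < 1 ->
  chaining_bound p q sg 1 (1 - sg * p).
Proof.
move=> p0 sg0 sgp C1 C10.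
have [C2 C20 H] := chaining_critical_le p0 sg0 C10 sgp.
exists C2 => // a e X fx w y n a0 e0 X0 HX HY _ HW.
rewrite powRr1 ?(ltW a0)// subrr powRr0 mulr1 mulrBl mul1r mulfK ?gt_eqF//.
exact: H HY HW.
Qed.

(** Write T^g = (T^g)^m (T^g)^(1 - m), use the chaining bound in the first factor and T = e Y^(1/q),
    Y = (T/e)^q, in the second. The remaining powers of 1 + X and Y are at most powers of 1 + X + Y
    >= 1 of total exponent at most 1. The outcome is linear in X and Y, hence ready to be
    integrated. *)
Lemma interpolation_pointwise (p q g l k m C a e X T : R) :
  0 < p -> 0 < q -> 0 < g -> 0 <= k -> 0 <= m -> m <= 1 ->
  k * g * m / p + g * (1 - m) / q <= 1 ->
  0 < C -> 0 < a -> 0 < e -> 0 <= X -> 0 <= T ->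
  T <= C * (a `^ l * e `^ (1 - l) * (1 + X) `^ (k / p)) ->
  T `^ g <= C `^ (g * m) * (a `^ (l * m) * e `^ (1 - l * m)) `^ g *
    (1 + X + (T / e) `^ q).
Proof.
move=> p0 q0 g0 k0 m0 m1 kgm C0 a0 e0 X0; rewrite le_eqVlt => /predU1P[<- _|T0 Tle].
  by rewrite powR0 ?gt_eqF// !mulr_ge0 ?powR_ge0// !addr_ge0 ?powR_ge0.
have X1 : 0 < 1 + X by rewrite ltr_pwDl.
set Y := (T / e) `^ q.
have Te : 0 < T / e by rewrite divr_gt0.
have Y0 : 0 < Y by rewrite powR_gt0.
have Z0 : 0 < 1 + X + Y by rewrite addr_gt0.
have ap l' : 0 < a `^ l' by rewrite powR_gt0.
have ep l' : 0 < e `^ l' by rewrite powR_gt0.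
have Xp l' : 0 < (1 + X) `^ l' by rewrite powR_gt0.
have lnT : ln T <= ln C + l * ln a + (1 - l) * ln e + k / p * ln (1 + X).
  rewrite (le_trans (y := ln (C * (a `^ l * e `^ (1 - l) * (1 + X) `^ (k / p)))))//.
    by rewrite ler_ln ?posrE ?mulr_gt0.
  by rewrite !lnM ?posrE ?mulr_gt0// !ln_powR !addrA.
have lnTY : ln T = ln e + ln Y / q.
  rewrite /Y ln_powR lnM ?posrE ?invr_gt0// lnV ?posrE//; field.
  by rewrite gt_eqF.
have lnZ0 : 0 <= ln (1 + X + Y) by rewrite ln_ge0// -addrA lerDl addr_ge0// ltW.
have lnXZ : ln (1 + X) <= ln (1 + X + Y) by rewrite ler_ln ?posrE// lerDl ltW.
have lnYZ : ln Y <= ln (1 + X + Y) by rewrite ler_ln ?posrE// lerDr ltW.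
rewrite -ler_ln ?posrE ?mulr_gt0 ?powR_gt0 ?mulr_gt0//.
rewrite !lnM ?posrE ?mulr_gt0 ?powR_gt0 ?mulr_gt0// !ln_powR lnM ?posrE// !ln_powR.
set L := ln (1 + X + Y) in lnZ0 lnXZ lnYZ *.
have -> : g * ln T = g * m * ln T + g * (1 - m) * ln T by ring.
have gm0 : 0 <= g * m by rewrite mulr_ge0// ltW.
have gm1 : 0 <= g * (1 - m) by rewrite mulr_ge0 ?subr_ge0// ltW.
have h1 := ler_wpM2l gm0 lnT.
have h2 : k * g * m / p * ln (1 + X) <= k * g * m / p * L.
  apply: ler_wpM2l => //; apply: divr_ge0; last exact: ltW.
  by rewrite -mulrA mulr_ge0.
have h3 : g * (1 - m) / q * ln Y <= g * (1 - m) / q * L.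
  by apply: ler_wpM2l => //; apply: divr_ge0 => //; exact: ltW.
have h4 := ler_wpM2r lnZ0 kgm.
rewrite mul1r mulrDl in h4.
rewrite [X in _ + g * (1 - m) * X <= _]lnTY.
apply: (le_trans (lerD h1 (lexx _))).
rewrite [leLHS](_ : _ = g * m * ln C + g * (l * m * ln a + (1 - l * m) * ln e) +
  (k * g * m / p * ln (1 + X) + g * (1 - m) / q * ln Y)); last by field; rewrite !gt_eqF.
rewrite lerD2l; exact: le_trans (lerD h2 h3) h4.
Qed.
End chaining.

(** * Averages over intervals and energies near the diagonal *)

Section averages.
Context {R : realType}.
Notation mu := (@lebesgue_measure R).
Implicit Types (f : R -> R) (a b k p : R).

Definition avg f a b : R := (b - a)^-1 * (\int[mu]_(x in `[a, b]) f x)%R.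

Lemma measurable_powR_norm (d : measure_display) (T : measurableType d)
  (f : T -> R) (p : R) : measurable_fun setT f ->
  measurable_fun setT (fun x => (`|f x| `^ p)%:E).
Proof.
move=> mf; apply/measurable_EFinP; apply: (measurableT_comp (measurable_powR p)).
by apply: measurableT_comp => //; exact: normr_measurable.
Qed.

Lemma integrable_segment f a b : continuous f -> mu.-integrable `[a, b] (EFin \o f).
Proof.
move=> cf; apply: continuous_compact_integrable; first exact: segment_compact.
exact: continuous_subspaceT.
Qed.

Lemma lebesgue_measure_cc a b : a < b -> mu `[a, b]%classic = (b - a)%:E.
Proof. by move=> ab; rewrite lebesgue_measure_itv/= lte_fin ab EFinB. Qed.

Lemma norm_sub_avg_le f a b k : a < b -> continuous f ->
  (`|k - avg f a b|%:E <= (b - a)^-1%:E * \int[mu]_(x in `[a, b]) `|k - f x|%:E)%E.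
Proof.
move=> ab cf; have ba0 : 0 < b - a by rewrite subr_gt0.
have if_ := integrable_segment a b cf.
have ik : mu.-integrable `[a, b] (EFin \o cst k).
  by apply: integrable_segment => x; exact: cvg_cst.
have ikf : mu.-integrable `[a, b] (EFin \o (fun x => k - f x)).
  by apply: integrable_segment => x; apply: cvgB; [exact: cvg_cst|exact: cf].
have -> : k - avg f a b = (b - a)^-1 * (\int[mu]_(x in `[a, b]) (k - f x))%R.
  have Ek : (\int[mu]_(x in `[a, b]) cst k x)%R = k * (b - a).
    rewrite Rintegral_cst//; congr (k * _).
    by rewrite -[RHS]/(fine (b - a)%:E) -(lebesgue_measure_cc ab).
  rewrite (RintegralB _ ik if_)// Ek mulrBr /avg; congr (_ - _).
  by rewrite mulrCA mulVf ?mulr1// gt_eqF.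
rewrite normrM gtr0_norm ?invr_gt0// EFinM.
apply: lee_pmul => //.
- by rewrite lee_fin invr_ge0 ltW.
apply: (@le_trans _ _ (\int[mu]_(x in `[a, b]) `|k - f x|)%R%:E).
  by rewrite lee_fin; apply: le_normr_Rintegral.
rewrite /Rintegral fineK//.
have := integrable_norm ikf.
by move=> /integrable_fin_num; apply.
Qed.

(** For h > K the last term alone is at least h. Integrating this with a K adapted to the integral
    of h^p gives a substitute for Hoelder's inequality at the price of a factor 2. *)
Lemma le_powR_scaled (h K p : R) : 0 <= h -> 0 < K -> 1 <= p ->
  h <= K + K `^ (1 - p) * h `^ p.
Proof.
move=> h0 K0 p1; have [hK|Kh] := leP h K.
  by rewrite ler_wpDr// mulr_ge0// powR_ge0.
have {}h0 : 0 < h by apply: lt_trans Kh.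
apply: ler_wpDl; first exact: ltW.
apply: (@le_trans _ _ (h `^ (1 - p) * h `^ p)).
  by rewrite !powR_expR// -expRD -mulrDl subrK mul1r lnK.
rewrite ler_wpM2r ?powR_ge0// -opprB !powRN lef_pV2 ?posrE ?powR_gt0//.
by rewrite ge0_ler_powR ?nnegrE ?subr_ge0 ?(ltW K0) ?(ltW h0) ?(ltW Kh).
Qed.

Lemma integral_le_powR (D : set R) (h : R -> R) (l p v : R) : measurable D ->
  measurable_fun setT h -> (forall x, 0 <= h x) -> 1 <= p -> 0 < l -> 0 < v ->
  (mu D <= l%:E -> \int[mu]_(x in D) (h x `^ p)%:E <= v%:E ->
  \int[mu]_(x in D) (h x)%:E <= (2 * l * (v / l) `^ p^-1)%:E)%E.
Proof.
move=> mD mh h0 p1 l0 v0 Dl hv.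
have p0 : 0 < p by apply: lt_le_trans p1.
pose K := (v / l) `^ p^-1.
have K0 : 0 < K by rewrite powR_gt0// divr_gt0.
have mhp : measurable_fun setT (fun x => (h x `^ p)%:E).
  by apply/measurable_EFinP; apply: (measurableT_comp (measurable_powR p)).
apply: (@le_trans _ _ (\int[mu]_(x in D) (K%:E + (K `^ (1 - p))%:E * (h x `^ p)%:E))%E).
  apply: ge0_le_integral => //.
  - by move=> x _; rewrite lee_fin.
  - by apply: measurable_funTS; apply/measurable_EFinP.
  - apply: measurable_funTS; apply: emeasurable_funD => //.
    by apply: measurable_funeM.
  - by move=> x _; rewrite -EFinM -EFinD lee_fin le_powR_scaled.
rewrite ge0_integralD//; last 3 first.
- by move=> x _; rewrite lee_fin ltW.
- by move=> x _; rewrite -EFinM lee_fin mulr_ge0// powR_ge0.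
- by apply: measurable_funTS; apply: measurable_funeM.
rewrite integral_cst// ge0_integralZl//; last 3 first.
- exact: measurable_funTS.
- by move=> x _; rewrite lee_fin powR_ge0.
- by rewrite lee_fin powR_ge0.
apply: (@le_trans _ _ (K%:E * l%:E + (K `^ (1 - p))%:E * v%:E)%E).
  by apply: leeD; apply: lee_wpmul2l; rewrite // lee_fin ?powR_ge0 ?ltW.
rewrite -!EFinM -EFinD lee_fin -/K.
have -> : v = l * K `^ p.
  rewrite -powRrM mulVf ?gt_eqF// powRr1 ?divr_ge0 ?ltW//.
  by rewrite mulrC divfK// gt_eqF.
rewrite mulrCA -powRD; last by rewrite (gt_eqF K0) implybT.
rewrite subrK powRr1 ?(ltW K0)//; lra.
Qed.

Lemma avg_powR_le f a b k p : a < b -> continuous f -> 1 <= p ->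
  ((`|k - avg f a b| `^ p)%:E <=
   (2 `^ p / (b - a))%:E * \int[mu]_(x in `[a, b]) (`|k - f x| `^ p)%:E)%E.
Proof.
move=> ab cf p1; have ba0 : 0 < b - a by rewrite subr_gt0.
have p0 : 0 < p by apply: lt_le_trans p1.
have mf : measurable_fun setT f by exact: continuous_measurable_fun.
have mkf : measurable_fun setT (fun x => `|k - f x|).
  apply: (measurableT_comp (@normr_measurable R setT)).
  exact: measurable_funB.
have : (0 <= \int[mu]_(x in `[a, b]) (`|k - f x| `^ p)%:E)%E.
  by apply: integral_ge0 => x _; rewrite lee_fin powR_ge0.
case E : (\int[mu]_(x in `[a, b]) (`|k - f x| `^ p)%:E)%E => [v| |] //; last first.
  by move=> _; rewrite gt0_muley ?leey// lte_fin divr_gt0// powR_gt0.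
rewrite lee_fin => v0.
(* [integral_le_powR] asks for a positive bound while the integral v may vanish; so any B > v is
   used, and B tends to v at the end. *)
have H B : v < B -> `|k - avg f a b| `^ p <= 2 `^ p / (b - a) * B.
  move=> vB; have B0 : 0 < B by apply: le_lt_trans vB.
  have h1 := norm_sub_avg_le k ab cf.
  have := @integral_le_powR `[a, b]%classic (fun x => `|k - f x|) (b - a) p B.
  rewrite E => /(_ _ mkf _ p1 ba0 B0 _ _) h2.
  have {}h2 : (\int[mu]_(x in `[a, b]) `|k - f x|%:E <= (2 * (b - a) * (B / (b - a)) `^ p^-1)%:E)%E.
    by apply: h2 => //; [rewrite lebesgue_measure_cc|rewrite lee_fin ltW].
  have h3 : `|k - avg f a b| <= 2 * (B / (b - a)) `^ p^-1.
    rewrite -lee_fin; apply: (le_trans h1).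
    apply: (@le_trans _ _ ((b - a)^-1%:E * (2 * (b - a) * (B / (b - a)) `^ p^-1)%:E)%E).
      by apply: lee_wpmul2l => //; rewrite lee_fin invr_ge0 ltW.
    rewrite -EFinM lee_fin; set t := _ `^ _.
    by rewrite [2 * _]mulrC -mulrA mulKf// gt_eqF.
  apply: (@le_trans _ _ ((2 * (B / (b - a)) `^ p^-1) `^ p)).
    by rewrite ge0_ler_powR ?nnegrE ?mulr_ge0 ?powR_ge0 ?(ltW p0).
  rewrite powRM ?powR_ge0// -powRrM mulVf ?gt_eqF// powRr1; last first.
    by rewrite divr_ge0 ?(ltW B0) ?(ltW ba0).
  by rewrite mulrA mulrAC.
rewrite -EFinM lee_fin; apply/ler_addgt0Pr => e e0.
have c0 : 0 < 2 `^ p / (b - a) by rewrite divr_gt0// powR_gt0.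
set c := 2 `^ p / (b - a) in c0 H *.
have := H (v + e / c).
by rewrite mulrDr (mulrCA c) divff ?gt_eqF// mulr1; apply; rewrite ltrDl divr_gt0.
Qed.

Lemma measurable_dist2 f p : continuous f ->
  measurable_fun setT (fun z : measurableTypeR R * measurableTypeR R =>
    (`|f z.1 - f z.2| `^ p)%:E).
Proof.
move=> cf; have mf : measurable_fun setT f by exact: continuous_measurable_fun.
apply: measurable_powR_norm; apply: measurable_funB.
- by apply: (measurableT_comp mf); exact: measurable_fst.
- by apply: (measurableT_comp mf); exact: measurable_snd.
Qed.

Lemma avg_avg_powR_le f a b a' b' p : a < b -> a' < b' -> continuous f -> 1 <= p ->
  ((`|avg f a b - avg f a' b'| `^ p)%:E <=
   (4 `^ p / ((b - a) * (b' - a')))%:E * \int[mu]_(x in `[a, b])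
     \int[mu]_(y in `[a', b']) (`|f x - f y| `^ p)%:E)%E.
Proof.
move=> ab ab' cf p1; rewrite distrC.
have ba0 : 0 < b - a by rewrite subr_gt0.
have ba0' : 0 < b' - a' by rewrite subr_gt0.
apply: (le_trans (avg_powR_le _ ab cf p1)).
have mI : measurable_fun setT (fun x => \int[mu]_(y in `[a', b']) (`|f x - f y| `^ p)%:E)%E.
  apply: (@measurable_integral_in _ _ _ _ _ mu (fun z : measurableTypeR R * measurableTypeR R =>
    (`|f z.1 - f z.2| `^ p)%:E)) => //.
  exact: measurable_dist2.
have mf : measurable_fun setT f by exact: continuous_measurable_fun.
rewrite (_ : 4 `^ p = 2 `^ p * 2 `^ p); last first.
  by rewrite -powRM//; congr (_ `^ _); ring.
rewrite invfM mulrACA [in leRHS]EFinM -[in leRHS]muleA.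
apply: lee_wpmul2l; first by rewrite lee_fin divr_ge0 ?powR_ge0 ?ltW.
rewrite -ge0_integralZl//; last 3 first.
- exact: measurable_funTS.
- by move=> x _; apply: integral_ge0 => y _; rewrite lee_fin powR_ge0.
- by rewrite lee_fin divr_ge0 ?powR_ge0 ?ltW.
apply: ge0_le_integral => //.
- by apply: measurable_funTS; apply: measurable_powR_norm; exact: measurable_funB.
- by apply: measurable_funTS; exact: measurable_funeM.
- by move=> x _; rewrite distrC; exact: avg_powR_le.
Qed.

Definition near_diag (del : R) : set (measurableTypeR R * measurableTypeR R) :=
  [set z | `|z.1 - z.2| < del].

Lemma measurable_near_diag del : measurable (near_diag del).
Proof.
have mh : measurable_fun setT (fun z : measurableTypeR R * measurableTypeR R => `|z.1 - z.2|).
  apply: (measurableT_comp (@normr_measurable R setT)).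
  by apply: measurable_funB; [exact: measurable_fst|exact: measurable_snd].
rewrite (_ : near_diag del = (fun z : measurableTypeR R * measurableTypeR R => `|z.1 - z.2|) @^-1` `]-oo, del[).
  by rewrite -[X in measurable X]setTI; apply: mh.
by apply/seteqP; split => z; rewrite /near_diag/= in_itv.
Qed.

Definition near_dist f p del (z : measurableTypeR R * measurableTypeR R) : \bar R :=
  (`|f z.1 - f z.2| `^ p * \1_(near_diag del) z)%:E.

Definition near_energy f p a b del : \bar R :=
  (\int[mu]_(x in `[a, b]) \int[mu]_(y in `[a, b]) near_dist f p del (x, y))%E.

Lemma near_dist_ge0 f p del z : (0 <= near_dist f p del z)%E.
Proof. by rewrite lee_fin mulr_ge0 ?powR_ge0. Qed.

Lemma measurable_near_dist f p del : measurable_fun setT f ->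
  measurable_fun setT (near_dist f p del).
Proof.
move=> mf; apply/measurable_EFinP; apply: measurable_funM; last first.
  by apply: measurable_indic; exact: measurable_near_diag.
apply: (measurableT_comp (measurable_powR p)).
apply: (measurableT_comp (@normr_measurable R setT)); apply: measurable_funB.
- by apply: (measurableT_comp mf); exact: measurable_fst.
- by apply: (measurableT_comp mf); exact: measurable_snd.
Qed.

Lemma measurable_near_dist_inner f p del a b : measurable_fun setT f ->
  measurable_fun setT (fun x => \int[mu]_(y in `[a, b]) near_dist f p del (x, y))%E.
Proof.
move=> mf; apply: (@measurable_integral_in _ _ _ _ _ mu (near_dist f p del)) => //.
- exact: measurable_near_dist.
- exact: near_dist_ge0.
Qed.

Lemma near_distE f p del x y : `|x - y| < del ->
  near_dist f p del (x, y) = (`|f x - f y| `^ p)%:E.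
Proof. by move=> xy; rewrite /near_dist indicE mem_set ?mulr1. Qed.

Lemma integral_near_dist_le f p del a b a' b' x : measurable_fun setT f ->
  a <= a' -> b' <= b -> (forall y, a' <= y <= b' -> `|x - y| < del) ->
  (\int[mu]_(y in `[a', b']) (`|f x - f y| `^ p)%:E <=
   \int[mu]_(y in `[a, b]) near_dist f p del (x, y))%E.
Proof.
move=> mf aa bb xy.
have mx : measurable_fun setT (fun y : measurableTypeR R => near_dist f p del (x, y)).
  by apply: (measurableT_comp (measurable_near_dist p del mf)).
apply: (@le_trans _ _ (\int[mu]_(y in `[a', b']) near_dist f p del (x, y))%E).
  apply: ge0_le_integral => //.
  - by apply: measurable_funTS; apply: measurable_powR_norm; exact: measurable_funB.
  - exact: measurable_funTS.
  - by move=> y; rewrite /= in_itv/= => /xy ?; rewrite near_distE.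
apply: ge0_subset_integral => //.
- exact: measurable_funTS.
- by move=> y _; exact: near_dist_ge0.
- move=> y; rewrite /= !in_itv/= => /andP[? ?].
  by rewrite (le_trans aa)//= (le_trans _ bb).
Qed.

Lemma integral2_near_dist_le f p del a b a1 b1 a2 b2 : measurable_fun setT f ->
  a <= a1 -> b1 <= b -> a <= a2 -> b2 <= b ->
  (forall x y, a1 <= x <= b1 -> a2 <= y <= b2 -> `|x - y| < del) ->
  (\int[mu]_(x in `[a1, b1]) \int[mu]_(y in `[a2, b2]) (`|f x - f y| `^ p)%:E <=
   near_energy f p a b del)%E.
Proof.
move=> mf aa1 bb1 aa2 bb2 xy.
have mI := @measurable_near_dist_inner f p del a b mf.
apply: (@le_trans _ _ (\int[mu]_(x in `[a1, b1]) \int[mu]_(y in `[a, b]) near_dist f p del (x, y))%E).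
  apply: ge0_le_integral => //.
  - by move=> x _; apply: integral_ge0 => y _; rewrite lee_fin powR_ge0.
  - apply: measurable_funTS.
    apply: (@measurable_integral_in _ _ _ _ _ mu (fun z : measurableTypeR R * measurableTypeR R =>
      (`|f z.1 - f z.2| `^ p)%:E)) => //.
    apply: measurable_powR_norm; apply: measurable_funB.
    + by apply: (measurableT_comp mf); exact: measurable_fst.
    + by apply: (measurableT_comp mf); exact: measurable_snd.
  - exact: measurable_funTS.
  - move=> x; rewrite /= in_itv/= => xab; apply: integral_near_dist_le => // y yab.
    exact: xy.
apply: ge0_subset_integral => //.
- exact: measurable_funTS.
- by move=> x _; apply: integral_ge0 => y _; exact: near_dist_ge0.
- move=> y; rewrite /= !in_itv/= => /andP[? ?].
  by rewrite (le_trans aa1)//= (le_trans _ bb1).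
Qed.

End averages.

Ltac posr := by repeat first [assumption | apply: mulr_gt0 | apply: divr_gt0
  | rewrite invr_gt0 | apply: powR_gt0 | apply: exprn_gt0 | done].
Ltac ln_expand := repeat first [rewrite ln_powR
  | rewrite lnM; [|rewrite posrE; posr|rewrite posrE; posr]
  | rewrite lnV; [|rewrite posrE; posr]].

(** * The interpolation inequality on an annulus *)

Section annulus.
Context {R : realType}.
Notation mu := (@lebesgue_measure R).
Implicit Types (f : R -> R) (a b k p q sg r x e A H : R).

Lemma ln_eq (u v : R) : 0 < u -> 0 < v -> ln u = ln v -> u = v.
Proof. by move=> u0 v0 uv; rewrite -(lnK u0) uv lnK. Qed.

(** A dyadic discretization of the one-dimensional Gagliardo energy of order sg on [r, 4r]: for x <>
    y, the weights of the scales exceeding |x - y| add up to about |x - y|^(-(1 + sg p)). The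
    interval spans two consecutive annuli, so that their means can be compared. *)
Definition dyadic_energy_le f p sg r A := forall n : nat,
  (\sum_(j < n) (((r * 4 / 2 ^+ j) `^ (- (1 + sg * p)))%:E *
     near_energy f p r (r * 4) (r * 4 / 2 ^+ j)) <= A%:E)%E.

Lemma near_energy_ge0 f p a b del : (0 <= near_energy f p a b del)%E.
Proof.
by apply: integral_ge0 => x _; apply: integral_ge0 => y _; exact: near_dist_ge0.
Qed.

Lemma near_energy_le f p sg r A j : 0 < r -> dyadic_energy_le f p sg r A ->
  (near_energy f p r (r * 4) (r * 4 / 2 ^+ j) <=
   (A * (r * 4 / 2 ^+ j) `^ (1 + sg * p))%:E)%E.
Proof.
move=> r0 /(_ j.+1); rewrite big_ord_recr/= => H.
have d0 : 0 < r * 4 / 2 ^+ j by rewrite divr_gt0 ?mulr_gt0// exprn_gt0.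
have {}H : (((r * 4 / 2 ^+ j) `^ (- (1 + sg * p)))%:E *
   near_energy f p r (r * 4) (r * 4 / 2 ^+ j) <= A%:E)%E.
  apply: le_trans H; apply: leeDr; apply: sume_ge0 => i _.
  by rewrite mule_ge0 ?near_energy_ge0// lee_fin powR_ge0.
by move: H; rewrite powRN lee_pdivrMl ?powR_gt0// -EFinM [_ * A]mulrC.
Qed.

Section shrinking.
Variables (r x : R) (j : nat).
Hypotheses (r0 : 0 < r) (xr : r <= x <= r * 2).
(* The interval [[lo, hi]] has length [r / 2 ^+ j] and stays inside [[r, 2 r]]
   wherever [x] is. *)
Definition lo := x - (x - r) / 2 ^+ j.
Definition hi := x + (r * 2 - x) / 2 ^+ j.

Let p2 : (0 : R) < 2 ^+ j. Proof. by rewrite exprn_gt0. Qed.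
Let p21 : (1 : R) <= 2 ^+ j. Proof. by rewrite exprn_ege1// ler1n. Qed.

Lemma hi_lo : hi - lo = r / 2 ^+ j.
Proof. by rewrite /hi /lo; field; rewrite gt_eqF. Qed.

Lemma lt_lo_hi : lo < hi.
Proof. by rewrite -subr_gt0 hi_lo divr_gt0. Qed.

Lemma lo_ge : r <= lo.
Proof.
move: xr => /andP[rx _]; rewrite /lo.
have : (x - r) / 2 ^+ j <= x - r by rewrite ler_pdivrMr// ler_peMr// subr_ge0.
lra.
Qed.

Lemma hi_le : hi <= r * 2.
Proof.
move: xr => /andP[_ rx]; rewrite /hi.
have : (r * 2 - x) / 2 ^+ j <= r * 2 - x by rewrite ler_pdivrMr// ler_peMr// subr_ge0.
lra.
Qed.

Lemma lo_x_hi : lo <= x <= hi.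
Proof.
move: xr => /andP[rx xr2]; rewrite /lo /hi.
have h1 : 0 <= (x - r) / 2 ^+ j by rewrite divr_ge0 ?subr_ge0// ltW.
have h2 : 0 <= (r * 2 - x) / 2 ^+ j by rewrite divr_ge0 ?subr_ge0// ltW.
by apply/andP; split; lra.
Qed.

Lemma shrinking_dist y z : lo <= y <= hi -> lo <= z <= hi -> `|y - z| < r * 4 / 2 ^+ j.
Proof.
have h := hi_lo => /andP[a1 a2] /andP[b1 b2].
have h0 : 0 < r / 2 ^+ j by rewrite divr_gt0.
rewrite (_ : r * 4 / 2 ^+ j = 4 * (r / 2 ^+ j)); last by rewrite mulrAC mulrC.
by rewrite ltr_norml; apply/andP; split; lra.
Qed.

End shrinking.

Lemma shrinking_sub (r x : R) (j : nat) : 0 < r -> r <= x <= r * 2 ->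
  lo r x j <= lo r x j.+1 /\ hi r x j.+1 <= hi r x j.
Proof.
move=> r0 /andP[rx xr2]; rewrite /lo /hi exprS invfM.
have p2 : (0 : R) <= (2 ^+ j)^-1 by rewrite invr_ge0 exprn_ge0.
have h1 : 0 <= (x - r) * (2 ^+ j)^-1 by rewrite mulr_ge0// subr_ge0.
have h2 : 0 <= (r * 2 - x) * (2 ^+ j)^-1 by rewrite mulr_ge0// subr_ge0.
rewrite !(mulrCA _ 2^-1); split; lra.
Qed.

Lemma powR_le_root (t u p : R) : 0 < p -> 0 <= t -> 0 <= u -> t `^ p <= u `^ p -> t <= u.
Proof.
move=> p0 t0 u0 h; rewrite -(powRr1 t0) -(powRr1 u0) -(@mulfV _ p) ?gt_eqF// !powRrM.
by rewrite ge0_ler_powR ?nnegrE ?powR_ge0// invr_ge0 ltW.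
Qed.

(** Source of the first chaining bound: the summand of index j alone controls the mean of |f x - f
    y|^p over [[lo], [hi]], since that interval lies within 4r / 2^j of x. *)
Lemma avg_shrinking_dist f p sg r x (H : R) (n : nat) :
  continuous f -> 1 <= p -> 0 < r -> r <= x <= r * 2 -> 0 <= H ->
  (\sum_(j < n.+1) ((r `^ (sg * p) * (r * 4 / 2 ^+ j) `^ (- (1 + sg * p)))%:E *
     \int[mu]_(y in `[r, (r * 4)%R]) near_dist f p (r * 4 / 2 ^+ j) (x, y)) <= H%:E)%E ->
  forall j, (j <= n)%N ->
  `|f x - avg f (lo r x j) (hi r x j)| `^ p <=
    2 `^ p * 4 `^ (1 + sg * p) * H * (2 ^+ j) `^ (- (sg * p)).
Proof.
move=> cf p1 r0 xr H0 hH j jn.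
have mf : measurable_fun setT f by exact: continuous_measurable_fun.
have p2 : (0 : R) < 2 ^+ j by rewrite exprn_gt0.
have d0 : 0 < r * 4 / 2 ^+ j by rewrite divr_gt0 ?mulr_gt0.
have hj : ((r `^ (sg * p) * (r * 4 / 2 ^+ j) `^ (- (1 + sg * p)))%:E *
     \int[mu]_(y in `[r, (r * 4)%R]) near_dist f p (r * 4 / 2 ^+ j) (x, y) <= H%:E)%E.
  apply: le_trans hH.
  have jn1 : (j < n.+1)%N by [].
  rewrite (bigD1 (Ordinal jn1))//=; apply: leeDl.
  apply: sume_ge0 => i _; rewrite mule_ge0 ?lee_fin ?mulr_ge0 ?powR_ge0//.
  by apply: integral_ge0 => y _; exact: near_dist_ge0.
have c0 : 0 < r `^ (sg * p) * (r * 4 / 2 ^+ j) `^ (- (1 + sg * p)).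
  by rewrite mulr_gt0// powR_gt0.
move: hj; rewrite -lee_pdivlMl// => hj.
have := avg_powR_le (f x) (lt_lo_hi x j r0) cf p1.
rewrite hi_lo -lee_fin => /le_trans; apply.
have lo4 : r <= lo r x j by exact: lo_ge.
have hi4 : hi r x j <= r * 4 by rewrite (le_trans (hi_le _ xr))// ler_pM2l// ler_nat.
have := @integral_near_dist_le _ f p (r * 4 / 2 ^+ j) r (r * 4) (lo r x j) (hi r x j) x mf lo4 hi4.
have hx y : lo r x j <= y <= hi r x j -> `|x - y| < r * 4 / 2 ^+ j.
  by apply: shrinking_dist => //; exact: lo_x_hi.
move=> /(_ hx) h.
apply: (@le_trans _ _ ((2 `^ p / (r / 2 ^+ j))%:E *
   ((r `^ (sg * p) * (r * 4 / 2 ^+ j) `^ (- (1 + sg * p)))^-1%:E * H%:E))%E).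
  apply: lee_wpmul2l; last exact: le_trans hj.
  by rewrite lee_fin divr_ge0 ?powR_ge0// ltW// divr_gt0.
rewrite -!EFinM lee_fin le_eqVlt; apply/orP; left; apply/eqP.
set c := _ * _ `^ (- _) in c0 *.
rewrite mulrA [RHS]mulrAC; congr (_ * H).
rewrite /c; set P := 2 ^+ j in p2 d0 *.
apply: ln_eq; [posr|posr|ln_expand].
ring.
Qed.

(** Source of the second chaining bound. Both points are averaged here, so the double integral at
    scale j suffices and the estimate is uniform in x. *)
Lemma avg_shrinking_step f p sg r x A j : continuous f -> 1 <= p -> 0 < r ->
  r <= x <= r * 2 -> 0 < A ->
  dyadic_energy_le f p sg r (A * r `^ (1 - sg * p)) ->
  `|avg f (lo r x j) (hi r x j) - avg f (lo r x j.+1) (hi r x j.+1)| `^ p <=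
    4 `^ p * 2 * 4 `^ (1 + sg * p) * A * (2 ^+ j) `^ (1 - sg * p).
Proof.
move=> cf p1 r0 xr A0 hA.
have mf : measurable_fun setT f by exact: continuous_measurable_fun.
have p2 : (0 : R) < 2 ^+ j by rewrite exprn_gt0.
have d0 : 0 < r * 4 / 2 ^+ j by rewrite divr_gt0 ?mulr_gt0.
have hj := near_energy_le j r0 hA.
have := avg_avg_powR_le (lt_lo_hi x j r0) (lt_lo_hi x j.+1 r0) cf p1.
rewrite !hi_lo -lee_fin => /le_trans; apply.
have lo4 := lo_ge j xr.
have hi4 : hi r x j <= r * 4 by rewrite (le_trans (hi_le _ xr))// ler_pM2l// ler_nat.
have lo4' := lo_ge j.+1 xr.
have hi4' : hi r x j.+1 <= r * 4 by rewrite (le_trans (hi_le _ xr))// ler_pM2l// ler_nat.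
have [slo shi] := shrinking_sub j r0 xr.
have hx y z : lo r x j <= y <= hi r x j -> lo r x j.+1 <= z <= hi r x j.+1 ->
    `|y - z| < r * 4 / 2 ^+ j.
  move=> hy /andP[z1 z2]; apply: (@shrinking_dist r x) => //.
  by rewrite (le_trans slo)//= (le_trans _ shi).
have h := @integral2_near_dist_le _ f p _ r (r * 4) _ _ _ _ mf lo4 hi4 lo4' hi4' hx.
apply: (@le_trans _ _ ((4 `^ p / (r / 2 ^+ j * (r / 2 ^+ j.+1)))%:E *
   (A * r `^ (1 - sg * p) * (r * 4 / 2 ^+ j) `^ (1 + sg * p))%:E)%E).
  apply: lee_wpmul2l; last exact: le_trans hj.
  by rewrite lee_fin divr_ge0 ?powR_ge0// ltW// mulr_gt0 ?divr_gt0// exprn_gt0.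
rewrite -!EFinM lee_fin le_eqVlt exprS; apply/orP; left; apply/eqP.
set P := 2 ^+ j in p2 d0 *.
apply: ln_eq; [posr|posr|ln_expand].
ring.
Qed.

Lemma avg_shrinking_le f q r x e j : continuous f -> 1 <= q -> 0 < r ->
  r <= x <= r * 2 -> 0 < e ->
  (\int[mu]_(y in `[r, (r * 2)%R]) (`|f y| `^ q)%:E <= (e `^ q * r)%:E)%E ->
  `|avg f (lo r x j) (hi r x j)| `^ q <= 2 `^ q * e `^ q * 2 ^+ j.
Proof.
move=> cf q1 r0 xr e0 he.
have mf : measurable_fun setT f by exact: continuous_measurable_fun.
have p2 : (0 : R) < 2 ^+ j by rewrite exprn_gt0.
have := avg_powR_le 0 (lt_lo_hi x j r0) cf q1.
rewrite sub0r normrN hi_lo -lee_fin => /le_trans; apply.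
under eq_integral do rewrite sub0r normrN.
apply: (@le_trans _ _ ((2 `^ q / (r / 2 ^+ j))%:E * (e `^ q * r)%:E)%E).
  apply: lee_wpmul2l; first by rewrite lee_fin divr_ge0 ?powR_ge0// ltW// divr_gt0.
  apply: le_trans he; apply: ge0_subset_integral => //.
  - by apply: measurable_funTS; exact: measurable_powR_norm.
  - move=> y; rewrite /= !in_itv/= => /andP[y1 y2].
    by rewrite (le_trans (lo_ge j xr))//= (le_trans y2)// hi_le.
rewrite -EFinM lee_fin le_eqVlt; apply/orP; left; apply/eqP; field.
by rewrite !gt_eqF.
Qed.

(** Ends the chaining at a finite index: the error falls below any threshold once j is large, so L
    influences only the number of steps. *)
Lemma avg_lipschitz f r x j L : continuous f -> 0 < r -> r <= x <= r * 2 -> 0 <= L ->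
  (forall y z, r <= y <= r * 2 -> r <= z <= r * 2 -> `|f y - f z| <= L * `|y - z|) ->
  `|f x - avg f (lo r x j) (hi r x j)| <= L * (r * 4 / 2 ^+ j).
Proof.
move=> cf r0 xr L0 hL.
have p2 : (0 : R) < 2 ^+ j by rewrite exprn_gt0.
have d0 : 0 < r * 4 / 2 ^+ j by rewrite divr_gt0 ?mulr_gt0.
have lh := lt_lo_hi x j r0.
have hl0 : 0 < hi r x j - lo r x j by rewrite subr_gt0.
rewrite -lee_fin; apply: (le_trans (norm_sub_avg_le (f x) lh cf)).
have mfx : measurable_fun setT (fun y => `|f x - f y|%:E).
  apply/measurable_EFinP; apply: (measurableT_comp (@normr_measurable R setT)).
  by apply: measurable_funB => //; exact: continuous_measurable_fun.
apply: (@le_trans _ _ ((hi r x j - lo r x j)^-1%:E *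
   \int[mu]_(y in `[lo r x j, hi r x j]) (L * (r * 4 / 2 ^+ j))%:E)%E).
  apply: lee_wpmul2l; first by rewrite lee_fin invr_ge0 ltW.
  apply: ge0_le_integral => //.
  - exact: measurable_funTS.
  - move=> y; rewrite /= in_itv/= => hy; rewrite lee_fin.
    apply: le_trans (hL _ _ xr _) _.
      by case/andP: hy => y1 y2; rewrite (le_trans (lo_ge j xr))//= (le_trans y2)// hi_le.
    apply: ler_wpM2l => //; apply/ltW/(@shrinking_dist r x) => //.
    exact: lo_x_hi.
have -> : (\int[mu]_(y in `[lo r x j, hi r x j]) (L * (r * 4 / 2 ^+ j))%:E =
    (L * (r * 4 / 2 ^+ j))%:E * mu `[lo r x j, hi r x j]%classic)%E by rewrite integral_cst.
rewrite lebesgue_measure_cc// -!EFinM lee_fin mulrCA mulVf ?mulr1//.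
by rewrite gt_eqF.
Qed.

Lemma powR_addr_le (u v q : R) : 0 <= u -> 0 <= v -> 0 <= q ->
  (u + v) `^ q <= 2 `^ q * (u `^ q + v `^ q).
Proof.
move=> u0 v0 q0; wlog uv : u v u0 v0 / u <= v.
  move=> H; have /orP[h|h] := le_total u v; first exact: H.
  by rewrite addrC [_ `^ q + _]addrC; exact: H.
apply: (@le_trans _ _ ((2 * v) `^ q)).
  by rewrite ge0_ler_powR ?nnegrE ?addr_ge0 ?mulr_ge0//; lra.
by rewrite powRM// ler_wpM2l ?powR_ge0// lerDr powR_ge0.
Qed.

Lemma lo0 (r x : R) : lo r x 0 = r.
Proof. by rewrite /lo expr0 divr1 subKr. Qed.

Lemma hi0 (r x : R) : hi r x 0 = r * 2.
Proof. by rewrite /hi expr0 divr1 subrKC. Qed.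

Lemma norm_avg_le f q r e : continuous f -> 1 <= q -> 0 < r -> 0 < e ->
  (\int[mu]_(y in `[r, (r * 2)%R]) (`|f y| `^ q)%:E <= (e `^ q * r)%:E)%E ->
  `|avg f r (r * 2)| <= 2 * e.
Proof.
move=> cf q1 r0 e0 he.
have rr : r <= r <= r * 2 by apply/andP; split; lra.
have := avg_shrinking_le 0 cf q1 r0 rr e0 he.
rewrite lo0 hi0 expr0 mulr1 -powRM ?(ltW e0)//.
have q0 : 0 < q by apply: lt_le_trans q1.
apply: (powR_le_root q0) => //; by rewrite mulr_ge0 ?(ltW e0).
Qed.

(** The scale of index 0 is 4r, larger than the distance of any point of [r, 2r] to any point of
    [2r, 4r]; one term of the dyadic energy therefore compares the two means. *)
Lemma avg_annuli_le p sg : 1 <= p -> exists2 C : R, 0 < C & forall f r a,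
  continuous f -> 0 < r -> 0 < a ->
  dyadic_energy_le f p sg r (a `^ p * r `^ (1 - sg * p)) ->
  `|avg f r (r * 2) - avg f (r * 2) (r * 2 * 2)| <= C * a.
Proof.
move=> p1; have p0 : 0 < p by apply: lt_le_trans p1.
pose c : R := 4 `^ p * 4 `^ (1 + sg * p).
have c0 : 0 < c by rewrite mulr_gt0// powR_gt0.
exists (c `^ p^-1); first by rewrite powR_gt0.
move=> f r a cf r0 a0 hA.
have mf : measurable_fun setT f by exact: continuous_measurable_fun.
apply: (powR_le_root p0) => //; first by rewrite mulr_ge0 ?powR_ge0 ?ltW.
have hj := near_energy_le 0 r0 hA.
rewrite expr0 divr1 in hj.
have r2 : r < r * 2 by rewrite ltr_pMr// ltr1n.
have r4 : r * 2 < r * 2 * 2 by rewrite ltr_pMr ?mulr_gt0// ltr1n.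
have := avg_avg_powR_le r2 r4 cf p1.
rewrite -lee_fin => /le_trans; apply.
have e4 : r * 2 * 2 = r * 4 by rewrite -mulrA -natrM.
have hx y z : r <= y <= r * 2 -> r * 2 <= z <= r * 2 * 2 -> `|y - z| < r * 4.
  by move=> /andP[? ?] /andP[? ?]; rewrite ltr_norml; apply/andP; split; lra.
have h := @integral2_near_dist_le _ f p _ r (r * 4) _ _ _ _ mf (lexx r) (_ : r * 2 <= r * 4) (ltW r2) (_ : r * 2 * 2 <= r * 4) hx.
apply: (@le_trans _ _ ((4 `^ p / ((r * 2 - r) * (r * 2 * 2 - r * 2)))%:E *
   (a `^ p * r `^ (1 - sg * p) * (r * 4) `^ (1 + sg * p))%:E)%E).
  apply: lee_wpmul2l.
    by rewrite lee_fin divr_ge0 ?powR_ge0// mulr_ge0// subr_ge0 ltW.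
  by apply: le_trans hj; apply: h; lra.
rewrite -EFinM lee_fin [leRHS]powRM ?powR_ge0 ?(ltW a0)// -[in leRHS]powRrM mulVf ?gt_eqF// [c `^ 1]powRr1 ?(ltW c0)//.
rewrite (_ : r * 2 - r = r); last by ring.
rewrite (_ : r * 2 * 2 - r * 2 = r * 2); last by ring.
rewrite -[leRHS]divr1.
apply: (@le_trans _ _ (c * a `^ p / 2)); last first.
  have : 0 <= c * a `^ p by rewrite mulr_ge0 ?powR_ge0 ?(ltW c0).
  lra.
rewrite le_eqVlt; apply/orP; left; apply/eqP.
have r20 : 0 < r * 2 by rewrite mulr_gt0.
rewrite /c; apply: ln_eq; [posr|posr|ln_expand].
ring.
Qed.

Section gagliardo_nirenberg.
Variables (p q g sg l k m : R).
Hypotheses (p1 : 1 <= p) (q1 : 1 <= q) (g0 : 0 < g).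
Hypotheses (k0 : 0 <= k) (m0 : 0 <= m) (m1 : m <= 1).
Hypothesis kgm : k * g * m / p + g * (1 - m) / q <= 1.
Hypothesis chain : chaining_bound p q sg l k.

Let p0 : 0 < p. Proof. exact: lt_le_trans p1. Qed.
Let q0 : 0 < q. Proof. exact: lt_le_trans q1. Qed.

(** The density in x of the dyadic energy, truncated to n + 1 scales. The factor r^(sg p) normalizes
    its mean over an annulus to at most a^p; divided by a^p it is the X of the chaining. *)
Definition weighted_dist f r n x : \bar R :=
  \sum_(j < n.+1) ((r `^ (sg * p) * (r * 4 / 2 ^+ j) `^ (- (1 + sg * p)))%:E *
     \int[mu]_(y in `[r, (r * 4)%R]) near_dist f p (r * 4 / 2 ^+ j) (x, y))%E.

Lemma weighted_dist_ge0 f r n x : (0 <= weighted_dist f r n x)%E.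
Proof.
apply: sume_ge0 => i _; rewrite mule_ge0 ?lee_fin ?mulr_ge0 ?powR_ge0//.
by apply: integral_ge0 => y _; exact: near_dist_ge0.
Qed.

Lemma measurable_weighted_dist f r n : measurable_fun setT f ->
  measurable_fun setT (weighted_dist f r n).
Proof.
move=> mf; apply: emeasurable_sum => j; apply: measurable_funeM.
exact: measurable_near_dist_inner.
Qed.

Lemma integral_weighted_dist_le f r n a : measurable_fun setT f -> 0 < r ->
  dyadic_energy_le f p sg r (a `^ p * r `^ (1 - sg * p)) ->
  (\int[mu]_(x in `[r, (r * 2)%R]) weighted_dist f r n x <= (a `^ p * r)%:E)%E.
Proof.
move=> mf r0 hA.
apply: (@le_trans _ _ (\int[mu]_(x in `[r, (r * 4)%R]) weighted_dist f r n x)%E).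
  apply: ge0_subset_integral => //.
  - by apply: measurable_funTS; exact: measurable_weighted_dist.
  - by move=> x _; exact: weighted_dist_ge0.
  - move=> y; rewrite /= !in_itv/= => /andP[-> y2]/=.
    by rewrite (le_trans y2)// ler_pM2l// ler_nat.
rewrite ge0_integral_sum//; last 2 first.
- move=> j; apply: measurable_funTS; apply: measurable_funeM.
  exact: measurable_near_dist_inner.
- move=> j x _; rewrite mule_ge0 ?lee_fin ?mulr_ge0 ?powR_ge0//.
  by apply: integral_ge0 => y _; exact: near_dist_ge0.
rewrite (_ : a `^ p * r = r `^ (sg * p) * (a `^ p * r `^ (1 - sg * p))); last first.
  rewrite mulrCA -powRD; last by rewrite (gt_eqF r0) implybT.
  by rewrite addrCA subrr addr0 powRr1// ltW.
rewrite [leRHS]EFinM; apply: le_trans (lee_wpmul2l _ (hA n.+1)); last first.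
  by rewrite lee_fin powR_ge0.
rewrite ge0_sume_distrr; last first.
  by move=> j _; rewrite mule_ge0 ?near_energy_ge0// lee_fin powR_ge0.
apply: lee_sum => j _; rewrite ge0_integralZl//; last 3 first.
- by apply: measurable_funTS; exact: measurable_near_dist_inner.
- by move=> x _; apply: integral_ge0 => y _; exact: near_dist_ge0.
- by rewrite lee_fin mulr_ge0 ?powR_ge0.
by rewrite EFinM -muleA.
Qed.

Lemma pointwise_oscillation_le : exists2 C : R, 0 < C & forall f r a e L,
  continuous f -> 0 < r -> 0 < a -> 0 < e -> 0 <= L ->
  (forall y z, r <= y <= r * 2 -> r <= z <= r * 2 -> `|f y - f z| <= L * `|y - z|) ->
  dyadic_energy_le f p sg r (a `^ p * r `^ (1 - sg * p)) ->
  (\int[mu]_(y in `[r, (r * 2)%R]) (`|f y| `^ q)%:E <= (e `^ q * r)%:E)%E ->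
  exists n, forall x, r <= x <= r * 2 ->
  ((`|f x - avg f r (r * 2)| `^ g)%:E <=
    (C * (a `^ (l * m) * e `^ (1 - l * m)) `^ g)%:E *
    (1%:E + (a `^ p)^-1%:E * weighted_dist f r n x +
     (e `^ q)^-1%:E * (`|f x - avg f r (r * 2)| `^ q)%:E))%E.
Proof.
pose cX : R := 2 `^ p * 4 `^ (1 + sg * p).
pose cY : R := 4 `^ p * 2 * 4 `^ (1 + sg * p).
have cX0 : 0 < cX by rewrite mulr_gt0// powR_gt0.
have cY0 : 0 < cY by rewrite !mulr_gt0// powR_gt0.
pose C1 := cX `^ p^-1 + cY `^ p^-1 + 2.
have cXp : 0 < cX `^ p^-1 by rewrite powR_gt0.
have cYp : 0 < cY `^ p^-1 by rewrite powR_gt0.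
have C10 : 0 < C1 by rewrite !addr_gt0.
have C12 : 2 <= C1 by rewrite lerDr addr_ge0// ltW.
have cXC : cX <= C1 `^ p.
  rewrite -[leLHS](powRr1 (ltW cX0)) -(@mulVf _ p) ?gt_eqF// powRrM.
  by rewrite ge0_ler_powR ?nnegrE ?(ltW p0) ?(ltW cXp) ?(ltW C10)// /C1; lra.
have cYC : cY <= C1 `^ p.
  rewrite -[leLHS](powRr1 (ltW cY0)) -(@mulVf _ p) ?gt_eqF// powRrM.
  by rewrite ge0_ler_powR ?nnegrE ?(ltW p0) ?(ltW cYp) ?(ltW C10)// /C1; lra.
have [C2 C20 hC2] := chain C10.
have C2p : 0 < 1 + C2 by rewrite addr_gt0.
exists ((1 + C2) `^ (g * m)); first by rewrite powR_gt0.
move=> f r a e L cf r0 a0 e0 L0 hL hA he.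
have mf : measurable_fun setT f by exact: continuous_measurable_fun.
have ap0 : 0 < a `^ p by rewrite powR_gt0.
have eq0 : 0 < e `^ q by rewrite powR_gt0.
pose w := a `^ l * e `^ (1 - l).
have w0 : 0 < w by rewrite mulr_gt0 ?powR_gt0.
(* The number of scales depends on f through L, but the constant was fixed before f. *)
have [n hn] : exists n, L * (r * 4 / 2 ^+ n) <= w.
  have [n hn] : exists n : nat, L * (r * 4) / w <= n%:R.
    have h : 0 <= L * (r * 4) / w.
      by apply: divr_ge0; [apply: mulr_ge0 => //; rewrite mulr_ge0// ltW|exact: ltW].
    by exists (Num.bound (L * (r * 4) / w)); apply/ltW/archi_boundP.
  exists n; rewrite mulrA ler_pdivrMr ?exprn_gt0//.
  move: hn; rewrite ler_pdivrMr// => /le_trans; apply.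
  rewrite mulrC ler_pM2l//.
  by rewrite -natrX ler_nat ltnW// ltn_expl.
exists n => x xr.
pose T : R := `|f x - avg f r (r * 2)|; rewrite -/T.
have T0 : 0 <= T by exact: normr_ge0.
have := weighted_dist_ge0 f r n x.
case hE : (weighted_dist f r n x) => [H| |] //; last first.
  move=> _; rewrite gt0_muley ?lte_fin ?invr_gt0//.
  by rewrite addey// addye// gt0_muley ?leey// lte_fin mulr_gt0 ?powR_gt0// mulr_gt0 ?powR_gt0.
rewrite lee_fin => H0.
rewrite -!EFinM lee_fin.
pose X := H / a `^ p.
have X0 : 0 <= X by rewrite divr_ge0// ltW.
have X1 : 0 < 1 + X by rewrite ltr_pwDl.
have HX : H <= a `^ p * (1 + X).
  by rewrite mulrDr mulr1 /X mulrCA divff ?gt_eqF// mulr1 lerDr ltW.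
have EY : (e `^ q)^-1 * T `^ q = (T / e) `^ q.
  by rewrite powRM ?invr_ge0 ?(ltW e0)// -powR_inv1 ?(ltW eq0)// -[e^-1]powR_inv1 ?(ltW e0)// -!powRrM mulrC mulrN1 mulN1r.
rewrite EY (mulrC _^-1 H) -/X.
apply: (interpolation_pointwise p0 q0 g0 k0 m0 m1 kgm C2p a0 e0 X0 T0).
have T_E : T = `|f x - avg f (lo r x 0) (hi r x 0)| by rewrite lo0 hi0.
have key : T <= w + C2 * (w * (1 + X) `^ (k / p)).
  rewrite T_E; apply: (hC2 a e X (f x) w (fun j => avg f (lo r x j) (hi r x j)) n a0 e0 X0); clearbody C1.
  - move=> j jn; apply: (powR_le_root p0); first exact: normr_ge0.
      by rewrite !mulr_ge0 ?powR_ge0 ?(ltW C10) ?(ltW a0).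
    have hH : (weighted_dist f r n x <= H%:E)%E by rewrite hE.
    apply: (le_trans (@avg_shrinking_dist f p sg r x H n cf p1 r0 xr H0 hH j jn)).
    rewrite !powRM ?mulr_ge0 ?powR_ge0 ?(ltW C10) ?(ltW a0)// -!powRrM.
    rewrite mulVf ?gt_eqF// powRr1 ?(ltW X1)// mulNr -/cX.
    rewrite ler_wpM2r ?powR_ge0//; apply: ler_pM => //; exact: ltW.
  - move=> j jn; apply: (powR_le_root p0); first exact: normr_ge0.
      by rewrite !mulr_ge0 ?powR_ge0 ?(ltW C10) ?(ltW a0).
    apply: (le_trans (avg_shrinking_step j cf p1 r0 xr ap0 hA)).
    rewrite -/cY !powRM ?mulr_ge0 ?powR_ge0 ?(ltW C10) ?(ltW a0)// -!powRrM.
    rewrite mulrBl mulVf ?gt_eqF//.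
    by rewrite ler_wpM2r ?powR_ge0// ler_wpM2r ?powR_ge0.
  - move=> j jn; apply: (powR_le_root q0); first exact: normr_ge0.
      by rewrite !mulr_ge0 ?powR_ge0 ?(ltW C10) ?(ltW e0).
    apply: (le_trans (avg_shrinking_le j cf q1 r0 xr e0 he)).
    rewrite !powRM ?mulr_ge0 ?powR_ge0 ?(ltW C10) ?(ltW e0)// -!powRrM.
    rewrite mulVf ?gt_eqF// powRr1 ?exprn_ge0//.
    rewrite ler_wpM2r ?exprn_ge0// ler_wpM2r ?powR_ge0//.
    by rewrite ge0_ler_powR ?nnegrE ?(ltW q0) ?(ltW C10)//.
  - exact: le_trans (avg_lipschitz n cf r0 xr L0 hL) hn.
(* The terminal error w is absorbed because (1 + X)^(k/p) >= 1. *)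
apply: (le_trans key); rewrite -/w mulrDl mul1r lerD2r.
rewrite ler_peMr ?(ltW w0)// -[leLHS](powRr0 (1 + X)).
by rewrite ler_powR ?lerDl// divr_ge0 ?(ltW p0).
Qed.

Lemma local_gagliardo_nirenberg : exists2 C : R, 0 < C & forall f r a e L,
  continuous f -> 0 < r -> 0 < a -> 0 < e -> 0 <= L ->
  (forall y z, r <= y <= r * 2 -> r <= z <= r * 2 -> `|f y - f z| <= L * `|y - z|) ->
  dyadic_energy_le f p sg r (a `^ p * r `^ (1 - sg * p)) ->
  (\int[mu]_(y in `[r, (r * 2)%R]) (`|f y| `^ q)%:E <= (e `^ q * r)%:E)%E ->
  (\int[mu]_(x in `[r, (r * 2)%R]) (`|f x - avg f r (r * 2)| `^ g)%:E <=
   (C * (a `^ (l * m) * e `^ (1 - l * m)) `^ g * r)%:E)%E.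
Proof.
have [C C0 hC] := pointwise_oscillation_le.
(* The three summands bound the means over the annulus of 1, of X, and of |f - c|^q / e^q; the last
   one uses |c| <= 2 e for the mean c. *)
pose K : R := 1 + 1 + 2 `^ q * (1 + 2 `^ q).
have K0 : 0 < K by rewrite !addr_gt0// mulr_gt0 ?addr_gt0// powR_gt0.
exists (C * K); first by rewrite mulr_gt0.
move=> f r a e L cf r0 a0 e0 L0 hL hA he.
have [n hn] := hC f r a e L cf r0 a0 e0 L0 hL hA he.
have mf : measurable_fun setT f by exact: continuous_measurable_fun.
have ap0 : 0 < a `^ p by rewrite powR_gt0.
have eq0 : 0 < e `^ q by rewrite powR_gt0.
set c := avg f r (r * 2) in hn *.
set P := _ `^ g in hn *.
have P0 : 0 <= P by rewrite powR_ge0.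
have rr : r < r * 2 by rewrite ltr_pMr// ltr1n.
have mI : (mu `[r, (r * 2)%R]%classic = r%:E).
  by rewrite lebesgue_measure_cc//; congr EFin; ring.
have mT u : measurable_fun setT (fun x => (`|f x - c| `^ u)%:E).
  by apply: measurable_powR_norm; exact: measurable_funB.
have mW := @measurable_weighted_dist f r n mf.
have hq : (\int[mu]_(x in `[r, (r * 2)%R]) (`|f x - c| `^ q)%:E <=
    (2 `^ q * (1 + 2 `^ q) * e `^ q * r)%:E)%E.
  apply: (@le_trans _ _ (\int[mu]_(x in `[r, (r * 2)%R])
     ((2 `^ q)%:E * ((`|f x| `^ q)%:E + ((2 * e) `^ q)%:E)))%E).
    apply: ge0_le_integral => //.
    - exact: (measurable_funTS (mT q)).
    - apply: measurable_funTS; apply: measurable_funeM; apply: emeasurable_funD => //.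
      exact: measurable_powR_norm.
    - move=> x _; rewrite -EFinD -EFinM lee_fin.
      apply: (@le_trans _ _ ((`|f x| + 2 * e) `^ q)).
        rewrite ge0_ler_powR ?nnegrE ?(ltW q0)//.
          by rewrite addr_ge0// mulr_ge0// ltW.
        rewrite (le_trans (ler_normB _ _))// lerD2l.
        exact: norm_avg_le cf q1 r0 e0 he.
      by rewrite powR_addr_le ?(ltW q0)// mulr_ge0// ltW.
  rewrite ge0_integralZl//; last 2 first.
  - apply: measurable_funTS; apply: emeasurable_funD => //.
    exact: measurable_powR_norm.
  - by move=> x _; rewrite -EFinD lee_fin addr_ge0 ?powR_ge0.
  rewrite ge0_integralD//; last 2 first.
  - by apply: measurable_funTS; exact: measurable_powR_norm.
  - by move=> x _; rewrite lee_fin powR_ge0.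
  rewrite integral_cst//.
  apply: (@le_trans _ _ ((2 `^ q)%:E * ((e `^ q * r)%:E + ((2 * e) `^ q)%:E * r%:E))%E).
    apply: lee_wpmul2l; first by rewrite lee_fin powR_ge0.
    by apply: leeD => //; rewrite -mI.
  rewrite -!EFinM lee_fin powRM ?(ltW e0)//.
  by rewrite le_eqVlt; apply/orP; left; apply/eqP; ring.
apply: (@le_trans _ _ (\int[mu]_(x in `[r, (r * 2)%R])
  ((C * P)%:E * (1%:E + (a `^ p)^-1%:E * weighted_dist f r n x +
     (e `^ q)^-1%:E * (`|f x - c| `^ q)%:E)))%E).
  apply: ge0_le_integral => //.
  - exact: (measurable_funTS (mT g)).
  - apply: measurable_funTS; apply: measurable_funeM; apply: emeasurable_funD.
      by apply: emeasurable_funD => //; apply: measurable_funeM.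
    by apply: measurable_funeM; exact: (mT q).
rewrite ge0_integralZl//; last 3 first.
- apply: measurable_funTS; apply: emeasurable_funD.
    by apply: emeasurable_funD => //; apply: measurable_funeM.
  by apply: measurable_funeM; exact: (mT q).
- move=> x _; rewrite !adde_ge0 ?mule_ge0 ?lee_fin ?invr_ge0 ?powR_ge0//.
  exact: weighted_dist_ge0.
- by rewrite lee_fin mulr_ge0// ltW.
rewrite (_ : C * K * P * r = C * P * (r * K)); last by ring.
rewrite [leRHS]EFinM; apply: lee_wpmul2l; first by rewrite lee_fin mulr_ge0// ltW.
rewrite ge0_integralD//; last 4 first.
- move=> x _; rewrite adde_ge0 ?mule_ge0 ?lee_fin ?invr_ge0 ?powR_ge0//.
  exact: weighted_dist_ge0.
- by apply: measurable_funTS; apply: emeasurable_funD => //; apply: measurable_funeM.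
- by move=> x _; rewrite -EFinM lee_fin mulr_ge0 ?invr_ge0 ?powR_ge0.
- by apply: measurable_funTS; apply: measurable_funeM; exact: (mT q).
rewrite ge0_integralD//; last 2 first.
- by move=> x _; rewrite mule_ge0 ?lee_fin ?invr_ge0 ?powR_ge0// weighted_dist_ge0.
- by apply: measurable_funTS; exact: measurable_funeM.
rewrite integral_cst// ge0_integralZl//; last 3 first.
- exact: measurable_funTS.
- by move=> x _; exact: weighted_dist_ge0.
- by rewrite lee_fin invr_ge0 powR_ge0.
rewrite ge0_integralZl//; last 2 first.
- exact: (measurable_funTS (mT q)).
- by rewrite lee_fin invr_ge0 powR_ge0.
apply: (@le_trans _ _ (1%:E * r%:E + (a `^ p)^-1%:E * (a `^ p * r)%:E +
  (e `^ q)^-1%:E * (2 `^ q * (1 + 2 `^ q) * e `^ q * r)%:E)%E).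
  apply: leeD; first apply: leeD.
  - by rewrite -mI.
  - apply: lee_wpmul2l; first by rewrite lee_fin invr_ge0 powR_ge0.
    exact: integral_weighted_dist_le.
  - by apply: lee_wpmul2l => //; rewrite lee_fin invr_ge0 powR_ge0.
rewrite -!EFinM -!EFinD lee_fin le_eqVlt; apply/orP; left; apply/eqP.
by rewrite /K; field; rewrite !gt_eqF.
Qed.

End gagliardo_nirenberg.

(** Of the parameters l, k, m of the chaining and the interpolation only t = l m survives, as the
    weight of the amplitude a. *)
Definition annulus_gn (p q g sg t : R) := exists2 C : R, 0 < C & forall f r a e L,
  continuous f -> 0 < r -> 0 < a -> 0 < e -> 0 <= L ->
  (forall y z, r <= y <= r * 2 -> r <= z <= r * 2 -> `|f y - f z| <= L * `|y - z|) ->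
  dyadic_energy_le f p sg r (a `^ p * r `^ (1 - sg * p)) ->
  (\int[mu]_(y in `[r, (r * 2)%R]) (`|f y| `^ q)%:E <= (e `^ q * r)%:E)%E ->
  (\int[mu]_(x in `[r, (r * 2)%R]) (`|f x - avg f r (r * 2)| `^ g)%:E <=
   (C * (a `^ t * e `^ (1 - t)) `^ g * r)%:E)%E.

(** With g = q, l = 1, m = t and k = 1 - sg p, the exponent condition of the interpolation reads t +
    (1 - t) <= 1 whatever t is. So even the equality case leaves room to move the parameter. *)
Lemma annulus_gn_critical p q sg t : 1 <= p -> 1 <= q -> 0 < sg -> sg * p < 1 ->
  q * (1 - sg * p) = p -> 0 <= t -> t <= 1 -> annulus_gn p q q sg t.
Proof.
move=> p1 q1 sg0 sgp qp t0 t1.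
have p0 : 0 < p by apply: lt_le_trans p1.
have q0 : 0 < q by apply: lt_le_trans q1.
have kgm : (1 - sg * p) * q * t / p + q * (1 - t) / q <= 1.
  rewrite [_ * q]mulrC qp mulrAC divff ?gt_eqF// mulrAC divff ?gt_eqF//; lra.
have k0 : 0 <= 1 - sg * p by rewrite subr_ge0 ltW.
have := local_gagliardo_nirenberg p1 q1 q0 k0 t0 t1 kgm
  (chaining_bound_critical q p0 sg0 sgp).
by rewrite mul1r.
Qed.

(** The last hypothesis is the gap to criticality in dimension one. The parameters l, k, m with l m
    = t have to convert it into the decay rate required by [chaining_le] while keeping the exponent
    condition of the interpolation. *)
Lemma annulus_gn_strict p q g sg t : 1 <= p -> 1 <= q -> 0 < g -> 0 < sg ->
  0 < t -> t < 1 -> 0 < sg * t - t / p + g^-1 - (1 - t) / q ->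
  annulus_gn p q g sg t.
Proof.
move=> p1 q1 g0 sg0 t0 t1 H.
have p0 : 0 < p by apply: lt_le_trans p1.
have q0 : 0 < q by apply: lt_le_trans q1.
have [l [k [m [k0 kl l1 m0 [m1 lm kgm strict]]]]] : exists l k m,
  [/\ 0 <= k, k <= l, l <= 1, 0 <= m & [/\ m <= 1, l * m = t,
  k * g * m / p + g * (1 - m) / q <= 1 &
  0 < sg * l - (l - k) / p - (1 - l) / q]].
  (* If 1/g <= t/p, chaining alone suffices: m = 1 and k g / p = 1, and the decay rate is the gap
     itself. *)
  have [h|h] := leP g^-1 (t / p).
    exists t, (p / g), 1; split; rewrite ?(ltW t1)//.
    - by rewrite divr_ge0 ?ltW.
    - by move: h; rewrite ler_pdivlMr// mulrC.
    - split; rewrite ?mulr1//.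
        by rewrite subrr mulr0 mul0r addr0 divfK ?gt_eqF// divff ?gt_eqF.
      by rewrite mulrBl (_ : p / g / p = g^-1) ?opprB ?addrA; [lra|field; rewrite !gt_eqF].
  (* Otherwise k = l, and m makes the exponent condition an equality; m times the decay rate is
     again the gap. This requires l = t / m <= 1. *)
  pose m := 1 - q * (g^-1 - t / p).
  have mlt1 : m < 1 by rewrite /m ltrBlDr ltrDl mulr_gt0// subr_gt0.
  have [tm|mt] := leP t m.
    have m0 : 0 < m by exact: lt_le_trans tm.
    exists (t / m), (t / m), m; split => //.
    - by rewrite divr_ge0 ?ltW.
    - by rewrite ler_pdivrMr// mul1r.
    - exact: ltW.
    - split; [exact: ltW|by rewrite divfK ?gt_eqF| |].
      + rewrite (_ : t / m * g * m / p + g * (1 - m) / q = 1)//.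
        have -> : t / m * g * m = t * g by rewrite mulrAC divfK ?gt_eqF.
        by rewrite /m; field; rewrite !gt_eqF.
      + rewrite subrr mul0r subr0 -(pmulr_rgt0 _ m0).
        rewrite (_ : m * _ = sg * t - (m - t) / q); last by field; rewrite !gt_eqF.
        rewrite /m (_ : _ - _ = sg * t - t / p + g^-1 - (1 - t) / q)//.
        by field; rewrite !gt_eqF.
  (* When that m would be smaller than t, take l = 1 and m = t instead: the decay rate is sg, and m
     < t is what yields the exponent condition. *)
  exists 1, 1, t; split; rewrite ?ler01 ?(ltW t0)//; split; rewrite ?mul1r ?(ltW t1)//.
    rewrite (_ : g * t / p + g * (1 - t) / q = g * (t / p + (1 - t) / q)); last by ring.
    rewrite -ler_pdivlMl// mulr1 -(ler_pM2l q0).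
    rewrite mulrDr (_ : q * ((1 - t) / q) = 1 - t); last by field; rewrite gt_eqF.
    by move: mt; rewrite /m mulrBr; lra.
  by rewrite !subrr !mul0r !subr0 mulr1.
rewrite -lm.
have chain : chaining_bound p q sg l k.
  by move=> C1 C10; exact: chaining_le p0 q0 C10 k0 kl l1 strict.
exact: local_gagliardo_nirenberg p1 q1 g0 k0 m0 m1 kgm chain.
Qed.

End annulus.

(** * Summation over dyadic annuli *)

Section summation.
Context {R : realType}.
Notation mu := (@lebesgue_measure R).
Implicit Types (f : R -> R) (a b p q sg r x e A H : R).

(** Increments growing with ratio s > 1 have a sum comparable to the last of them. *)
Lemma growing_chain_le (y : nat -> R) (A B s : R) : 1 < s -> 0 <= A -> 0 <= B ->
  `|y 0%N| <= A -> (forall k, `|y k - y k.+1| <= B * s ^+ k.+1) ->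
  forall k, `|y k| <= (A + B / (1 - s^-1)) * s ^+ k.
Proof.
move=> s1 A0 B0 y0 yk.
have s0 : 0 < s by apply: lt_trans s1.
have d0 : 0 < 1 - s^-1 by rewrite subr_gt0 invf_lt1.
have K0 : 0 <= B / (1 - s^-1) by rewrite divr_ge0// ltW.
elim=> [|k IH]; first by rewrite expr0 mulr1 (le_trans y0)// lerDl.
have -> : y k.+1 = y k - (y k - y k.+1) by rewrite subKr.
rewrite (le_trans (ler_normB _ _))// (le_trans (lerD IH (yk k)))//.
have sk : 0 < s ^+ k by rewrite exprn_gt0.
rewrite exprS mulrA -mulrDl mulrA ler_wpM2r ?(ltW sk)//.
set K := B / _ in K0 *.
have EB : B = K * (1 - s^-1) by rewrite divfK// gt_eqF.
have -> : A + K + B * s = A + K * s.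
  by rewrite EB; field; rewrite gt_eqF.
by rewrite mulrDl lerD2r ler_peMr// ltW.
Qed.

(** Telescoping starts from an index where y vanishes and goes down; as s < 1, the constant does not
    depend on N. *)
Lemma vanishing_chain_le (y : nat -> R) (B s : R) (N : nat) : 0 < s -> s < 1 -> 0 <= B ->
  (forall k, (N <= k)%N -> y k = 0) -> (forall k, `|y k - y k.+1| <= B * s ^+ k) ->
  forall k, `|y k| <= B / (1 - s) * s ^+ k.
Proof.
move=> s0 s1 B0 yN yk.
have d0 : 0 < 1 - s by rewrite subr_gt0.
have K0 : 0 <= B / (1 - s) by rewrite divr_ge0// ltW.
suff H m : forall k, (N <= k + m)%N -> `|y k| <= B / (1 - s) * s ^+ k.
  by move=> k; apply: (H N); rewrite leq_addl.
elim: m => [|m IH] k.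
  by rewrite addn0 => /yN ->; rewrite normr0 mulr_ge0// exprn_ge0// ltW.
rewrite addnS -addSn => /IH h.
have -> : y k = (y k - y k.+1) + y k.+1 by rewrite subrK.
rewrite (le_trans (ler_normD _ _))// (le_trans (lerD (yk k) h))//.
have sk : 0 < s ^+ k by rewrite exprn_gt0.
rewrite exprS mulrA -mulrDl ler_wpM2r ?(ltW sk)//.
by rewrite le_eqVlt; apply/orP; left; apply/eqP; field; rewrite gt_eqF.
Qed.

Lemma integral_setU_le (F : R -> \bar R) (D1 D2 : set R) : measurable D1 -> measurable D2 ->
  measurable_fun setT F -> (forall x, 0 <= F x)%E ->
  (\int[mu]_(x in D1 `|` D2) F x <= \int[mu]_(x in D1) F x + \int[mu]_(x in D2) F x)%E.
Proof.
move=> mD1 mD2 mF F0.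
have -> : D1 `|` D2 = D1 `|` (D2 `\` D1).
  apply/seteqP; split => x [xD1|]; [by left| |by left|by move=> [xD2 _]; right].
  by move=> xD2; have [xD1|xD1] := pselect (D1 x); [left|right].
rewrite ge0_integral_setU//=; last 3 first.
- exact: measurableD.
- exact: measurable_funTS.
- by rewrite disj_set2E setDIK.
apply: leeD => //; apply: ge0_subset_integral => //.
- exact: measurableD.
- exact: measurable_funTS.
Qed.

Lemma integral_partition_le (F : R -> \bar R) (a : nat -> R) (N : nat) :
  measurable_fun setT F -> (forall x, 0 <= F x)%E ->
  (\int[mu]_(x in `]a 0%N, a N]) F x <= \sum_(k < N) \int[mu]_(x in `[a k, a k.+1]) F x)%E.
Proof.
move=> mF F0; elim: N => [|N IH].
  by rewrite big_ord0 set_itv_ge ?integral_set0// bnd_simp ltxx.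
rewrite big_ord_recr/=.
apply: (@le_trans _ _ (\int[mu]_(x in `]a 0%N, a N] `|` `[a N, a N.+1]) F x)%E).
  apply: ge0_subset_integral => //.
  - exact: measurableU.
  - exact: measurable_funTS.
  - move=> x; rewrite /= !in_itv/= => /andP[x0 x1].
    by have [xN|Nx] := leP x (a N); [left; rewrite x0|right; rewrite (ltW Nx)].
by apply: (le_trans (integral_setU_le _ _ mF F0)) => //; exact: leeD.
Qed.

Lemma annulus_total_le (n : nat) g f r c X C K : measurable_fun setT f ->
  0 < g -> 0 < r -> 0 <= X -> 0 <= C -> 0 <= K ->
  (\int[mu]_(x in `[r, (r * 2)%R]) (`|f x - c| `^ g)%:E <= (C * X `^ g * r)%:E)%E ->
  `|c| <= K * X ->
  (\int[mu]_(x in `[r, (r * 2)%R]) (`|f x| `^ g * `|x| ^+ n)%:E <=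
   (2 `^ g * (C + K `^ g) * 2 ^+ n * (X `^ g * r ^+ n.+1))%:E)%E.
Proof.
move=> mf g0 r0 X0 C0 K0 hf hc.
have mT u : measurable_fun setT (fun x => (`|f x - c| `^ u)%:E).
  by apply: measurable_powR_norm; exact: measurable_funB.
have r20 : 0 <= r * 2 by rewrite mulr_ge0// ltW.
have c0 : 0 <= (r * 2) ^+ n * 2 `^ g by rewrite mulr_ge0 ?powR_ge0// exprn_ge0.
apply: (@le_trans _ _ (\int[mu]_(x in `[r, (r * 2)%R])
   (((r * 2) ^+ n * 2 `^ g)%:E * ((`|f x - c| `^ g)%:E + ((K * X) `^ g)%:E)))%E).
  apply: ge0_le_integral => //.
  - apply: measurable_funTS; apply/measurable_EFinP; apply: measurable_funM.
      by apply/measurable_EFinP; exact: measurable_powR_norm.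
    by apply: measurable_funX; exact: normr_measurable.
  - apply: measurable_funTS; apply: measurable_funeM; apply: emeasurable_funD => //.
    exact: (mT g).
  - move=> x; rewrite /= in_itv/= => /andP[rx xr].
    rewrite -!EFinM lee_fin mulrC -mulrA; apply: ler_pM; rewrite ?exprn_ge0 ?powR_ge0//.
      rewrite lerXn2r ?nnegrE// ger0_norm//; exact: le_trans (ltW r0) rx.
    apply: (@le_trans _ _ ((`|f x - c| + K * X) `^ g)).
      rewrite ge0_ler_powR ?nnegrE ?(ltW g0) ?addr_ge0 ?mulr_ge0//.
      by rewrite -{1}(subrK c (f x)) (le_trans (ler_normD _ _))// lerD2l.
    by apply: powR_addr_le; rewrite ?(ltW g0) ?mulr_ge0.
rewrite ge0_integralZl//; last 2 first.
- by apply: measurable_funTS; apply: emeasurable_funD => //; exact: (mT g).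
- by move=> x _; rewrite -EFinD lee_fin addr_ge0 ?powR_ge0.
rewrite ge0_integralD//; last 2 first.
- exact: (measurable_funTS (mT g)).
- by move=> x _; rewrite lee_fin powR_ge0.
rewrite integral_cst//.
have rr : r < r * 2 by rewrite ltr_pMr// ltr1n.
have mI : (mu `[r, (r * 2)%R]%classic = r%:E).
  by rewrite lebesgue_measure_cc//; congr EFin; ring.
apply: (@le_trans _ _ (((r * 2) ^+ n * 2 `^ g)%:E * ((C * X `^ g * r)%:E + ((K * X) `^ g)%:E * r%:E))%E).
  apply: lee_wpmul2l; first by rewrite lee_fin.
  by apply: leeD => //; rewrite -mI.
rewrite -!EFinM lee_fin powRM// exprMn exprS.
by rewrite le_eqVlt; apply/orP; left; apply/eqP; ring.
Qed.

Section sum_over_annuli.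
Variables (n : nat) (p q g sg tau eps m1 m2 D : R).
Hypotheses (p1 : 1 <= p) (q1 : 1 <= q) (g0 : 0 < g) (D0 : 0 < D).
Hypothesis gD : g * D = n.+1%:R.
Hypothesis m12 : m1 != m2.
Hypothesis mD : tau * m1 + (1 - tau) * m2 = D.
Hypotheses (tau0 : 0 < tau) (tau1 : tau < 1) (eps0 : 0 < eps).
Hypotheses (gnm : annulus_gn p q g sg (tau - eps)) (gnp : annulus_gn p q g sg (tau + eps)).

(* [r0] is the radius where the amplitudes [u r^(-m1)] and [v r^(-m2)] coincide; away
   from it the smaller of the two decays strictly faster than [r^(-D)]. *)
Lemma averages_decay : exists2 eta, 0 < eta & exists2 K, 0 < K & forall f u v M r0 w,
  continuous f -> (forall x, M <= x -> f x = 0) -> 0 < u -> 0 < v -> 0 < r0 ->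
  u * r0 `^ (- m1) = w -> v * r0 `^ (- m2) = w ->
  (forall r, 0 < r -> dyadic_energy_le f p sg r ((u * r `^ (- m1)) `^ p * r `^ (1 - sg * p))) ->
  (forall r, 0 < r -> (\int[mu]_(y in `[r, (r * 2)%R]) (`|f y| `^ q)%:E <=
     ((v * r `^ (- m2)) `^ q * r)%:E)%E) ->
  forall k,
   `|avg f (r0 * 2 ^+ k) (r0 * 2 ^+ k * 2)| <= K * w * (2 ^+ k) `^ (- D - eta) /\
   `|avg f (r0 / 2 ^+ k) (r0 / 2 ^+ k * 2)| <= K * w * (2 ^+ k) `^ (D - eta).
Proof.
have [C C0 hC] := avg_annuli_le sg p1.
have p0 : 0 < p by apply: lt_le_trans p1.
have amp u r0 w m P : 0 < u -> 0 < r0 -> 0 < P -> u * r0 `^ (- m) = w ->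
    u * (r0 * P) `^ (- m) = w * P `^ (- m).
  by move=> u0 r00 P0 <-; rewrite powRM ?ltW// mulrA.
have ampV u r0 w m P : 0 < u -> 0 < r0 -> 0 < P -> u * r0 `^ (- m) = w ->
    u * (r0 / P) `^ (- m) = w * P `^ m.
  move=> u0 r00 P0 h; rewrite (amp _ _ w)// ?invr_gt0//.
  by rewrite -powR_inv1 ?ltW// -powRrM mulrNN mul1r.
have le_exp (P x y : R) : 1 <= P -> x <= y -> P `^ x <= P `^ y.
  by move=> P1 xy; rewrite ler_powR.
have P0 j : 0 < 2 ^+ j :> R by rewrite exprn_gt0.
have P1 j : 1 <= 2 ^+ j :> R by rewrite exprn_ege1// ler1n.
have [[m1D Dm2]|[m2D Dm1]] : m1 < D /\ D < m2 \/ m2 < D /\ D < m1.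
  have tau1' : 0 < 1 - tau by rewrite subr_gt0.
  move: m12; rewrite neq_lt -mD => /orP[]; rewrite -subr_gt0 => h; [left|right].
    have h1 := mulr_gt0 tau0 h; have h2 := mulr_gt0 tau1' h; split; lra.
  have h1 := mulr_gt0 tau0 h; have h2 := mulr_gt0 tau1' h; split; lra.
- pose m' := (Num.max m1 0 + D) / 2.
  have [mm0 mm1] : 0 <= Num.max m1 0 /\ m1 <= Num.max m1 0.
    by rewrite !le_max !lexx orbT.
  have mmD : Num.max m1 0 < D by rewrite gt_max m1D.
  have m'0 : 0 < m' by rewrite /m'; lra.
  have m'1 : m1 <= m' by rewrite /m'; lra.
  have m'D : m' < D by rewrite /m'; lra.
  pose s : R := 2 `^ m'.
  have s1 : 1 < s by rewrite /s powR_expR// -[ltLHS]expR0 ltr_expR mulr_gt0// ln2_gt0.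
  have d0 : 0 < 1 - s^-1 by rewrite subr_gt0 invf_lt1// (lt_trans ltr01).
  pose K := 2 + C / (1 - s^-1).
  have K2 : 2 <= K by rewrite lerDl divr_ge0// ltW.
  have K0 : 0 < K by apply: lt_le_trans K2.
  pose eta := Num.min (m2 - D) (D - m').
  have [eta1 eta2] : eta <= m2 - D /\ eta <= D - m' by rewrite !ge_min !lexx orbT.
  exists eta; first by rewrite lt_min !subr_gt0 Dm2.
  exists K => // f u v M r0 w cf fM u0 v0 r00 uw vw hA he k.
  have w0 : 0 < w by rewrite -uw mulr_gt0// powR_gt0.
  split.
    have r0k : 0 < r0 * 2 ^+ k by rewrite mulr_gt0.
    have e0 : 0 < v * (r0 * 2 ^+ k) `^ (- m2) by rewrite mulr_gt0// powR_gt0.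
    apply: (le_trans (norm_avg_le cf q1 r0k e0 (he _ r0k))).
    rewrite (amp _ _ w)// mulrA.
    apply: ler_pM; rewrite ?powR_ge0 ?mulr_ge0 ?(ltW w0)//.
      by rewrite ler_wpM2r ?(ltW w0).
    by apply: le_exp => //; lra.
  have H := @growing_chain_le (fun j => avg f (r0 / 2 ^+ j) (r0 / 2 ^+ j * 2)) (2 * w) (C * w) s s1.
  apply: (le_trans (H _ _ _ _ k)).
  + by rewrite mulr_ge0// ltW.
  + by rewrite mulr_ge0// ltW.
  + rewrite expr0 divr1 -vw; apply: (norm_avg_le cf q1 r00 _ (he _ r00)).
    by rewrite mulr_gt0// powR_gt0.
  + move=> j; rewrite distrC.
    have r0j : 0 < r0 / 2 ^+ j.+1 by rewrite divr_gt0.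
    have Er : r0 / 2 ^+ j = r0 / 2 ^+ j.+1 * 2.
      by rewrite exprS; field; rewrite gt_eqF.
    have a0 : 0 < u * (r0 / 2 ^+ j.+1) `^ (- m1) by rewrite mulr_gt0// powR_gt0.
    have := hC f _ _ cf r0j a0 (hA _ r0j).
    rewrite -Er => /le_trans; apply.
    rewrite (ampV _ _ w)// mulrA ler_wpM2l//; first by rewrite mulr_ge0// ltW.
    by rewrite /s -powR_natX; exact: le_exp.
  + rewrite (_ : 2 * w + C * w / (1 - s^-1) = K * w); last first.
      by rewrite [C * w / _]mulrAC -mulrDl.
    rewrite ler_wpM2l//; first by rewrite mulr_ge0// ltW.
    by rewrite /s -powR_natX; apply: le_exp => //; lra.
(* Case m2 < D < m1. Inwards the Coulomb amplitude grows slowly enough; outwards the differences of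
   means decay like 2^(-k m1) and are summed from infinity, where f vanishes. *)
- pose s : R := 2 `^ (- m1).
  have m10 : 0 < m1 by exact: lt_trans Dm1.
  have s0 : 0 < s by rewrite powR_gt0.
  have s1 : s < 1.
    by rewrite /s powR_expR// -[ltRHS]expR0 ltr_expR mulNr oppr_lt0 mulr_gt0// ln2_gt0.
  have d0 : 0 < 1 - s by rewrite subr_gt0.
  have Cd : 0 <= C / (1 - s) by rewrite divr_ge0// ltW.
  pose K := 2 + C / (1 - s).
  have K2 : 2 <= K by rewrite lerDl.
  have K0 : 0 < K by apply: lt_le_trans K2.
  pose eta := Num.min (m1 - D) (D - m2).
  have [eta1 eta2] : eta <= m1 - D /\ eta <= D - m2 by rewrite !ge_min !lexx orbT.
  exists eta; first by rewrite lt_min !subr_gt0 Dm1.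
  exists K => // f u v M r0 w cf fM u0 v0 r00 uw vw hA he k.
  have w0 : 0 < w by rewrite -uw mulr_gt0// powR_gt0.
  split; last first.
    have r0k : 0 < r0 / 2 ^+ k by rewrite divr_gt0.
    have e0 : 0 < v * (r0 / 2 ^+ k) `^ (- m2) by rewrite mulr_gt0// powR_gt0.
    apply: (le_trans (norm_avg_le cf q1 r0k e0 (he _ r0k))).
    rewrite (ampV _ _ w)// mulrA.
    apply: ler_pM; rewrite ?powR_ge0 ?mulr_ge0 ?(ltW w0)//.
      by rewrite ler_wpM2r ?(ltW w0).
    by apply: le_exp => //; lra.
  have [N hN] : exists N : nat, forall j, (N <= j)%N -> M <= r0 * 2 ^+ j.
    exists (Num.bound (`|M| / r0)) => j Nj.
    have h : 0 <= `|M| / r0 by rewrite divr_ge0// ltW.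
    have := archi_boundP h; rewrite ltr_pdivrMr// => h2.
    rewrite (le_trans (ler_norm M))// (le_trans (ltW h2))// mulrC ler_wpM2l ?(ltW r00)//.
    by rewrite -natrX ler_nat (leq_trans Nj)// ltnW// ltn_expl.
  have H := @vanishing_chain_le (fun j => avg f (r0 * 2 ^+ j) (r0 * 2 ^+ j * 2)) (C * w) s N s0 s1.
  apply: (le_trans (H _ _ _ k)).
  + by rewrite mulr_ge0// ltW.
  + move=> j Nj; rewrite /avg /Rintegral integral0_eq ?mulr0//.
    move=> x; rewrite /= in_itv/= => /andP[jx _].
    by rewrite fM//; exact: le_trans (hN _ Nj) jx.
  + move=> j.
    have r0j : 0 < r0 * 2 ^+ j by rewrite mulr_gt0.
    have Er : r0 * 2 ^+ j.+1 = r0 * 2 ^+ j * 2 by rewrite exprSr mulrA.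
    have a0 : 0 < u * (r0 * 2 ^+ j) `^ (- m1) by rewrite mulr_gt0// powR_gt0.
    have := hC f _ _ cf r0j a0 (hA _ r0j).
    rewrite -Er => /le_trans; apply.
    by rewrite (amp _ _ w)// mulrA /s powR_natX.
  + rewrite (_ : C * w / (1 - s) = C / (1 - s) * w); last by rewrite mulrAC.
    apply: ler_pM.
    * by rewrite mulr_ge0// ltW.
    * by rewrite exprn_ge0// ltW.
    * by rewrite ler_wpM2r ?(ltW w0)// lerDr.
    * by rewrite /s -powR_natX; apply: le_exp => //; lra.
Qed.

Lemma powR_geometric (w P x y t : R) : 0 < w -> 0 < P ->
  (w * P `^ x) `^ t * (w * P `^ y) `^ (1 - t) = w * P `^ (t * x + (1 - t) * y).
Proof. by move=> w0 P0; apply: ln_eq; [posr|posr|ln_expand]; ring. Qed.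

Lemma dyadic_sum_powR_le x (N : nat) : 0 < x ->
  \sum_(j < N) (2 ^+ j) `^ (- x) <= (1 - 2 `^ (- x))^-1 :> R.
Proof.
move=> x0; under eq_bigr do rewrite powR_natX.
apply: dyadic_geometric_sum_le; first exact: powR_ge0.
by rewrite powR_expR// -[ltRHS]expR0 ltr_expR mulNr oppr_lt0 mulr_gt0// ln2_gt0.
Qed.

(** A shift of t by eps moves t m1 + (1 - t) m2 by eps (m1 - m2). One direction raises this exponent
    above D, the other lowers it below D, and the sign of m1 - m2 decides which. *)
Lemma annulus_gnP : (m1 < m2) || (m2 < m1) ->
  annulus_gn p q g sg (tau - eps) -> annulus_gn p q g sg (tau + eps) ->
  (exists2 t, annulus_gn p q g sg t & t * m1 + (1 - t) * m2 = D + eps * `|m1 - m2|) /\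
  (exists2 t, annulus_gn p q g sg t & t * m1 + (1 - t) * m2 = D - eps * `|m1 - m2|).
Proof.
rewrite -mD; case/orP => h gm gp.
  rewrite ler0_norm; last by rewrite subr_le0 ltW.
  split; [exists (tau - eps)|exists (tau + eps)] => //; ring.
rewrite ger0_norm; last by rewrite subr_ge0 ltW.
split; [exists (tau + eps)|exists (tau - eps)] => //; ring.
Qed.

Lemma radial_profile_gn : exists2 C, 0 < C & forall f u v M,
  continuous f -> (forall x, M <= x -> f x = 0) ->
  (forall r, 0 < r -> exists2 L, 0 <= L & forall y z, r <= y <= r * 2 ->
    r <= z <= r * 2 -> `|f y - f z| <= L * `|y - z|) ->
  0 < u -> 0 < v ->
  (forall r, 0 < r -> dyadic_energy_le f p sg r ((u * r `^ (- m1)) `^ p * r `^ (1 - sg * p))) ->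
  (forall r, 0 < r -> (\int[mu]_(y in `[r, (r * 2)%R]) (`|f y| `^ q)%:E <=
     ((v * r `^ (- m2)) `^ q * r)%:E)%E) ->
  (\int[mu]_(x in `]0%R, +oo[) (`|f x| `^ g * `|x| ^+ n)%:E <=
    (C * (u `^ tau * v `^ (1 - tau)) `^ g)%:E)%E.
Proof.
have [eta1 eta10 [K K0 hK]] := averages_decay.
have m12' : (m1 < m2) || (m2 < m1) by rewrite -neq_lt.
have [[t1 [C1 C10 hC1] et1] [t2 [C2 C20 hC2] et2]] :=
  annulus_gnP m12' gnm gnp.
have eta20 : 0 < eps * `|m1 - m2| by rewrite mulr_gt0// normr_gt0 subr_eq0.
set eta2 := eps * _ in et1 et2 eta20.
pose eta := Num.min eta1 eta2.
have eta0 : 0 < eta by rewrite lt_min eta10.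
have [el1 el2] : eta <= eta1 /\ eta <= eta2 by rewrite !ge_min !lexx orbT.
have geta0 : 0 < g * eta by rewrite mulr_gt0.
pose B := 2 `^ g * (C1 + C2 + K `^ g) * 2 ^+ n.
have B0 : 0 < B.
  by rewrite /B mulr_gt0 ?exprn_gt0// mulr_gt0 ?powR_gt0// !addr_gt0 ?powR_gt0.
pose S := (1 - 2 `^ (- (g * eta)))^-1.
have S0 : 0 < S.
  rewrite invr_gt0 subr_gt0 powR_expR// -[ltRHS]expR0 ltr_expR mulNr oppr_lt0.
  by rewrite mulr_gt0// ln2_gt0.
have BS0 : 0 < B * S by exact: mulr_gt0.
exists (1 + B * S + B * S); first by lra.
move=> f u v M cf fM lipf u0 v0 hA he.
have mf : measurable_fun setT f by exact: continuous_measurable_fun.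
pose F x : \bar R := (`|f x| `^ g * `|x| ^+ n)%:E.
have F0 x : (0 <= F x)%E by rewrite lee_fin mulr_ge0 ?powR_ge0// exprn_ge0.
have mF : measurable_fun setT F.
  apply/measurable_EFinP; apply: measurable_funM.
    by apply/measurable_EFinP; exact: measurable_powR_norm.
  by apply: measurable_funX; exact: normr_measurable.
pose r0 := (v / u) `^ (m2 - m1)^-1.
have r00 : 0 < r0 by rewrite powR_gt0// divr_gt0.
have m21 : m2 - m1 != 0 by rewrite subr_eq0 eq_sym.
have lnr0 : ln r0 * (m2 - m1) = ln v - ln u.
  by rewrite /r0 ln_powR lnM ?lnV ?posrE ?invr_gt0// mulrAC mulVf// mul1r.
clearbody r0.
pose w := u * r0 `^ (- m1).
have w0 : 0 < w by rewrite mulr_gt0// powR_gt0.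
have vw : v * r0 `^ (- m2) = w.
  rewrite /w; apply: ln_eq; [posr|posr|ln_expand].
  by rewrite -[ln v](subrK (ln u)) -lnr0; ring.
(* Both amplitudes equal w at [r0], so tau m1 + (1 - tau) m2 = D identifies the right-hand side of
   the claim with the size of the annulus at [r0]. *)
have target : (u `^ tau * v `^ (1 - tau)) `^ g = w `^ g * r0 ^+ n.+1.
  rewrite -[r0 ^+ n.+1]powR_mulrn ?(ltW r00)// -gD.
  rewrite /w; apply: ln_eq; [posr|posr|ln_expand].
  by rewrite -[ln v](subrK (ln u)) -lnr0 -mD; ring.
have {}hK := hK f u v M r0 w cf fM u0 v0 r00 (erefl _) vw hA he.
have P0 j : 0 < 2 ^+ j :> R by rewrite exprn_gt0.
have P1 j : 1 <= 2 ^+ j :> R by rewrite exprn_ege1// ler1n.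
have annulus r X C : 0 < r -> 0 < X -> 0 < C -> C <= C1 + C2 ->
    (\int[mu]_(x in `[r, (r * 2)%R]) (`|f x - avg f r (r * 2)| `^ g)%:E <= (C * X `^ g * r)%:E)%E ->
    `|avg f r (r * 2)| <= K * X ->
    (\int[mu]_(x in `[r, (r * 2)%R]) F x <= (B * (X `^ g * r ^+ n.+1))%:E)%E.
  move=> rp Xp Cp CC h1 h2.
  apply: (le_trans (annulus_total_le n mf g0 rp (ltW Xp) (ltW Cp) (ltW K0) h1 h2)).
  rewrite lee_fin /B ler_wpM2r//.
    by rewrite mulr_ge0 ?powR_ge0// exprn_ge0// ltW.
  by rewrite ler_wpM2r ?exprn_ge0// ler_wpM2l ?powR_ge0// lerD2r.
have powX (P x y t : R) : 0 < P -> (w * P `^ x) `^ t * (w * P `^ y) `^ (1 - t) =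
    w * P `^ (t * x + (1 - t) * y).
  by move=> Pp; exact: powR_geometric.
have le_pow_X Y X : 0 <= Y -> Y <= X -> Y `^ g <= X `^ g.
  by move=> Y0 YX; apply: ge0_ler_powR; rewrite ?nnegrE ?(ltW g0) ?(le_trans Y0).
(* Beyond [r0] the parameter with exponent above D is used, so that the annulus of index k
   contributes at most 2^(-k g eta) times the central size; below [r0] the parameter with exponent
   below D does the same. *)
have outer k : (\int[mu]_(x in `[(r0 * 2 ^+ k)%R, (r0 * 2 ^+ k * 2)%R]) F x <=
    (B * (w `^ g * r0 ^+ n.+1) * (2 ^+ k) `^ (- (g * eta)))%:E)%E.
  have rp : 0 < r0 * 2 ^+ k by rewrite mulr_gt0.
  have [L L0 hL] := lipf _ rp.
  have a0 : 0 < u * (r0 * 2 ^+ k) `^ (- m1) by rewrite mulr_gt0// powR_gt0.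
  have e0 : 0 < v * (r0 * 2 ^+ k) `^ (- m2) by rewrite mulr_gt0// powR_gt0.
  pose X := w * (2 ^+ k) `^ (- D - eta).
  have X0 : 0 < X by rewrite mulr_gt0// powR_gt0.
  have h1 := hC1 f _ _ _ L cf rp a0 e0 L0 hL (hA _ rp) (he _ rp).
  have ea : u * (r0 * 2 ^+ k) `^ (- m1) = w * (2 ^+ k) `^ (- m1).
    by rewrite /w powRM ?mulrA ?(ltW r00) ?(ltW (P0 k)).
  have ev : v * (r0 * 2 ^+ k) `^ (- m2) = w * (2 ^+ k) `^ (- m2).
    by rewrite -vw powRM ?mulrA ?(ltW r00) ?(ltW (P0 k)).
  have := annulus _ X C1 rp X0 C10 _ _ _.
  rewrite (_ : B * (X `^ g * _) = B * (w `^ g * r0 ^+ n.+1) * (2 ^+ k) `^ (- (g * eta))); last first.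
    rewrite -[(_ * _) ^+ n.+1]powR_mulrn ?(ltW rp)// -[r0 ^+ _]powR_mulrn ?(ltW r00)// -gD /X.
    have := P0 k; set P := 2 ^+ k => Pp.
    clearbody B w P; apply: ln_eq; [posr|posr|ln_expand]; ring.
  apply.
  - by rewrite lerDl ltW.
  - apply: (le_trans h1); rewrite lee_fin; apply: ler_wpM2r; first exact: ltW.
    apply: ler_wpM2l; first exact: ltW.
    apply: le_pow_X.
      by apply: mulr_ge0; exact: powR_ge0.
    rewrite ea ev (powX _ _ _ _ (P0 k)); apply: ler_wpM2l; first exact: ltW.
    apply: ler_powR; first exact: P1.
    by rewrite !mulrN -opprD et1 opprD lerD2l lerN2.
  - apply: (le_trans (hK k).1); rewrite /X mulrA; apply: ler_wpM2l.
      by apply: mulr_ge0; exact: ltW.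
    apply: ler_powR; [exact: P1|by rewrite lerD2l lerN2].
have inner k : (\int[mu]_(x in `[(r0 / 2 ^+ k)%R, (r0 / 2 ^+ k * 2)%R]) F x <=
    (B * (w `^ g * r0 ^+ n.+1) * (2 ^+ k) `^ (- (g * eta)))%:E)%E.
  have rp : 0 < r0 / 2 ^+ k by rewrite divr_gt0.
  have [L L0 hL] := lipf _ rp.
  have a0 : 0 < u * (r0 / 2 ^+ k) `^ (- m1) by rewrite mulr_gt0// powR_gt0.
  have e0 : 0 < v * (r0 / 2 ^+ k) `^ (- m2) by rewrite mulr_gt0// powR_gt0.
  pose X := w * (2 ^+ k) `^ (D - eta).
  have X0 : 0 < X by rewrite mulr_gt0// powR_gt0.
  have h1 := hC2 f _ _ _ L cf rp a0 e0 L0 hL (hA _ rp) (he _ rp).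
  have inv m : (r0 / 2 ^+ k) `^ (- m) = r0 `^ (- m) * (2 ^+ k) `^ m.
    have := P0 k; set P := 2 ^+ k => Pp; clearbody P.
    by apply: ln_eq; [posr|posr|ln_expand]; ring.
  have ea : u * (r0 / 2 ^+ k) `^ (- m1) = w * (2 ^+ k) `^ m1 by rewrite inv mulrA.
  have ev : v * (r0 / 2 ^+ k) `^ (- m2) = w * (2 ^+ k) `^ m2 by rewrite inv mulrA vw.
  have := annulus _ X C2 rp X0 C20 _ _ _.
  rewrite (_ : B * (X `^ g * _) = B * (w `^ g * r0 ^+ n.+1) * (2 ^+ k) `^ (- (g * eta))); last first.
    rewrite -[(_ / _) ^+ n.+1]powR_mulrn ?(ltW rp)// -[r0 ^+ _]powR_mulrn ?(ltW r00)// -gD /X.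
    have := P0 k; set P := 2 ^+ k => Pp.
    clearbody B w P; apply: ln_eq; [posr|posr|ln_expand]; ring.
  apply.
  - by rewrite lerDr ltW.
  - apply: (le_trans h1); rewrite lee_fin; apply: ler_wpM2r; first exact: ltW.
    apply: ler_wpM2l; first exact: ltW.
    apply: le_pow_X.
      by apply: mulr_ge0; exact: powR_ge0.
    rewrite ea ev (powX _ _ _ _ (P0 k)); apply: ler_wpM2l; first exact: ltW.
    apply: ler_powR; first exact: P1.
    by rewrite et2 lerD2l lerN2.
  - apply: (le_trans (hK k).2); rewrite /X mulrA; apply: ler_wpM2l.
      by apply: mulr_ge0; exact: ltW.
    apply: ler_powR; [exact: P1|by rewrite lerD2l lerN2].
set W := w `^ g * r0 ^+ n.+1 in target outer inner.
have W0 : 0 < W by rewrite mulr_gt0 ?powR_gt0// exprn_gt0.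
have BW0 : 0 <= B * W by rewrite mulr_ge0// ltW.
have [M0 M00 hM0] : exists2 M0, 0 < M0 & forall x, 0 <= x <= r0 -> `|f x| <= M0.
  have [|c _ hc] := @EVT_max R (fun x => `|f x|) 0 r0 (ltW r00).
    apply: continuous_subspaceT => x.
    apply: (@continuous_comp _ _ _ f (fun y : R => `|y|)); first exact: cf.
    exact: norm_continuous.
  exists (`|f c| + 1); first by rewrite ltr_wpDl.
  by move=> x xr; rewrite (le_trans (hc _ _)) ?lerDl// in_itv.
(* N puts the support of f on the half-line below r0 2^N and makes the contribution of (0, r0 / 2^N]
   at most W by the crude bound [M0]. It depends on f, but the geometric sums are bounded uniformly
   in N. *)
have [N [NM NW]] : exists N, M <= r0 * 2 ^+ N /\ M0 `^ g * r0 ^+ n.+1 / W <= 2 ^+ N.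
  pose Z := `|M| / r0 + M0 `^ g * r0 ^+ n.+1 / W.
  have z1 : 0 <= `|M| / r0 by rewrite divr_ge0// ltW.
  have z2 : 0 <= M0 `^ g * r0 ^+ n.+1 / W.
    by rewrite divr_ge0 ?(ltW W0)// mulr_ge0 ?powR_ge0// exprn_ge0// ltW.
  have h : Z <= 2 ^+ Num.bound Z.
    apply: (le_trans (ltW (archi_boundP (addr_ge0 z1 z2)))).
    by rewrite -natrX ler_nat ltnW// ltn_expl.
  exists (Num.bound Z); split.
    rewrite (le_trans (ler_norm M))// mulrC -ler_pdivrMr//; apply: le_trans h.
    by rewrite /Z lerDl.
  by apply: le_trans h; rewrite /Z lerDr.
have near0 : (\int[mu]_(x in `]0%R, (r0 / 2 ^+ N)%R]) F x <= W%:E)%E.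
  have dN : 0 < r0 / 2 ^+ N by rewrite divr_gt0.
  have dN1 : r0 / 2 ^+ N <= r0 by rewrite ler_pdivrMr// ler_peMr// ltW.
  apply: (@le_trans _ _ (\int[mu]_(x in `]0%R, (r0 / 2 ^+ N)%R]) (M0 `^ g * r0 ^+ n)%:E)%E).
    apply: ge0_le_integral => //.
    - exact: measurable_funTS.
    - move=> x; rewrite /= in_itv/= => /andP[x0 xN]; rewrite lee_fin.
      have xr : x <= r0 by exact: le_trans xN dN1.
      apply: ler_pM; rewrite ?powR_ge0 ?exprn_ge0//.
        by rewrite ge0_ler_powR ?nnegrE ?(ltW g0) ?(ltW M00)// hM0// (ltW x0).
      by rewrite lerXn2r ?nnegrE ?(ltW r00)// gtr0_norm.
  have -> : (\int[mu]_(x in `]0%R, (r0 / 2 ^+ N)%R]) (M0 `^ g * r0 ^+ n)%:E =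
    (M0 `^ g * r0 ^+ n)%:E * mu `]0%R, (r0 / 2 ^+ N)%R]%classic)%E by rewrite integral_cst.
  rewrite lebesgue_measure_itv/= lte_fin dN -EFinB subr0 -EFinM lee_fin mulrA.
  by rewrite -[_ * _ * r0]mulrA -exprSr ler_pdivrMr// [W * _]mulrC -ler_pdivrMr.
have sum_le : \sum_(k < N) (2 ^+ k) `^ (- (g * eta)) <= S by exact: dyadic_sum_powR_le.
have far : (\int[mu]_(x in `]r0, (r0 * 2 ^+ N)%R]) F x <= (B * W * S)%:E)%E.
  have := @integral_partition_le F (fun k => r0 * 2 ^+ k) N mF F0.
  rewrite expr0 mulr1 => /le_trans; apply.
  apply: (@le_trans _ _ (\sum_(k < N) (B * W * (2 ^+ k) `^ (- (g * eta)))%:E)%E).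
    by apply: lee_sum => k _; rewrite exprSr mulrA; exact: outer.
  by rewrite sumEFin lee_fin -mulr_sumr ler_wpM2l.
have close : (\int[mu]_(x in `](r0 / 2 ^+ N)%R, r0]) F x <= (B * W * S)%:E)%E.
  (* The partition points must increase, so the inner annuli are listed from r0 / 2^N outwards, with
     reversed index N - k. *)
  have := @integral_partition_le F (fun k => r0 / 2 ^+ (N - k)) N mF F0.
  rewrite subn0 subnn expr0 divr1 => /le_trans; apply.
  apply: (@le_trans _ _ (\sum_(k < N) (B * W * (2 ^+ (N - k)) `^ (- (g * eta)))%:E)%E).
    apply: lee_sum => k _.
    have -> : r0 / 2 ^+ (N - k.+1) = r0 / 2 ^+ (N - k) * 2.
      rewrite -[(N - k)%N]prednK ?subn_gt0// -subnS exprS.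
      by have := P0 (N - k.+1)%N; set P := 2 ^+ _ => Pp; field; rewrite gt_eqF.
    exact: inner.
  rewrite sumEFin lee_fin -mulr_sumr ler_wpM2l//; apply: le_trans sum_le.
  rewrite (reindex_inj rev_ord_inj)/=; apply: ler_sum => k _.
  rewrite subKn// !powR_natX exprS ler_piMl ?exprn_ge0 ?powR_ge0//.
  by rewrite -[leRHS](powRr0 2) ler_powR ?ler1n// oppr_le0 ltW.
have tail : (\int[mu]_(x in `](r0 * 2 ^+ N)%R, +oo[) F x = 0)%E.
  apply: integral0_eq => x; rewrite /= in_itv/= andbT => xN.
  by rewrite /F fM ?normr0 ?powR0 ?gt_eqF ?mul0r// (le_trans NM)// ltW.
rewrite target -/W.
pose D1 : set R := [set` `]0%R, (r0 / 2 ^+ N)%R]]; pose D2 : set R := [set` `](r0 / 2 ^+ N)%R, r0]].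
pose D3 : set R := [set` `]r0, (r0 * 2 ^+ N)%R]]; pose D4 : set R := [set` `](r0 * 2 ^+ N)%R, +oo[].
have [mD1 mD2 mD3 mD4] : [/\ measurable (D1 : set (measurableTypeR R)), measurable (D2 : set (measurableTypeR R)),
    measurable (D3 : set (measurableTypeR R)) & measurable (D4 : set (measurableTypeR R))] by split; exact: measurable_itv.
have mD34 := measurableU _ _ mD3 mD4.
have mD234 := measurableU _ _ mD2 mD34.
apply: (@le_trans _ _ (\int[mu]_(x in D1 `|` (D2 `|` (D3 `|` D4))) F x)%E).
  apply: ge0_subset_integral => //.
  - exact: (measurableU _ _ mD1 mD234).
  - exact: measurable_funTS.
  - move=> x; rewrite /= /D1 /D2 /D3 /D4 /= !in_itv/= !andbT => x0.
    have [h1|h1] := leP x (r0 / 2 ^+ N); first by left; rewrite x0.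
    have [h2|h2] := leP x r0; first by right; left.
    have [h3|h3] := leP x (r0 * 2 ^+ N); first by right; right; left.
    by right; right; right.
apply: (le_trans (integral_setU_le mD1 mD234 mF F0)).
rewrite (_ : (1 + B * S + B * S) * W = W + (B * W * S + (B * W * S + 0))); last by ring.
rewrite !EFinD; apply: leeD => //.
apply: (le_trans (integral_setU_le mD2 mD34 mF F0)).
apply: leeD => //.
apply: (le_trans (integral_setU_le mD3 mD4 mF F0)).
by apply: leeD => //; rewrite /D4 tail.
Qed.

End sum_over_annuli.
End summation.

(** * The radial profile *)

Section profile.
Context {R : realType}.
Notation mu := (@lebesgue_measure R).

Lemma continuous_rV_measurable n (g : 'rV[R]_n -> R) :
  continuous g -> measurable_fun setT g.
Proof.
move=> /continuousP cg; apply: (measurability _ (RGenOpens.measurableE R)).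
move=> _ [_ [a [b ->]] <-]; rewrite setTI measurable_rVE.
by apply: sub_sigma_algebra; apply: cg; exact: interval_open.
Qed.

Lemma le_coord_enorm n (x : 'rV[R]_n) i : `|x ord0 i| <= enorm x.
Proof.
rewrite -sqrtr_sqr ler_wsqrtr// (bigD1 i)//= lerDl sumr_ge0// => j _.
exact: sqr_ge0.
Qed.

Lemma enorm_le_coord n (x : 'rV[R]_n) b : 0 <= b ->
  (forall i, `|x ord0 i| <= b) -> enorm x <= n%:R * b.
Proof.
move=> b0 xb.
have nb0 : 0 <= n%:R * b by rewrite mulr_ge0.
rewrite -[leRHS]ger0_norm// -sqrtr_sqr ler_wsqrtr//.
apply: (@le_trans _ _ (\sum_(i < n) b ^+ 2)).
  by apply: ler_sum => i _; rewrite -real_normK ?num_real// lerXn2r ?nnegrE.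
rewrite sumr_const card_ord -[leLHS]mulr_natl exprMn ler_wpM2r ?sqr_ge0//.
by rewrite -natrX ler_nat; case: n {x xb nb0} => // m; rewrite -[X in (X <= _)%N]expn1 leq_pexp2l.
Qed.

Lemma enorm0 n : enorm (0 : 'rV[R]_n) = 0.
Proof. by rewrite /enorm big1 ?sqrtr0// => i _; rewrite mxE expr0n. Qed.

Lemma enormZ n (a : R) (x : 'rV[R]_n) : enorm (a *: x) = `|a| * enorm x.
Proof.
rewrite -sqrtr_sqr -sqrtrM ?sqr_ge0// mulr_sumr; congr Num.sqrt.
by apply: eq_bigr => i _; rewrite mxE exprMn.
Qed.

Lemma enorm_eq0 n (x : 'rV[R]_n) : enorm x = 0 -> x = 0.
Proof.
move=> x0; apply/rowP => i; rewrite mxE; apply/eqP; rewrite -normr_le0 -x0.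
exact: le_coord_enorm.
Qed.

Lemma rV_cons_scale n (t : R) :
  rV_cons (t, 0 : 'rV[R]_n) = t *: delta_mx ord0 ord0.
Proof.
apply/rowP => i; case: (unliftP ord0 i) => [j|] ->.
  by rewrite rV_consS !mxE/= mulr0.
by rewrite rV_cons0 !mxE !eqxx mulr1.
Qed.

Section lines.
Variables (n : nat) (g : 'rV[R]_n -> R).
Hypothesis dg : forall x, differentiable g x.

Lemma is_derive_line w (t : R) :
  is_derive t 1 (fun s : R => g (s *: w)) ('D_w g (t *: w)).
Proof.
have E : (fun h : R => h^-1 *: (((fun s : R => g (s *: w)) \o shift t) (h *: 1) - g (t *: w))) =
   (fun h : R => h^-1 *: ((g \o shift (t *: w)) (h *: w) - g (t *: w))).
  by apply/funext => h /=; rewrite [h *: 1]mulr1 scalerDl.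
apply: DeriveDef; last by rewrite /derive E.
have := @diff_derivable _ _ _ g (t *: w) w (dg _).
by rewrite /derivable E.
Qed.

Lemma derive_gradient (w x : 'rV[R]_n) : 'D_w g x = \sum_i w ord0 i * gradient g x ord0 i.
Proof.
rewrite deriveE// {1}[w]row_sum_delta linear_sum; apply: eq_bigr => i _.
by rewrite linearZ/= mxE deriveE.
Qed.

Lemma derive_le_gradient (w x : 'rV[R]_n) : (forall i, `|w ord0 i| <= 1) ->
  `|'D_w g x| <= n%:R * enorm (gradient g x).
Proof.
move=> w1; rewrite derive_gradient (le_trans (ler_norm_sum _ _ _))//.
rewrite mulr_natl -[X in _ *+ X]card_ord -sumr_const; apply: ler_sum => i _.
by rewrite normrM -[leRHS]mul1r ler_pM// le_coord_enorm.
Qed.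

End lines.

Section radial.
Variables (n : nat) (g : 'rV[R]_n.+1 -> R).
Hypotheses (hg : C1c_rad g).
Let dg : forall x, differentiable g x. Proof. by case: hg => -[]. Qed.
Let cdg : forall i, continuous (fun x => 'D_(delta_mx ord0 i) g x).
Proof. by case: hg => -[]. Qed.

(** Taken along the whole first axis, negative half included, the profile is differentiable at 0
    too. *)
Definition profile (t : R) : R := g (rV_cons (t, 0)).
Definition dprofile (t : R) : R := 'D_(delta_mx ord0 ord0) g (rV_cons (t, 0)).

Lemma profile_enorm x : g x = profile (enorm x).
Proof.
case: hg => _ _; apply.
by rewrite enorm_cons enorm0 expr0n addr0 sqrtr_sqr ger0_norm// enorm_ge0.
Qed.

Let continuous_ray : continuous (fun t : R => rV_cons (t, 0 : 'rV[R]_n)).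
Proof.
rewrite (_ : (fun _ => _) = (fun t : R => t *: delta_mx ord0 ord0)); last first.
  by apply/funext => t; exact: rV_cons_scale.
by move=> t; apply: scalel_continuous.
Qed.

Lemma continuous_profile : continuous profile.
Proof.
move=> t; apply: (@continuous_comp _ _ _ (fun t : R => rV_cons (t, 0 : 'rV[R]_n)) g).
  exact: continuous_ray.
exact: differentiable_continuous.
Qed.

Lemma continuous_dprofile : continuous dprofile.
Proof.
move=> t; apply: (@continuous_comp _ _ _ (fun t : R => rV_cons (t, 0 : 'rV[R]_n))
  (fun x => 'D_(delta_mx ord0 ord0) g x)).
  exact: continuous_ray.
exact: cdg.
Qed.

Lemma is_derive_profile (t : R) : is_derive t 1 profile (dprofile t).
Proof.
rewrite /dprofile rV_cons_scale.
have := is_derive_line dg (delta_mx ord0 ord0) t.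
by congr (is_derive t 1 _ _); apply/funext => s; rewrite /profile rV_cons_scale.
Qed.

(* A unit vector along x has coordinates bounded by 1, which is all that is needed
   up to a dimensional constant. *)
Lemma dprofile_enorm_le x : 0 < enorm x ->
  `|dprofile (enorm x)| <= n.+1%:R * enorm (gradient g x).
Proof.
move=> x0; pose w := (enorm x)^-1 *: x.
have xw : x = enorm x *: w by rewrite scalerA divff ?gt_eqF// scale1r.
have w1 i : `|w ord0 i| <= 1.
  have -> : w ord0 i = x ord0 i / enorm x by rewrite mxE mulrC.
  by rewrite normf_div [`|enorm x|]gtr0_norm// ler_pdivrMr// mul1r le_coord_enorm.
have lw (t : R) : 0 < t -> g (t *: w) = profile t.
  move=> t0; rewrite profile_enorm; congr profile.
  rewrite scalerA enormZ normf_div (gtr0_norm t0) (gtr0_norm x0).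
  by rewrite -mulrA mulVf ?gt_eqF// mulr1.
(* Along the ray of w, g agrees with the profile near t = |x|, so the derivative of g at x in
   direction w is that of the profile at |x|. *)
have <- : 'D_w g x = dprofile (enorm x); last exact: derive_le_gradient.
rewrite {1}xw -[LHS](@derive_val _ _ _ _ _ _ _ (is_derive_line dg w (enorm x))).
rewrite -[RHS](@derive_val _ _ _ _ _ _ _ (is_derive_profile (enorm x))).
apply: near_eq_derive.
by near=> t; apply: lw; near: t; exact: lt_nbhsr.
Unshelve. all: by end_near. Qed.

Lemma measurable_gradient : measurable_fun setT (fun x => enorm (gradient g x)).
Proof.
apply: (measurableT_comp measurable_sqrtr).
apply: (@measurable_sum _ _ _ _ _ _ (fun i (x : 'rV[R]_n.+1) => gradient g x ord0 i ^+ 2)) => i.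
apply: measurable_funX.
rewrite (_ : (fun _ => _) = (fun x => 'D_(delta_mx ord0 i) g x)).
  exact: continuous_rV_measurable.
by apply/funext => x; rewrite mxE.
Qed.

Lemma profile_support : exists2 M, 0 < M & forall t, M <= t -> profile t = 0.
Proof.
case: hg => _ cg _.
have /compact_bounded[M [_ hM]] :
    compact ((fun x : 'rV[R]_n.+1 => x ord0 ord0) @` closure [set x | g x != 0]).
  apply: continuous_compact cg; apply: continuous_subspaceT => x.
  exact: coord_continuous.
(* Boundedness holds for every constant strictly above M; |M| + 1 is one, and the further unit gives
   the contradiction. *)
exists (`|M| + 2); first by rewrite ltr_wpDl.
move=> t Mt; apply/eqP/negP => /negP t0.
have /(hM (`|M| + 1) _)/= : ((fun x : 'rV[R]_n.+1 => x ord0 ord0) @` closure [set x | g x != 0]) t.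
  by exists (rV_cons (t, 0)); [exact: subset_closure|rewrite rV_cons0].
rewrite (le_lt_trans (ler_norm M)) ?ltrDl// => /(_ isT).
by have := ler_norm t; lra.
Qed.

Lemma profile_bounded : exists2 B, 0 < B & forall t, 0 <= t -> `|profile t| <= B.
Proof.
have [M M0 hM] := profile_support.
have [|c _ hc] := @EVT_max R (fun x => `|profile x|) 0 M (ltW M0).
  apply: continuous_subspaceT => x.
  apply: (@continuous_comp _ _ _ profile (fun y : R => `|y|)); first exact: continuous_profile.
  exact: norm_continuous.
exists (`|profile c| + 1); first by rewrite ltr_wpDl.
move=> t t0; have [Mt|tM] := leP M t; first by rewrite hM// normr0 addr_ge0.
by rewrite (le_trans (hc _ _)) ?lerDl// in_itv/= t0 ltW.
Qed.

Lemma profile_lipschitz a b : a <= b -> exists2 L, 0 <= L &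
  forall y z, a <= y <= b -> a <= z <= b ->
    `|profile y - profile z| <= L * `|y - z|.
Proof.
move=> ab.
have [|c _ hc] := @EVT_max R (fun x => `|dprofile x|) a b ab.
  apply: continuous_subspaceT => x.
  apply: (@continuous_comp _ _ _ dprofile (fun y : R => `|y|)); first exact: continuous_dprofile.
  exact: norm_continuous.
exists `|dprofile c| => //.
suff H y z : a <= y -> z <= b -> y <= z -> `|profile y - profile z| <= `|dprofile c| * `|y - z|.
  move=> y z /andP[ay yb] /andP[az zb]; have [yz|zy] := leP y z; first exact: H.
  by rewrite distrC [`|y - z|]distrC; apply: H => //; exact: ltW.
move=> ay zb yz.
have [||k] := @MVT_segment R profile dprofile y z yz.
- by move=> x _; exact: is_derive_profile.
- by apply: continuous_subspaceT => x; exact: continuous_profile.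
rewrite in_itv/= => /andP[yk kz] E.
rewrite distrC E normrM [`|z - y|]distrC ler_wpM2r// hc// in_itv/=.
by rewrite (le_trans ay)//= (le_trans kz).
Qed.

End radial.
End profile.

(** * Lower bounds for the energies *)

Section energy_bounds.
Context {R : realType}.
Notation mu := (@lebesgue_measure R).
Local Notation leb := (lebesgue_rV R).

Lemma tube_annulus_le n (F : R -> \bar R) (v : 'rV[R]_n) (r del a b : R) :
  measurable_fun setT F -> (forall x, 0 <= F x)%E -> 0 < del -> 0 <= r -> r < a ->
  (forall u : 'rV[R]_n, (forall i, `|u ord0 i - v ord0 i| < del) -> enorm u <= r) ->
  (((2 * del) ^+ n)%:E * \int[mu]_(t in `[a, b]) F t <=
   \int[leb n.+1]_(y in tube v del) F (enorm y))%E.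
Proof.
move=> mF F0 d0 r0 ra vr; apply: le_trans (le_integral_enorm mF F0 d0 r0 vr).
rewrite lee_wpmul2l ?lee_fin ?exprn_ge0 ?mulr_ge0 ?(ltW d0)//.
apply: ge0_subset_integral => //; first exact: measurable_funTS.
by move=> x; rewrite /= !in_itv/= andbT => /andP[ax _]; exact: lt_le_trans ax.
Qed.

Lemma integral_tube_le n (v : 'rV[R]_n) del (G : 'rV[R]_n.+1 -> \bar R) :
  measurable_fun setT G -> (forall x, 0 <= G x)%E ->
  (\int[leb n.+1]_(y in tube v del) G y <= \int[leb n.+1]_y G y)%E.
Proof.
move=> mG G0; apply: ge0_subset_integral => //.
exact: measurable_tube.
Qed.

(** The tube around the first axis has width proportional to r: its cross-section has volume
    comparable to r^n, the weight expected from polar coordinates, and its transverse vectors have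
    norm at most r / 2, so every radius in [r, b] is met. *)
Lemma annulus_le_integral n (F : R -> \bar R) (r b : R) :
  measurable_fun setT F -> (forall x, 0 <= F x)%E -> 0 < r ->
  (((r / n.+1%:R) ^+ n)%:E * \int[mu]_(t in `[r, b]) F t <=
   \int[leb n.+1]_y F (enorm y))%E.
Proof.
move=> mF F0 r0.
have n0 : 0 < n.+1%:R :> R by rewrite ltr0n.
pose del := r / n.+1%:R / 2.
have d0 : 0 < del by rewrite !divr_gt0.
have h (u : 'rV[R]_n) : (forall i, `|u ord0 i - (0 : 'rV[R]_n) ord0 i| < del) -> enorm u <= r / 2.
  move=> ud; apply: (le_trans (@enorm_le_coord _ _ u del (ltW d0) _)).
    by move=> i; have := ud i; rewrite mxE subr0 => /ltW.
  rewrite /del mulrA ler_wpM2r// mulrCA ler_piMr ?(ltW r0)//.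
  by rewrite ler_pdivrMr// mul1r ler_nat.
have r2 : r / 2 < r by rewrite ltr_pdivrMr// ltr_pMr// ltr1n.
have r20 : 0 <= r / 2 by rewrite divr_ge0// ltW.
have := tube_annulus_le b mF F0 d0 r20 r2 h.
rewrite {1}/del mulrC divfK// => /le_trans; apply.
by apply: integral_tube_le => //; apply: (measurableT_comp mF); exact: measurable_enorm.
Qed.

Lemma lebesgue_rV_set1 n (x : 'rV[R]_n.+1) : leb n.+1 [set x] = 0%E.
Proof.
rewrite (_ : [set x] = [set y : 'rV[R]_n.+1 | forall i, [set x ord0 i] (y ord0 i)]).
  rewrite (@lebesgue_rV_box R n.+1 (fun i => [set x ord0 i])) => [|i].
    by rewrite big_ord_recl/= lebesgue_measure_set1 mul0e.
  exact: measurable_set1.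
apply/seteqP; split => y /=; first by move=> -> i.
by move=> yx; apply/rowP => i; exact: yx.
Qed.

Lemma measurable_rV_set1 n (x : 'rV[R]_n) : measurable [set x].
Proof.
rewrite (_ : [set x] = [set y : 'rV[R]_n | forall i, [set x ord0 i] (y ord0 i)]).
  by apply: (@measurable_rV_box R n (fun i => [set x ord0 i])) => i; exact: measurable_set1.
apply/seteqP; split => y /=; first by move=> -> i.
by move=> yx; apply/rowP => i; exact: yx.
Qed.

Lemma measurable_enormB n :
  measurable_fun setT (fun z : 'rV[R]_n * 'rV[R]_n => enorm (z.1 - z.2)).
Proof.
apply: (measurableT_comp (@measurable_enorm R n)); apply/measurable_fun_rVP => i.
under eq_fun do rewrite !mxE.
apply: measurable_funB.
- exact: (measurableT_comp (measurable_rV_coord i) measurable_fst).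
- exact: (measurableT_comp (measurable_rV_coord i) measurable_snd).
Qed.

Lemma measurable_riesz n (h : 'rV[R]_n * 'rV[R]_n -> R) N :
  measurable_fun setT h ->
  measurable_fun setT (fun z => (h z / enorm (z.1 - z.2) `^ N)%:E).
Proof.
move=> mh; apply/measurable_EFinP; apply: measurable_funM => //.
under eq_fun do rewrite -powRN.
apply: (measurableT_comp (measurable_powR (- N))); exact: measurable_enormB.
Qed.

Lemma lee_sqr_sqrt (x : \bar R) e : (0 <= x)%E -> (x * x <= e%:E)%E ->
  (x <= (Num.sqrt e)%:E)%E.
Proof.
case: x => [x| |]//.
rewrite !lee_fin => x0; rewrite -expr2 => xe.
  by rewrite -[x]ger0_norm// -sqrtr_sqr ler_wsqrtr.
Qed.

(** Two points where h is nonzero have coordinates at most 2 r apart, hence distance at most (n + 1)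
    2 r; this bounds the kernel from below by a constant. *)
Lemma integral_square_le_riesz n (h : 'rV[R]_n.+1 -> R) (r N : R) :
  measurable_fun setT h -> (forall x, 0 <= h x) -> 0 <= N -> 0 < r ->
  (forall x, h x != 0 -> enorm x <= r) ->
  ((\int[leb n.+1]_x (h x)%:E) * (\int[leb n.+1]_x (h x)%:E) *
    ((n.+1%:R * (2 * r)) `^ (- N))%:E <=
   \int[leb n.+1]_x \int[leb n.+1]_y (h x * h y / enorm (x - y) `^ N)%:E)%E.
Proof.
move=> mh h0 N0 r0 hr.
set c := _ `^ (- N); have c0 : 0 <= c by exact: powR_ge0.
have mhE : measurable_fun setT (fun x => (h x)%:E) by exact/measurable_EFinP.
set J := (\int[leb n.+1]_x (h x)%:E)%E.
have J0 : (0 <= J)%E by apply: integral_ge0 => x _; rewrite lee_fin.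
have mK := @measurable_riesz n.+1 (fun z => h z.1 * h z.2) N.
have {}mK : measurable_fun setT (fun z : 'rV[R]_n.+1 * 'rV[R]_n.+1 =>
    (h z.1 * h z.2 / enorm (z.1 - z.2) `^ N)%:E).
  apply: mK; apply: measurable_funM.
  - exact: (measurableT_comp mh measurable_fst).
  - exact: (measurableT_comp mh measurable_snd).
have K0 z : (0 <= (h z.1 * h z.2 / enorm (z.1 - z.2) `^ N)%:E)%E.
  by rewrite lee_fin divr_ge0 ?powR_ge0// mulr_ge0.
have -> : (J * J * c%:E = \int[leb n.+1]_x ((h x)%:E * (J * c%:E)))%E.
  rewrite (@ge0_integralZr _ _ _ (leb n.+1) setT measurableT (fun x => (h x)%:E)) -/J ?muleA//.
  - by move=> x _; rewrite lee_fin.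
  - by rewrite mule_ge0.
apply: ge0_le_integral => //.
- by move=> x _; rewrite !mule_ge0// lee_fin.
- by apply: emeasurable_funM => //; exact: measurable_cst.
- exact: (@measurable_integral_in _ _ _ _ _ (leb n.+1) _ mK).
move=> x _.
have -> : ((h x)%:E * (J * c%:E) = \int[leb n.+1]_y ((h y)%:E * (h x * c)%:E))%E.
  rewrite (@ge0_integralZr _ _ _ (leb n.+1) setT measurableT (fun x => (h x)%:E)) -/J//; last 2 first.
  - by move=> y _; rewrite lee_fin.
  - by rewrite lee_fin mulr_ge0.
  by rewrite -/J EFinM muleA [(_ * J)%E]muleC -muleA.
(* At y = x and N > 0 the kernel is 0 by the convention on division, so the pointwise bound may fail
   there; this single point is discarded as a null set. *)
apply: ae_ge0_le_integral => //.
- by move=> y _; rewrite -EFinM lee_fin !mulr_ge0.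
- by apply: emeasurable_funM => //; exact: measurable_cst.
- by move=> y _; exact: (K0 (x, y)).
- exact: (measurableT_comp mK (pair1_measurable x)).
exists [set x]; split; [exact: measurable_rV_set1|exact: lebesgue_rV_set1|].
move=> y /= yP; apply: contrapT => /eqP yx; apply: yP => _.
have d0 : 0 < enorm (x - y).
  rewrite lt_neqAle enorm_ge0 andbT eq_sym; apply/eqP => /enorm_eq0/eqP.
  by rewrite subr_eq0 eq_sym; exact/negP.
rewrite -EFinM lee_fin [h x * h y]mulrC -mulrA.
have [->|hx] := eqVneq (h x) 0; first by rewrite !(mul0r, mulr0).
have [->|hy] := eqVneq (h y) 0; first by rewrite !mul0r.
rewrite ler_wpM2l//.
rewrite ler_wpM2l// /c powRN lef_pV2 ?posrE ?powR_gt0//; last first.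
  by rewrite mulr_gt0 ?ltr0n// mulr_gt0.
rewrite ge0_ler_powR ?nnegrE ?enorm_ge0 ?mulr_ge0 ?(ltW r0)//.
apply: enorm_le_coord => [|i]; first by rewrite mulr_ge0 ?ltW.
rewrite !mxE (le_trans (ler_normB _ _))// mulr2n mulrDl mul1r.
by rewrite lerD// (le_trans (le_coord_enorm _ _)) ?hr.
Qed.

End energy_bounds.

Section lower_bounds.
Context {R : realType}.
Notation mu := (@lebesgue_measure R).
Local Notation leb := (lebesgue_rV R).

Lemma le_integral2_riesz n (h1 h2 : 'rV[R]_n.+1 * 'rV[R]_n.+1 -> R) N :
  (forall z, 0 <= h1 z) -> (forall z, h1 z <= h2 z) ->
  measurable_fun setT h1 -> measurable_fun setT h2 ->
  (\int[leb n.+1]_x \int[leb n.+1]_y (h1 (x, y) / enorm (x - y) `^ N)%:E <=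
   \int[leb n.+1]_x \int[leb n.+1]_y (h2 (x, y) / enorm (x - y) `^ N)%:E)%E.
Proof.
move=> h0 h12 mh1 mh2.
have K1 z : (0 <= (h1 z / enorm (z.1 - z.2) `^ N)%:E)%E.
  by rewrite lee_fin divr_ge0 ?powR_ge0.
have K2 z : (0 <= (h2 z / enorm (z.1 - z.2) `^ N)%:E)%E.
  by rewrite lee_fin divr_ge0 ?powR_ge0// (le_trans (h0 z)).
have mK1 := measurable_riesz N mh1; have mK2 := measurable_riesz N mh2.
apply: ge0_le_integral => //.
- by move=> x _; apply: integral_ge0 => y _; exact: (K1 (x, y)).
- exact: (@measurable_integral_in _ _ _ _ _ (leb n.+1) _ mK1).
- exact: (@measurable_integral_in _ _ _ _ _ (leb n.+1) _ mK2).
move=> x _; apply: ge0_le_integral => //.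
- exact: (measurableT_comp mK1 (pair1_measurable x)).
- exact: (measurableT_comp mK2 (pair1_measurable x)).
by move=> y _; rewrite lee_fin ler_wpM2r ?h12// invr_ge0 powR_ge0.
Qed.

(** Up to constants, the integral J of |f|^q over the ball of radius 2 r satisfies J^2 r^(-(d -
    alpha)) <= e, and J is at least r^(d - 1) times the integral over [r, 2 r]. The resulting power
    r^(1 - (d + alpha) / 2) is the one on the right-hand side. *)
Lemma annulus_powR_le_coulomb n (alpha q : R) : 0 < q -> alpha < n.+1%:R ->
  exists2 C, 0 < C & forall (f : R -> R) (e : R), continuous f -> 0 < e ->
  (coulomb_energy alpha q (fun x : 'rV[R]_n.+1 => f (enorm x)) <= e%:E)%E ->
  forall r, 0 < r -> (\int[mu]_(y in `[r, (r * 2)%R]) (`|f y| `^ q)%:E <=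
    (((C * e) `^ (2 * q)^-1 * r `^ (- ((n.+1%:R + alpha) / (2 * q)))) `^ q * r)%:E)%E.
Proof.
move=> q0 an; set d : R := n.+1%:R.
have d0 : 0 < d by rewrite ltr0n.
have d4 : 0 < d * 4 by rewrite mulr_gt0.
have N0 : 0 < d - alpha by rewrite subr_gt0.
exists ((d * 4) `^ (d - alpha) * d `^ (2 * n%:R)).
  by rewrite mulr_gt0// powR_gt0.
move=> f e cf e0 hE r r0.
have mf : measurable_fun setT f by exact: continuous_measurable_fun.
pose F t : R := `|f t| `^ q * \1_(`]-oo, (r * 2)]%classic : set R) t.
have mF : measurable_fun setT (EFin \o F).
  apply/measurable_EFinP; apply: measurable_funM.
    by apply/measurable_EFinP; exact: measurable_powR_norm.
  exact: measurable_indic.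
have F0 t : 0 <= F t by rewrite mulr_ge0 ?powR_ge0.
pose h (x : 'rV[R]_n.+1) := F (enorm x).
have mh : measurable_fun setT h.
  apply: (measurableT_comp _ (@measurable_enorm R n.+1)).
  exact/measurable_EFinP.
have h0 x : 0 <= h x by exact: F0.
have hr x : h x != 0 -> enorm x <= r * 2.
  rewrite /h /F mulf_eq0 negb_or => /andP[_].
  by rewrite indicE pnatr_eq0 eqb0 negbK inE/= in_itv.
have r20 : 0 < r * 2 by rewrite mulr_gt0.
have H1 := integral_square_le_riesz mh h0 (ltW N0) r20 hr.
set c := _ `^ (- (d - alpha)) in H1.
have c0 : 0 < c by rewrite powR_gt0// !mulr_gt0.
set J := (\int[leb n.+1]_x (h x)%:E)%E in H1.
have J0 : (0 <= J)%E by apply: integral_ge0 => x _; rewrite lee_fin.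
have {}H1 : (J * J <= (e / c)%:E)%E.
  rewrite EFinM lee_pdivlMr//; apply: (le_trans H1); apply: le_trans hE.
  pose a (x : 'rV[R]_n.+1) := `|f (enorm x)| `^ q.
  have ma : measurable_fun setT a.
    apply: (measurableT_comp _ (@measurable_enorm R n.+1) (f := fun t => `|f t| `^ q)).
    by apply/measurable_EFinP; exact: measurable_powR_norm.
  apply: (@le_integral2_riesz n (fun z => h z.1 * h z.2) (fun z => a z.1 * a z.2)).
  - by move=> z; rewrite mulr_ge0.
  - move=> z; rewrite ler_pM// /h/F/a ler_piMr ?powR_ge0// indicE lern1 leq_b1//.
  - apply: measurable_funM.
      exact: (measurableT_comp mh measurable_fst).
    exact: (measurableT_comp mh measurable_snd).
  - apply: measurable_funM.
      exact: (measurableT_comp ma measurable_fst).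
    exact: (measurableT_comp ma measurable_snd).
have {H1} JE := lee_sqr_sqrt J0 H1.
have := annulus_le_integral n (r * 2) mF (fun t => F0 t) r0.
have -> : (\int[mu]_(t in `[r, (r * 2)%R]) (EFin \o F) t = \int[mu]_(t in `[r, (r * 2)%R]) (`|f t| `^ q)%:E)%E.
  apply: eq_integral => t; rewrite inE/= in_itv/= => /andP[_ t2].
  by rewrite /F indicE mem_set/= ?mulr1// in_itv.
move=> /le_trans/(_ JE).
have rd0 : 0 < (r / d) ^+ n by rewrite exprn_gt0// divr_gt0.
rewrite -lee_pdivlMl// => /le_trans; apply; rewrite -EFinM lee_fin le_eqVlt; apply/orP; left; apply/eqP.
rewrite -powR12_sqrt ?divr_ge0 ?(ltW e0) ?(ltW c0)// -powR_mulrn ?divr_ge0 ?(ltW r0) ?(ltW d0)//.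
have -> : c = (d * 4 * r) `^ (- (d - alpha)) by congr (_ `^ _); rewrite -/d; ring.
have nE : n%:R = d - 1 :> R by rewrite /d -natr1 addrK.
rewrite -/d nE; clearbody d; clear - d0 d4 r0 e0 q0; apply: ln_eq.
- posr.
- posr.
by ln_expand; field; rewrite gt_eqF.
Qed.

(* Below the cut-off the last term dominates, so the whole sum is controlled by the cut-off. *)
Lemma geometric_cut_sum_le (a b s : R) m : 0 <= a -> 0 <= b -> 1 < s ->
  \sum_(j < m) (a * s ^+ j) * ((a * s ^+ j <= b)%R)%:R <= b / (1 - s^-1).
Proof.
move=> a0 b0 s1.
have s0 : 0 < s by exact: lt_trans s1.
have d0 : 0 < 1 - s^-1 by rewrite subr_gt0 invf_lt1.
have full k : \sum_(j < k.+1) a * s ^+ j <= a * s ^+ k / (1 - s^-1).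
  elim: k => [|k IH].
    rewrite big_ord1 ler_pdivlMr// ler_piMr ?mulr_ge0 ?exprn_ge0 ?(ltW s0)//.
    by rewrite gerBl invr_ge0 ltW.
  rewrite big_ord_recr/= (le_trans (lerD IH (lexx _)))//.
  rewrite exprS -subr_ge0 le_eqVlt; apply/orP; left; apply/eqP.
  by field; rewrite !gt_eqF//= ?subr_gt0.
elim: m => [|m IH]; first by rewrite big_ord0 divr_ge0// ltW.
rewrite big_ord_recr/=; have [h|h] := leP (a * s ^+ m) b; last first.
  by rewrite mulr0 addr0.
rewrite mulr1 (@le_trans _ _ (\sum_(j < m.+1) a * s ^+ j))//.
  rewrite big_ord_recr/= lerD2r; apply: ler_sum => j _.
  by rewrite ler_piMr ?mulr_ge0 ?exprn_ge0 ?(ltW s0)// lern1 leq_b1.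
by rewrite (le_trans (full m))// ler_wpM2r// invr_ge0 ltW.
Qed.

(** The transverse coordinates are close by the width of the second tube. The first coordinates
    follow from the norms: their squares differ by at most a multiple of del r, and their sum is at
    least r / 2 because both are positive and x lies near the axis with norm at least r. *)
Lemma tube_dist_le n (x y : 'rV[R]_n.+1) (r del : R) : 0 < r -> 0 < del -> del <= r * 4 ->
  tube (0 : 'rV[R]_n) (r / (4 * n.+1%:R)) x -> r <= enorm x <= r * 4 ->
  tube (\row_i x ord0 (lift ord0 i)) (del / (16 * n.+1%:R)) y ->
  `|enorm x - enorm y| < del -> enorm (x - y) <= n.+1%:R * (32 * del).
Proof.
move=> r0 del0 delr [x0 xe] /andP[rx xr] [y0 ye] xy.
set k : R := n.+1%:R in xe ye *.
have k0 : 0 < k by rewrite ltr0n.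
have k1 : 1 <= k by rewrite ler1n.
have del16 : del / (16 * k) <= del / 16.
  rewrite ler_pM2l// lef_pV2 ?posrE ?mulr_gt0// ler_peMr//.
have xe' i : `|x ord0 (lift ord0 i)| <= r / (4 * k).
  by have := xe i; rewrite mxE subr0 => /ltW.
have ye' i : `|y ord0 (lift ord0 i) - x ord0 (lift ord0 i)| <= del / (16 * k).
  by have := ye i; rewrite mxE => /ltW.
apply: enorm_le_coord; first by rewrite mulr_ge0// ltW.
have xs : enorm x ^+ 2 = x ord0 ord0 ^+ 2 + \sum_(i < n) x ord0 (lift ord0 i) ^+ 2.
  by rewrite enorm_sqr big_ord_recl.
have ys : enorm y ^+ 2 = y ord0 ord0 ^+ 2 + \sum_(i < n) y ord0 (lift ord0 i) ^+ 2.
  by rewrite enorm_sqr big_ord_recl.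
have nk : n%:R <= k by rewrite ler_nat.
have S1 : \sum_(i < n) x ord0 (lift ord0 i) ^+ 2 <= r ^+ 2 / 16.
  apply: (@le_trans _ _ (\sum_(i < n) (r / (4 * k)) ^+ 2)).
    apply: ler_sum => i _; rewrite -[X in X <= _]real_normK ?num_real// lerXn2r ?nnegrE//.
    by rewrite divr_ge0 ?mulr_ge0 ?ltW.
  rewrite sumr_const card_ord -[leLHS]mulr_natl.
  apply: (@le_trans _ _ (k * (r / (4 * k)) ^+ 2)); first by rewrite ler_wpM2r ?sqr_ge0.
  have -> : k * (r / (4 * k)) ^+ 2 = r ^+ 2 / 16 * k^-1 by field; rewrite gt_eqF.
  by rewrite ler_piMr ?divr_ge0 ?sqr_ge0// invf_le1.
have S2 : `|\sum_(i < n) y ord0 (lift ord0 i) ^+ 2 - \sum_(i < n) x ord0 (lift ord0 i) ^+ 2| <= del * r.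
  rewrite -sumrB (le_trans (ler_norm_sum _ _ _))//.
  apply: (@le_trans _ _ (\sum_(i < n) del / (16 * k) * r)); last first.
    rewrite sumr_const card_ord -[leLHS]mulr_natl mulrA ler_wpM2r ?(ltW r0)//.
    rewrite mulrCA ler_piMr ?(ltW del0)// ler_pdivrMr ?mulr_gt0// mul1r.
    by rewrite (le_trans nk)// ler_peMl ?(ltW k0)// ler1n.
  apply: ler_sum => i _; rewrite subr_sqr normrM ler_pM//.
  have -> : y ord0 (lift ord0 i) + x ord0 (lift ord0 i) =
    (y ord0 (lift ord0 i) - x ord0 (lift ord0 i)) + (x ord0 (lift ord0 i) *+ 2) by ring.
  rewrite (le_trans (ler_normD _ _))// normrMn.
  apply: (@le_trans _ _ (r / 4 + (r / 4) *+ 2)); last by lra.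
  apply: lerD; first by rewrite (le_trans (ye' i))// (le_trans del16)//; lra.
  rewrite lerMn2r/= (le_trans (xe' i))// ler_pM2l// lef_pV2 ?posrE ?mulr_gt0//.
  by rewrite ler_peMr.
have x2 : r / 2 <= x ord0 ord0.
  rewrite -(@ler_pXn2r _ 2) ?nnegrE ?(ltW x0) ?divr_ge0 ?(ltW r0)//.
  have : r ^+ 2 <= enorm x ^+ 2 by rewrite lerXn2r ?nnegrE ?enorm_ge0 ?(ltW r0).
  have -> : (r / 2) ^+ 2 = r ^+ 2 / 4 by field.
  by rewrite xs; have := sqr_ge0 r; lra.
have yr : enorm y <= r * 8.
  have := ler_norm (enorm y - enorm x); rewrite distrC; lra.
have S3 : `|enorm y ^+ 2 - enorm x ^+ 2| <= del * (r * 12).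
  rewrite subr_sqr normrM distrC; apply: ler_pM => //; first exact: ltW.
  by rewrite ger0_norm ?addr_ge0 ?enorm_ge0//; lra.
have S4 : `|y ord0 ord0 - x ord0 ord0| * (r / 2) <= del * (r * 13).
  apply: (@le_trans _ _ `|y ord0 ord0 ^+ 2 - x ord0 ord0 ^+ 2|).
    rewrite subr_sqr normrM ler_wpM2l//.
    by rewrite (le_trans _ (ler_norm _))//; lra.
  move: S2 S3; rewrite xs ys.
  set a := \sum_(i < n) _; set b := \sum_(i < n) _ => S2 S3.
  have -> : y ord0 ord0 ^+ 2 - x ord0 ord0 ^+ 2 =
    (y ord0 ord0 ^+ 2 + a - (x ord0 ord0 ^+ 2 + b)) - (a - b) by ring.
  by rewrite (le_trans (ler_normB _ _))// (le_trans (lerD S3 S2))//; lra.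
move=> i; rewrite !mxE distrC; case: (unliftP ord0 i) => [j|] ->.
  by rewrite (le_trans (ye' j))// (le_trans del16)//; lra.
have : `|y ord0 ord0 - x ord0 ord0| <= del * 26.
  by rewrite -(@ler_pM2r _ (r / 2)) ?divr_gt0// (le_trans S4)//; lra.
by move=> /le_trans; apply; lra.
Qed.

End lower_bounds.

(** * The fractional seminorm bounds the dyadic energy of the profile *)

Section gagliardo.
Context {R : realType}.
Notation mu := (@lebesgue_measure R).
Local Notation leb := (lebesgue_rV R).

Lemma powR_annulus_energy n (p s sg B r : R) : 0 < p -> 0 < B -> 0 < r ->
  (B `^ p^-1 * r `^ (- ((n.+1%:R - s * p) / p))) `^ p * r `^ (1 - sg * p) =
  B * r `^ ((s - sg) * p - n%:R).
Proof.
move=> p0 B0 r0; rewrite -natr1.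
apply: ln_eq; [posr|posr|ln_expand].
by field; rewrite gt_eqF.
Qed.

(** Only scales at least rho / kap contribute. Their weights increase geometrically as the scale
    shrinks, so the sum is comparable to the weight (rho / kap)^(-N) at the cut. *)
Lemma dyadic_weight_sum_le (N kap r rho : R) m : 0 < N -> 0 < kap -> 0 < r -> 0 < rho ->
  \sum_(j < m) (r / 2 ^+ j) `^ (- N) * ((rho <= kap * (r / 2 ^+ j))%R)%:R <=
  kap `^ N / (1 - (2 `^ N)^-1) / rho `^ N.
Proof.
move=> N0 kap0 r0 rho0.
have s1 : 1 < 2 `^ N :> R.
  by rewrite powR_expR// -[ltLHS]expR0 ltr_expR mulr_gt0// ln2_gt0.
have P0 (j : nat) : 0 < 2 ^+ j :> R by rewrite exprn_gt0.
have E (j : nat) : (r / 2 ^+ j) `^ (- N) = r `^ (- N) * (2 `^ N) ^+ j.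
  rewrite -powR_natX; have := P0 j; set P := 2 ^+ j => Pp.
  by clearbody P; apply: ln_eq; [posr|posr|ln_expand]; ring.
have -> : kap `^ N / (1 - (2 `^ N)^-1) / rho `^ N = (kap / rho) `^ N / (1 - (2 `^ N)^-1).
  rewrite mulrAC; congr (_ / _); apply: ln_eq; [posr|posr|ln_expand]; ring.
apply: (le_trans _ (geometric_cut_sum_le m (powR_ge0 r (- N)) (powR_ge0 _ N) s1)).
apply: ler_sum => j _; rewrite -E ler_wpM2l ?powR_ge0// ler_nat.
case: (boolP (rho <= _)) => // h.
have d0 : 0 < r / 2 ^+ j by rewrite divr_gt0.
rewrite lt0b powRN -[leLHS]div1r ler_pdivrMr ?powR_gt0// -powRM ?divr_ge0 ?(ltW kap0) ?(ltW rho0) ?(ltW d0) ?(ltW r0) ?(ltW (P0 j))//.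
by rewrite -[leLHS](powRr0 (kap / rho * (r / 2 ^+ j))) ler_powR ?(ltW N0)// mulrAC ler_pdivlMr// mul1r.
Qed.

Section frac.
Variables (n : nat) (p s : R).
Hypotheses (p1 : 1 <= p) (s0 : 0 < s).
Let k : R := n.+1%:R.
Let N : R := k + s * p.
Let kap : R := k * 32.
Variable f : R -> R.
Hypothesis cf : continuous f.

Definition sphere_diff (z : 'rV[R]_n.+1 * 'rV[R]_n.+1) : R :=
  `|f (enorm z.1) - f (enorm z.2)| `^ p.

Let mf : measurable_fun setT f. Proof. exact: continuous_measurable_fun. Qed.

Lemma measurable_sphere_diff : measurable_fun setT sphere_diff.
Proof.
have mfe : measurable_fun setT (fun x : 'rV[R]_n.+1 => f (enorm x)).
  exact: (measurableT_comp mf (@measurable_enorm R n.+1)).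
apply: (measurableT_comp (measurable_powR p)).
apply: (measurableT_comp (@normr_measurable R setT)); apply: measurable_funB.
- exact: (measurableT_comp mfe measurable_fst).
- exact: (measurableT_comp mfe measurable_snd).
Qed.

Let G (c : R) (z : 'rV[R]_n.+1 * 'rV[R]_n.+1) : \bar R :=
  (sphere_diff z * \1_[set z | enorm (z.1 - z.2) <= c] z)%:E.

Let G0 c z : (0 <= G c z)%E.
Proof. by rewrite lee_fin mulr_ge0 ?powR_ge0. Qed.

Let mG c : measurable_fun setT (G c).
Proof.
apply/measurable_EFinP; apply: measurable_funM; first exact: measurable_sphere_diff.
apply: measurable_indic; rewrite -[X in measurable X]setTI.
rewrite (_ : [set z | _] = (fun z => enorm (z.1 - z.2)) @^-1` `]-oo, c]).
  by apply: measurable_enormB => //; exact: measurable_itv.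
by apply/seteqP; split => z /=; rewrite in_itv.
Qed.

Let K (z : 'rV[R]_n.+1 * 'rV[R]_n.+1) : \bar R :=
  (sphere_diff z / enorm (z.1 - z.2) `^ N)%:E.

Let K0 z : (0 <= K z)%E.
Proof. by rewrite lee_fin divr_ge0 ?powR_ge0. Qed.

Let mK : measurable_fun setT K.
Proof. exact: measurable_riesz measurable_sphere_diff. Qed.

Let C1 : R := kap `^ N / (1 - (2 `^ N)^-1).

Let N0 : 0 < N. Proof. by rewrite addr_gt0 ?ltr0n// mulr_gt0// (lt_le_trans ltr01). Qed.
Let k0 : 0 < k. Proof. by rewrite ltr0n. Qed.
Let kap0 : 0 < kap. Proof. by rewrite mulr_gt0. Qed.
Let C10 : 0 <= C1.
Proof.
rewrite divr_ge0 ?powR_ge0// subr_ge0 invf_le1 ?powR_gt0//.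
by rewrite -[leLHS](powRr0 2) ler_powR ?ler1n// ltW.
Qed.

Lemma sum_near_kernel_le r m z : 0 < r ->
  (\sum_(j < m) ((r / 2 ^+ j) `^ (- N))%:E * G (kap * (r / 2 ^+ j)) z <= C1%:E * K z)%E.
Proof.
move=> r0; under eq_bigr do rewrite -EFinM.
rewrite sumEFin -EFinM lee_fin.
have [z0|z0] := eqVneq (enorm (z.1 - z.2)) 0.
  have T0 : sphere_diff z = 0.
    move/enorm_eq0 : z0 => /eqP; rewrite subr_eq0 => /eqP E.
    by rewrite /sphere_diff E subrr normr0 powR0// gt_eqF// (lt_le_trans ltr01).
  by rewrite T0 mul0r mulr0 big1// => j _; rewrite mul0r mulr0.
have rho0 : 0 < enorm (z.1 - z.2) by rewrite lt_neqAle eq_sym z0 enorm_ge0.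
under eq_bigr do rewrite mulrCA.
rewrite -mulr_sumr mulrCA ler_wpM2l ?powR_ge0//.
apply: le_trans (dyadic_weight_sum_le m N0 kap0 r0 rho0).
apply: ler_sum => j _; rewrite ler_wpM2l ?powR_ge0// indicE ler_nat.
by case: (boolP (z \in _)) => // /set_mem /= ->.
Qed.

(** For fixed x, the integral in t = |y| is spread over a tube around the line through x parallel to
    the axis, of width comparable to [del]. There, norms closer than [del] already force |x - y| <=
    kap [del] by [tube_dist_le]. *)
Lemma near_dist_le_kernel r del x : 0 < r -> 0 < del -> del <= r * 4 ->
  tube (0 : 'rV[R]_n) (r / (4 * k)) x -> r <= enorm x <= r * 4 ->
  (((del / (8 * k)) ^+ n)%:E * \int[mu]_(t in `[r, (r * 4)%R]) near_dist f p del (enorm x, t) <=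
   \int[leb n.+1]_y G (kap * del) (x, y))%E.
Proof.
move=> r0 d0 dr tx xr.
pose v : 'rV[R]_n := \row_i x ord0 (lift ord0 i).
have mx : measurable_fun setT (fun t : measurableTypeR R => near_dist f p del (enorm x, t)).
  by apply: (measurableT_comp (measurable_near_dist p del mf)).
have c0 : 0 < del / (16 * k) by rewrite divr_gt0// mulr_gt0.
have r20 : 0 <= r / 2 by rewrite divr_ge0// ltW.
have r2 : r / 2 < r by rewrite ltr_pdivrMr// ltr_pMr// ltr1n.
have k1 : 1 <= k by rewrite ler1n.
have hv (u : 'rV[R]_n) : (forall i, `|u ord0 i - v ord0 i| < del / (16 * k)) -> enorm u <= r / 2.
  move=> uv; have rk : 0 <= r / (2 * k) by rewrite divr_ge0 ?mulr_ge0 ?ltW.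
  apply: (le_trans (enorm_le_coord rk _)) => [i|].
    have h1 := uv i; rewrite mxE in h1.
    have h2 := tx.2 i; rewrite mxE subr0 in h2.
    have -> : u ord0 i = (u ord0 i - x ord0 (lift ord0 i)) + x ord0 (lift ord0 i) by rewrite subrK.
    rewrite (le_trans (ler_normD _ _))// (le_trans (lerD (ltW h1) (ltW h2)))//.
    have -> : r / (2 * k) = (r * 4) / (16 * k) + r / (4 * k) by field; rewrite gt_eqF.
    by rewrite lerD2r ler_wpM2r// invr_ge0 mulr_ge0// ltW.
  apply: (@le_trans _ _ (k * (r / (2 * k)))); first by rewrite ler_wpM2r// ler_nat.
  by rewrite le_eqVlt; apply/orP; left; apply/eqP; field; rewrite gt_eqF.
have := tube_annulus_le (r * 4) mx (fun t => near_dist_ge0 f p del (enorm x, t)) c0 r20 r2 hv.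
have -> : 2 * (del / (16 * k)) = del / (8 * k) by field; rewrite gt_eqF.
move=> /le_trans; apply.
have mGx : measurable_fun setT (fun y => G (kap * del) (x, y)).
  exact: (measurableT_comp (mG _) (pair1_measurable x)).
apply: le_trans (integral_tube_le v (del / (16 * k)) mGx (fun y => G0 _ _)).
apply: ge0_le_integral => //.
- exact: measurable_tube.
- by move=> y _; exact: near_dist_ge0.
- apply: measurable_funTS; apply: (measurableT_comp mx); exact: measurable_enorm.
- exact: measurable_funTS.
move=> y ty; rewrite lee_fin ler_wpM2l ?powR_ge0// !indicE ler_nat.
case: (boolP (_ \in near_diag _)) => // /set_mem/= xy.
rewrite mem_set//= /kap -mulrA.
exact: (tube_dist_le r0 d0 dr tx xr ty xy).
Qed.

(** Two tubes are used. The one in y, of width comparable to the scale, produces its n-th power and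
    turns the kernel exponent n + 1 + s p into 1 + s p; the one in x, of width comparable to r, is
    responsible for the division by r^n. *)
Lemma sum_near_energy_le r m A : 0 < r ->
  (\int[leb n.+1]_x \int[leb n.+1]_y K (x, y) <= A%:E)%E ->
  (\sum_(j < m) ((r * 4 / 2 ^+ j) `^ (- (1 + s * p)))%:E *
     near_energy f p r (r * 4) (r * 4 / 2 ^+ j) <=
   ((8 * k) ^+ n * C1 * (2 * k) ^+ n * A / r ^+ n)%:E)%E.
Proof.
move=> r0 hA; pose del j : R := r * 4 / 2 ^+ j.
have d0 j : 0 < del j by rewrite divr_gt0 ?mulr_gt0// exprn_gt0.
have dr j : del j <= r * 4.
  by rewrite ler_pdivrMr ?exprn_gt0// ler_peMr ?mulr_ge0 ?(ltW r0)// exprn_ege1// ler1n.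
pose w j := (del j) `^ (- (1 + s * p)).
pose I j t : \bar R := (\int[mu]_(y in `[r, (r * 4)%R]) near_dist f p (del j) (t, y))%E.
have mI j : measurable_fun setT (I j) by exact: measurable_near_dist_inner.
have I0 j t : (0 <= I j t)%E by apply: integral_ge0 => y _; exact: near_dist_ge0.
pose H t : \bar R := (\sum_(j < m) (w j)%:E * I j t)%E.
have wI0 j t : (0 <= (w j)%:E * I j t)%E by rewrite mule_ge0// lee_fin powR_ge0.
have mwI j : measurable_fun setT (fun t => (w j)%:E * I j t)%E by exact: measurable_funeM.
have H0 t : (0 <= H t)%E by apply: sume_ge0 => j _.
have mH : measurable_fun setT H by exact: emeasurable_sum.
pose L x : \bar R := (\int[leb n.+1]_y K (x, y))%E.
have L0 x : (0 <= L x)%E by exact: integral_ge0.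
have mL : measurable_fun setT L.
  exact: (@measurable_integral_in _ _ _ _ _ (leb n.+1) K mK).
have B0 : 0 <= (8 * k) ^+ n * C1 by rewrite mulr_ge0// exprn_ge0// mulr_ge0// ltW.
have HL x : tube (0 : 'rV[R]_n) (r / (4 * k)) x -> r <= enorm x <= r * 4 ->
    (H (enorm x) <= ((8 * k) ^+ n * C1)%:E * L x)%E.
  move=> tx xr.
  apply: (@le_trans _ _ (((8 * k) ^+ n)%:E * \int[leb n.+1]_y (\sum_(j < m) ((del j) `^ (- N))%:E * G (kap * del j) (x, y)))%E).
    have mGx j : measurable_fun setT (fun y => G (kap * del j) (x, y)).
      exact: (measurableT_comp (mG _) (pair1_measurable x)).
    rewrite ge0_integral_sum//; last 2 first.
    - by move=> j; exact: measurable_funeM.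
    - by move=> j y _; rewrite mule_ge0// lee_fin powR_ge0.
    rewrite ge0_sume_distrr; last first.
      by move=> j _; apply: integral_ge0 => y _; rewrite mule_ge0// lee_fin powR_ge0.
    apply: lee_sum => j _.
    rewrite ge0_integralZl//; last by rewrite lee_fin powR_ge0.
    have h := near_dist_le_kernel r0 (d0 j) (dr j) tx xr.
    have -> : w j = (8 * k) ^+ n * (del j) `^ (- N) * (del j / (8 * k)) ^+ n.
      have k8 : 0 < 8 * k by rewrite mulr_gt0.
      rewrite expr_div_n mulrAC mulrCA divff ?gt_eqF ?exprn_gt0// mulr1 mulrC.
      rewrite -powR_mulrn ?(ltW (d0 j))// -powRD; last by apply/implyP => _; rewrite gt_eqF.
      by rewrite /w; congr (_ `^ _); rewrite /N /k -natr1; ring.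
    rewrite !EFinM -!muleA; apply: lee_wpmul2l; first by rewrite lee_fin exprn_ge0// mulr_ge0// ltW.
    by apply: lee_wpmul2l => //; rewrite lee_fin powR_ge0.
  rewrite EFinM -muleA; apply: lee_wpmul2l; first by rewrite lee_fin exprn_ge0// mulr_ge0// ltW.
  have mKx : measurable_fun setT (fun y => K (x, y)).
    exact: (measurableT_comp mK (pair1_measurable x)).
  rewrite /L -(@ge0_integralZl _ _ _ (leb n.+1) setT measurableT (fun y => K (x, y)))//.
  apply: ge0_le_integral => //.
  - by move=> y _; apply: sume_ge0 => j _; rewrite mule_ge0// lee_fin powR_ge0.
  - apply: emeasurable_sum => j; apply: measurable_funeM.
    exact: (measurableT_comp (mG _) (pair1_measurable x)).
  - exact: measurable_funeM.
  move=> y _; apply: sum_near_kernel_le; exact: mulr_gt0.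
pose H' t : \bar R := (H t * (\1_(`[r, (r * 4)%R]%classic : set R) t)%:E)%E.
have mH' : measurable_fun setT H'.
  apply: emeasurable_funM => //; apply/measurable_EFinP; exact: measurable_indic.
have H'0 t : (0 <= H' t)%E by rewrite mule_ge0// lee_fin.
have rk : 0 < r / (4 * k) by rewrite divr_gt0// mulr_gt0.
have r20 : 0 <= r / 2 by rewrite divr_ge0// ltW.
have r2 : r / 2 < r by rewrite ltr_pdivrMr// ltr_pMr// ltr1n.
have hv (u : 'rV[R]_n) : (forall i, `|u ord0 i - (0 : 'rV[R]_n) ord0 i| < r / (4 * k)) -> enorm u <= r / 2.
  move=> uv; apply: (le_trans (enorm_le_coord (ltW rk) _)) => [i|].
    by have := uv i; rewrite mxE subr0 => /ltW.
  apply: (@le_trans _ _ (k * (r / (4 * k)))).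
    by rewrite ler_wpM2r ?(ltW rk)// ler_nat.
  have -> : k * (r / (4 * k)) = r / 4 by field; rewrite gt_eqF.
  by rewrite ler_pM2l// lef_pV2 ?posrE// ler_nat.
have := tube_annulus_le (r * 4) mH' H'0 rk r20 r2 hv.
have -> : 2 * (r / (4 * k)) = r / (2 * k) by field; rewrite gt_eqF.
have -> : (\int[mu]_(t in `[r, (r * 4)%R]) H' t =
    \sum_(j < m) (w j)%:E * near_energy f p r (r * 4) (del j))%E.
  transitivity (\int[mu]_(t in `[r, (r * 4)%R]) H t)%E.
    by apply: eq_integral => t rt; rewrite /H' indicE rt mule1.
  rewrite ge0_integral_sum//; last by move=> j; exact: measurable_funTS.
  apply: eq_bigr => j _; rewrite ge0_integralZl//; last 2 first.
  - exact: measurable_funTS.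
  - by rewrite lee_fin powR_ge0.
move=> h.
have {}h := le_trans h (_ : _ <= ((8 * k) ^+ n * C1 * A)%:E)%E.
have rkn : 0 < (r / (2 * k)) ^+ n by rewrite exprn_gt0// divr_gt0// mulr_gt0.
rewrite -/(w _) -lee_pdivlMl// in h.
rewrite (_ : _ / r ^+ n = ((r / (2 * k)) ^+ n)^-1 * ((8 * k) ^+ n * C1 * A)); last first.
  rewrite expr_div_n invf_div; ring.
rewrite EFinM; apply: h.
apply: (@le_trans _ _ (\int[leb n.+1]_(y in tube 0 (r / (4 * k))) (((8 * k) ^+ n * C1)%:E * L y))%E).
  apply: ge0_le_integral => //.
  - exact: measurable_tube.
  - apply: measurable_funTS; apply: (measurableT_comp mH'); exact: measurable_enorm.
  - by apply: measurable_funTS; exact: measurable_funeM.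
  move=> x tx; rewrite /H' indicE; case: (boolP (_ \in _)) => [/set_mem/=|_].
    by rewrite in_itv/= mule1; exact: HL.
  by rewrite mule0 mule_ge0.
apply: (le_trans (integral_tube_le _ _ _ _)).
- exact: measurable_funeM.
- by move=> x; rewrite mule_ge0.
rewrite (@ge0_integralZl _ _ _ (leb n.+1) setT measurableT L)// [leRHS]EFinM.
by apply: lee_wpmul2l; rewrite ?lee_fin.
Qed.

End frac.
End gagliardo.

(** * The gradient bounds the dyadic energy of the profile *)

Section sobolev.
Context {R : realType}.
Notation mu := (@lebesgue_measure R).
Local Notation leb := (lebesgue_rV R).
Variables (f df : R -> R) (p : R).
Hypotheses (p1 : 1 <= p) (cdf : continuous df).
Hypothesis fdf : forall t : R, is_derive t 1 f (df t).

Let mdf : measurable_fun setT df. Proof. exact: continuous_measurable_fun. Qed.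
Let p0 : 0 < p. Proof. exact: lt_le_trans p1. Qed.

Let cf : continuous f.
Proof.
move=> t; apply: differentiable_continuous; apply/derivable1_diffP.
by have [] := fdf t.
Qed.

Lemma increment_powR_le x y del v : x < y -> y - x <= del -> 0 < v ->
  (\int[mu]_(z in `[x, y]) (`|df z| `^ p)%:E <= v%:E)%E ->
  `|f y - f x| `^ p <= 2 `^ p * del `^ (p - 1) * v.
Proof.
move=> xy yd v0 hv.
have d0 : 0 < del by rewrite (lt_le_trans _ yd)// subr_gt0.
have ftc : (\int[mu]_(z in `[x, y]) (df z)%:E = (f y)%:E - (f x)%:E)%E.
  apply: (@continuous_FTC2 R df f x y) => //.
  - by apply: continuous_subspaceT => z; exact: cdf.
  - split.
    + by move=> z _; have [] := fdf z.
    + by apply: cvg_at_right_filter; exact: cf.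
    + by apply: cvg_at_left_filter; exact: cf.
  - by move=> z _; rewrite derive1E; have [_ ->] := fdf z.
have h : `|f y - f x| <= 2 * del * (v / del) `^ p^-1.
  rewrite -lee_fin.
  have -> : (`|f y - f x|%:E = `|\int[mu]_(z in `[x, y]) (df z)%:E|)%E by rewrite ftc.
  apply: (@le_trans _ _ (\int[mu]_(z in `[x, y]) (`|df z|)%:E)%E).
    apply: (le_abse_integral mu) => //.
    by apply/measurable_EFinP; exact: measurable_funTS.
  apply: integral_le_powR => //.
  - by apply: (measurableT_comp _ mdf); exact: normr_measurable.
  - by rewrite lebesgue_measure_cc// lee_fin.
have q0 : 0 < v / del by rewrite divr_gt0.
apply: (@le_trans _ _ ((2 * del * (v / del) `^ p^-1) `^ p)).
  by rewrite ge0_ler_powR ?nnegrE ?(ltW p0)// ?mulr_ge0 ?powR_ge0 ?(ltW d0).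
rewrite le_eqVlt; apply/orP; left; apply/eqP.
apply: ln_eq; [posr|posr|ln_expand].
by field; rewrite gt_eqF.
Qed.

Let kern del (z : measurableTypeR R * measurableTypeR R) : \bar R :=
  (`|df z.2| `^ p * \1_(near_diag del) z)%:E.

Let kern0 del z : (0 <= kern del z)%E.
Proof. by rewrite lee_fin mulr_ge0 ?powR_ge0. Qed.

Let mkern del : measurable_fun setT (kern del).
Proof.
apply/measurable_EFinP; apply: measurable_funM; last first.
  by apply: measurable_indic; exact: measurable_near_diag.
apply: (measurableT_comp (measurable_powR p)).
apply: (measurableT_comp (@normr_measurable R setT)).
by apply: (measurableT_comp mdf); exact: measurable_snd.
Qed.

Lemma integral_segment_le_kern a b del x y z : a <= x -> y <= b ->
  (forall t, x <= t <= y -> `|z - t| < del) ->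
  (\int[mu]_(t in `[x, y]) (`|df t| `^ p)%:E <=
   \int[mu]_(t in `[a, b]) kern del (z, t))%E.
Proof.
move=> ax yb zt.
have mz : measurable_fun setT (fun t => kern del (z, t)).
  exact: (measurableT_comp (mkern del) (pair1_measurable z)).
apply: (@le_trans _ _ (\int[mu]_(t in `[x, y]) kern del (z, t))%E).
  apply: ge0_le_integral => //.
  - by apply: measurable_funTS; apply: measurable_powR_norm.
  - exact: measurable_funTS.
  - move=> t; rewrite /= in_itv/= => /zt zd.
    by rewrite /kern/= indicE mem_set ?mulr1.
apply: ge0_subset_integral => //; first exact: measurable_funTS.
move=> t; rewrite /= !in_itv/= => /andP[? ?].
by rewrite (le_trans ax)//= (le_trans _ yb).
Qed.

Lemma increment_le_kern a b del x y : a <= x <= b -> a <= y <= b -> `|x - y| < del ->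
  ((`|f x - f y| `^ p)%:E <= (2 `^ p * del `^ (p - 1))%:E *
     \int[mu]_(t in `[a, b]) kern del (x, t))%E.
Proof.
move=> /andP[ax xb] /andP[ay yb] xyd.
have d0 : 0 < del by exact: le_lt_trans xyd.
have B0 : 0 < 2 `^ p * del `^ (p - 1) by rewrite mulr_gt0 ?powR_gt0.
set V := (\int[mu]_(t in _) _)%E.
have V0 : (0 <= V)%E by apply: integral_ge0 => t _; exact: kern0.
have key v : 0 < v -> (V <= v%:E)%E -> `|f x - f y| `^ p <= 2 `^ p * del `^ (p - 1) * v.
  move=> v0 Vv; have [xy|yx|->] := ltgtP x y; last first.
  - by rewrite subrr normr0 powR0 ?gt_eqF// mulr_ge0 ?ltW.
  - apply: increment_powR_le => //; first by rewrite -[leLHS]gtr0_norm ?subr_gt0// ltW.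
    apply: le_trans Vv; apply: integral_segment_le_kern => // t /andP[yt tx].
    rewrite (le_lt_trans _ xyd)// !ger0_norm ?subr_ge0//; last exact: ltW.
    exact: lerB.
  - rewrite distrC; apply: increment_powR_le => //.
      by rewrite -[leLHS]gtr0_norm ?subr_gt0// distrC ltW.
    apply: le_trans Vv; apply: integral_segment_le_kern => // t /andP[yt tx].
    rewrite (le_lt_trans _ xyd)// distrC [`|x - y|]distrC !ger0_norm ?subr_ge0//; last exact: ltW.
    exact: lerB.
case: V V0 key => [v| |]//= v0 key; last by rewrite gt0_muley ?leey ?lte_fin.
rewrite -EFinM lee_fin; apply/ler_addgt0Pr => e e0.
have eB : 0 < e / (2 `^ p * del `^ (p - 1)) by rewrite divr_gt0.
have := key (v + e / (2 `^ p * del `^ (p - 1))).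
rewrite mulrDr [X in _ <= _ + X]mulrC divfK ?gt_eqF//; apply.
- by rewrite ltr_wpDl.
- by rewrite lee_fin lerDl ltW.
Qed.

Lemma integral_near_diag_le a b del x : 0 < del ->
  (\int[mu]_(y in `[a, b]) (\1_(near_diag del) (x, y))%:E <= (2 * del)%:E)%E.
Proof.
move=> d0.
have -> : (\int[mu]_(y in `[a, b]) (\1_(near_diag del) (x, y))%:E =
    \int[mu]_(y in `[a, b]) (\1_(ball x del) y)%:E)%E.
  apply: eq_integral => y _; rewrite !indicE; congr ((_%:R)%:E); congr nat_of_bool.
have mb : measurable (ball x del : set (measurableTypeR R)) by exact: measurable_ball.
rewrite integral_indic//.
apply: (@le_trans _ _ (mu (ball x del))).
  apply: le_measure => [| |t []//]; rewrite inE//; exact: measurableI.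
by rewrite lebesgue_measure_ball ?(ltW d0)// mulrC mulr_natr.
Qed.

(** An increment costs del^(p - 1) times the integral of |df|^p near x. Integrating over y near x
    and then, after Tonelli, over x near t brings one factor 2 [del] each time, so the total power
    is del^(p + 1). *)
Lemma near_energy_le_sobolev a b del : 0 < del ->
  (near_energy f p a b del <= (2 `^ p * del `^ (p - 1) * (2 * del) * (2 * del))%:E *
     \int[mu]_(t in `[a, b]) (`|df t| `^ p)%:E)%E.
Proof.
move=> d0; have mf : measurable_fun setT f by exact: continuous_measurable_fun.
pose B := 2 `^ p * del `^ (p - 1).
have B0 : 0 <= B by rewrite mulr_ge0 ?powR_ge0.
pose V x := (\int[mu]_(t in `[a, b]) kern del (x, t))%E.
have V0 x : (0 <= V x)%E by apply: integral_ge0 => t _; exact: kern0.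
have mV : measurable_fun setT V.
  exact: (@measurable_integral_in _ _ _ _ _ mu _ (mkern del)).
have D0 : 0 <= 2 * del by rewrite mulr_ge0// ltW.
have mI : measurable_fun setT (fun z => (\1_(near_diag del) z : R)%:E).
  by apply/measurable_EFinP; apply: measurable_indic; exact: measurable_near_diag.
have mind x : measurable_fun setT (fun y : measurableTypeR R => (\1_(near_diag del) (x, y) : R)%:E).
  exact: (measurableT_comp mI (pair1_measurable x)).
have mind' y : measurable_fun setT (fun x : measurableTypeR R => (\1_(near_diag del) (x, y) : R)%:E).
  exact: (measurableT_comp mI (pair2_measurable y)).
apply: (@le_trans _ _ (\int[mu]_(x in `[a, b]) ((B * (2 * del))%:E * V x))%E).
  apply: ge0_le_integral => //.
  - by move=> x _; apply: integral_ge0 => y _; exact: near_dist_ge0.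
  - by apply: measurable_funTS; exact: measurable_near_dist_inner.
  - by apply: measurable_funTS; exact: measurable_funeM.
  move=> x; rewrite /= in_itv/= => xab.
  apply: (@le_trans _ _ (\int[mu]_(y in `[a, b]) ((\1_(near_diag del) (x, y))%:E * (B%:E * V x)))%E).
    apply: ge0_le_integral => //.
    - by move=> y _; exact: near_dist_ge0.
    - apply: measurable_funTS.
      exact: (measurableT_comp (measurable_near_dist p del mf) (pair1_measurable x)).
    - apply: measurable_funTS; apply: emeasurable_funM => //; exact: measurable_cst.
    move=> y; rewrite /= in_itv/= => yab; rewrite /near_dist indicE/=.
    case: (boolP (_ \in _)) => [/set_mem/= xy|_].
      by rewrite mulr1 mul1e; exact: increment_le_kern.
    by rewrite mulr0 mul0e.
  rewrite ge0_integralZr//; last 2 first.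
  - exact: measurable_funTS.
  - by rewrite mule_ge0// lee_fin.
  have -> : ((B * (2 * del))%:E * V x = (2 * del)%:E * (B%:E * V x))%E.
    by rewrite muleA -EFinM [(2 * del * B)%R]mulrC.
  apply: lee_wpmul2r; first by rewrite mule_ge0// lee_fin.
  exact: integral_near_diag_le.
rewrite ge0_integralZl//; last 2 first.
- exact: measurable_funTS.
- by rewrite lee_fin mulr_ge0.
rewrite -/B [leRHS](_ : _ = (B * (2 * del))%:E * ((2 * del)%:E * \int[mu]_(t in `[a, b]) (`|df t| `^ p)%:E))%E; last first.
  by rewrite muleA -EFinM.
apply: lee_wpmul2l; first by rewrite lee_fin mulr_ge0.
rewrite /V (tonelli_in mu mu (mkern del) (kern0 del))//.
have mdp : measurable_fun setT (fun t => (`|df t| `^ p)%:E) by exact: measurable_powR_norm.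
rewrite -ge0_integralZl//; last exact: measurable_funTS.
apply: ge0_le_integral => //.
- by move=> t _; apply: integral_ge0 => x _; exact: kern0.
- apply: measurable_funTS.
  pose sw (z : measurableTypeR R * measurableTypeR R) : measurableTypeR R * measurableTypeR R := (z.2, z.1).
  have msw : measurable_fun setT sw by exact: measurable_swap.
  by apply: (@measurable_integral_in _ _ _ _ _ mu _ (measurableT_comp (mkern del) msw)) => // z; exact: kern0.
- by apply: measurable_funTS; exact: measurable_funeM.
move=> t _.
have -> : (\int[mu]_(x in `[a, b]) kern del (x, t) =
    (`|df t| `^ p)%:E * \int[mu]_(x in `[a, b]) (\1_(near_diag del) (x, t))%:E)%E.
  by rewrite -ge0_integralZl//; exact: measurable_funTS.
rewrite muleC; apply: lee_wpmul2r; first by rewrite lee_fin powR_ge0.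
have -> : (\int[mu]_(x in `[a, b]) (\1_(near_diag del) (x, t))%:E =
    \int[mu]_(x in `[a, b]) (\1_(near_diag del) (t, x))%:E)%E.
  apply: eq_integral => x _; rewrite !indicE; congr ((_%:R)%:E); congr nat_of_bool.
  by apply/idP/idP; rewrite !inE /near_diag/= distrC.
exact: integral_near_diag_le.
Qed.

(** After weighting, a scale del contributes del^((1 - sg) p), summable because sg < 1. This is why
    the order is lowered when s = 1. *)
Lemma dyadic_energy_le_sobolev sg r W m : 0 < r -> 0 <= W -> sg < 1 ->
  (\int[mu]_(t in `[r, (r * 4)%R]) (`|df t| `^ p)%:E <= W%:E)%E ->
  (\sum_(j < m) ((r * 4 / 2 ^+ j) `^ (- (1 + sg * p)))%:E *
     near_energy f p r (r * 4) (r * 4 / 2 ^+ j) <=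
   (2 `^ p * 4 * 4 `^ ((1 - sg) * p) / (1 - 2 `^ (- ((1 - sg) * p))) *
    (W * r `^ ((1 - sg) * p)))%:E)%E.
Proof.
move=> r0 W0 sg1 hW; pose del (j : nat) := r * 4 / 2 ^+ j.
have d0 j : 0 < del j by rewrite divr_gt0 ?mulr_gt0// exprn_gt0.
have x0 : 0 < (1 - sg) * p by rewrite mulr_gt0// subr_gt0.
apply: (@le_trans _ _ (\sum_(j < m) (2 `^ p * 4 * (W * (r * 4) `^ ((1 - sg) * p)) * (2 ^+ j) `^ (- ((1 - sg) * p)))%:E)%E).
  apply: lee_sum => j _.
  apply: (@le_trans _ _ (((del j) `^ (- (1 + sg * p)))%:E *
    ((2 `^ p * del j `^ (p - 1) * (2 * del j) * (2 * del j))%:E * W%:E))%E).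
    apply: lee_wpmul2l; first by rewrite lee_fin powR_ge0.
    apply: (le_trans (near_energy_le_sobolev _ _ (d0 j))).
    by apply: lee_wpmul2l => //; rewrite lee_fin !mulr_ge0 ?powR_ge0// ltW.
  rewrite -!EFinM lee_fin mulrA.
  rewrite (_ : _ * (_ * _) = 2 `^ p * 4 * ((r * 4) `^ ((1 - sg) * p) * (2 ^+ j) `^ (- ((1 - sg) * p)))).
    by rewrite le_eqVlt; apply/orP; left; apply/eqP; ring.
  rewrite /del; have := exprn_gt0 j (ltr0Sn R 1); set P := 2 ^+ j => P0.
  have -> : (4 : R) = 2 * 2 by rewrite -natrM.
  clearbody P; have r4 : 0 < r * (2 * 2) by rewrite !mulr_gt0.
  by apply: ln_eq; [posr|posr|ln_expand]; ring.
rewrite sumEFin lee_fin -mulr_sumr powRM ?(ltW r0)//.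
have S1 := @dyadic_sum_powR_le R ((1 - sg) * p) m x0.
apply: (le_trans (ler_wpM2l _ S1)).
  by rewrite !mulr_ge0 ?powR_ge0.
by rewrite le_eqVlt; apply/orP; left; apply/eqP; ring.
Qed.

End sobolev.

(** * Choice of exponents, and both seminorms in one statement *)

Section seminorms.
Context {R : realType}.
Notation mu := (@lebesgue_measure R).
Local Notation leb := (lebesgue_rV R).

(** For s = 1 the order is lowered by min(1/2, th/2), which preserves at least half of the gap [th].
    The gap is affine in tau with slope sg - 1/p + 1/q, of absolute value at most 2, so eps <= th'/4
    keeps it positive at tau - eps and tau + eps. In the critical case s p < 1 already gives s < 1,
    and sg = s. *)
Lemma gn_exponents (p q g s tau : R) : 1 <= p -> 1 <= q -> 0 < g -> 0 < s -> s <= 1 ->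
  0 < tau -> tau < 1 ->
  0 < s * tau - tau / p + g^-1 - (1 - tau) / q \/ (g = q /\ q * (1 - s * p) = p) ->
  exists sg eps, [/\ 0 < sg, sg < 1, s != 1 -> sg = s, 0 < eps &
    annulus_gn p q g sg (tau - eps) /\ annulus_gn p q g sg (tau + eps)].
Proof.
move=> p1 q1 g0 s0 s1 t0 t1 [th0|[-> crit]]; last first.
  have p0 : 0 < p by exact: lt_le_trans p1.
  have q0 : 0 < q by exact: lt_le_trans q1.
  have sp : s * p < 1 by rewrite -subr_gt0 -(pmulr_rgt0 _ q0) crit.
  pose eps := Num.min (tau / 2) ((1 - tau) / 2).
  have eps0 : 0 < eps by rewrite lt_min !divr_gt0// subr_gt0.
  have [e1 e2] : eps <= tau / 2 /\ eps <= (1 - tau) / 2 by rewrite !ge_min !lexx orbT.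
  exists s, eps; split => //.
    by rewrite (le_lt_trans _ sp)// ler_peMr// ltW.
  by split; apply: annulus_gn_critical => //; lra.
set th := _ - _ in th0.
have [sg [sg0 sg1 sgs sgth]] : exists sg, [/\ 0 < sg, sg < 1, s != 1 -> sg = s & s - sg <= th / 2].
  have [s1'|s1'] := eqVneq s 1; last first.
    exists s; split => //; first by rewrite lt_neqAle s1'.
    by rewrite subrr divr_ge0// ltW.
  exists (1 - Num.min (2^-1) (th / 2)).
  set h := Num.min _ _; have h0 : 0 < h by rewrite lt_min invr_gt0 ltr0n divr_gt0.
  have [h1 h2] : h <= 2^-1 /\ h <= th / 2 by rewrite !ge_min !lexx orbT.
  split => //; try lra.
have th'0 : 0 < sg * tau - tau / p + g^-1 - (1 - tau) / q.
  have : (s - sg) * tau <= th / 2.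
    apply: le_trans sgth; rewrite ler_piMr ?subr_ge0 ?(ltW t1)//.
    by have [E|/sgs ->] := eqVneq s 1; [rewrite E ltW|exact: lexx].
  by move: th0; rewrite /th; lra.
set th' := _ - _ in th'0.
pose eps := Num.min (Num.min (tau / 2) ((1 - tau) / 2)) (th' / 4).
have eps0 : 0 < eps by rewrite !lt_min !divr_gt0// subr_gt0.
have [e1 e2 e3] : [/\ eps <= tau / 2, eps <= (1 - tau) / 2 & eps <= th' / 4].
  by rewrite !ge_min !lexx !orbT.
exists sg, eps; split => //.
have p0 : 0 < p by exact: lt_le_trans p1.
have q0 : 0 < q by exact: lt_le_trans q1.
have [ip0 ip1] : 0 <= p^-1 /\ p^-1 <= 1 by rewrite invr_ge0 invf_le1// ltW.
have [iq0 iq1] : 0 <= q^-1 /\ q^-1 <= 1 by rewrite invr_ge0 invf_le1// ltW.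
have E1 : eps * (sg - p^-1 + q^-1) <= eps * 2 by rewrite ler_pM2l//; lra.
have E2 : eps * (- (sg - p^-1 + q^-1)) <= eps * 2 by rewrite ler_pM2l//; lra.
split; apply: annulus_gn_strict => //; try lra.
- have -> : sg * (tau - eps) - (tau - eps) / p + g^-1 - (1 - (tau - eps)) / q =
    th' - eps * (sg - p^-1 + q^-1) by rewrite /th'; ring.
  lra.
- have -> : sg * (tau + eps) - (tau + eps) / p + g^-1 - (1 - (tau + eps)) / q =
    th' - eps * (- (sg - p^-1 + q^-1)) by rewrite /th'; ring.
  lra.
Qed.

Definition seminorm n (s p : R) (g : 'rV[R]_n -> R) : \bar R :=
  if s == 1 then (\int[leb n]_x (enorm (gradient g x) `^ p)%:E)%E
  else (\int[leb n]_x \int[leb n]_y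
       (`|g x - g y| `^ p / enorm (x - y) `^ (n%:R + s * p))%:E)%E.

Lemma Wdot_normE n (s p : R) (g : 'rV[R]_n -> R) :
  Wdot_norm s p g = (seminorm s p g `^ p^-1)%E.
Proof. by rewrite /Wdot_norm /seminorm; case: ifP. Qed.

Lemma seminorm_ge0 n (s p : R) (g : 'rV[R]_n -> R) : (0 <= seminorm s p g)%E.
Proof.
rewrite /seminorm; case: ifP => _; apply: integral_ge0 => x _; first by rewrite lee_fin powR_ge0.
by apply: integral_ge0 => y _; rewrite lee_fin divr_ge0 ?powR_ge0.
Qed.

Lemma coulomb_energy_ge0 n (al q : R) (g : 'rV[R]_n -> R) : (0 <= coulomb_energy al q g)%E.
Proof.
apply: integral_ge0 => x _; apply: integral_ge0 => y _.
by rewrite lee_fin divr_ge0 ?mulr_ge0 ?powR_ge0.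
Qed.

Lemma profileE n (g : 'rV[R]_n.+1 -> R) : C1c_rad g -> g = (fun x => profile g (enorm x)).
Proof. by move=> hg; apply/funext => x; exact: profile_enorm. Qed.

Lemma dyadic_energy_le_gradient n (p sg : R) : 1 <= p -> sg < 1 ->
  exists2 C, 0 < C & forall (g : 'rV[R]_n.+1 -> R) a, C1c_rad g -> 0 < a ->
  (\int[leb n.+1]_x (enorm (gradient g x) `^ p)%:E <= a%:E)%E -> forall r, 0 < r ->
  dyadic_energy_le (profile g) p sg r
    (((C * a) `^ p^-1 * r `^ (- ((n.+1%:R - 1 * p) / p))) `^ p * r `^ (1 - sg * p)).
Proof.
move=> p1 sg1; have p0 : 0 < p by exact: lt_le_trans p1.
pose k : R := n.+1%:R; have k0 : 0 < k by rewrite ltr0n.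
have x0 : 0 < (1 - sg) * p by rewrite mulr_gt0// subr_gt0.
pose c := 2 `^ p * 4 * 4 `^ ((1 - sg) * p) / (1 - 2 `^ (- ((1 - sg) * p))) : R.
have c0 : 0 < c.
  rewrite !mulr_gt0 ?powR_gt0// invr_gt0 subr_gt0.
  by rewrite powR_expR// -[ltRHS]expR0 ltr_expR mulNr oppr_lt0 mulr_gt0// ln2_gt0.
have B0 : 0 < c * (k `^ p * k ^+ n).
  by apply: mulr_gt0 => //; apply: mulr_gt0; [exact: powR_gt0|exact: exprn_gt0].
exists (c * (k `^ p * k ^+ n)) => //.
move=> g a hg a0 ha r r0 m.
have Ba0 : 0 < c * (k `^ p * k ^+ n) * a by exact: mulr_gt0.
rewrite (powR_annulus_energy n 1 sg p0 Ba0 r0).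
pose df := dprofile g.
have mdf : measurable_fun setT df.
  by apply: continuous_measurable_fun; exact: continuous_dprofile.
(* The cut-off to [r, 4r] keeps x away from the origin, as [dprofile_enorm_le] demands. *)
pose F t : \bar R := (`|df t| `^ p * \1_(`[r, (r * 4)%R]%classic : set R) t)%:E.
have mF : measurable_fun setT F.
  apply/measurable_EFinP; apply: measurable_funM; last exact: measurable_indic.
  by apply/measurable_EFinP; exact: measurable_powR_norm.
have F0 t : (0 <= F t)%E by rewrite lee_fin mulr_ge0 ?powR_ge0.
have mG : measurable_fun setT (fun x => (enorm (gradient g x) `^ p)%:E).
  apply/measurable_EFinP; apply: (measurableT_comp (measurable_powR p)).
  exact: measurable_gradient.
have h1 : (\int[leb n.+1]_x F (enorm x) <= (k `^ p * a)%:E)%E.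
  apply: (@le_trans _ _ (\int[leb n.+1]_x ((k `^ p)%:E * (enorm (gradient g x) `^ p)%:E))%E).
    apply: ge0_le_integral => //.
    - apply: (measurableT_comp mF); exact: measurable_enorm.
    - exact: measurable_funeM.
    move=> x _; rewrite /F indicE -EFinM lee_fin; case: (boolP (_ \in _)) => [/set_mem/=|_].
      rewrite in_itv/= mulr1 => /andP[rx _].
      rewrite -powRM ?enorm_ge0 ?(ltW k0)// ge0_ler_powR ?nnegrE ?(ltW p0) ?mulr_ge0 ?(ltW k0) ?enorm_ge0//.
      by apply: dprofile_enorm_le => //; exact: lt_le_trans rx.
    by rewrite mulr0 mulr_ge0 ?powR_ge0.
  rewrite ge0_integralZl//; last 2 first.
  - by move=> x _; rewrite lee_fin powR_ge0.
  - by rewrite lee_fin powR_ge0.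
  by rewrite EFinM; apply: lee_wpmul2l => //; rewrite lee_fin powR_ge0.
have h2 := annulus_le_integral n (r * 4) mF F0 r0.
have {h2} := le_trans h2 h1.
have -> : (\int[mu]_(t in `[r, (r * 4)%R]) F t = \int[mu]_(t in `[r, (r * 4)%R]) (`|df t| `^ p)%:E)%E.
  by apply: eq_integral => t rt; rewrite /F indicE rt mulr1.
rewrite -/k; have rk0 : 0 < (r / k) ^+ n by rewrite exprn_gt0// divr_gt0.
rewrite -lee_pdivlMl// -EFinM => h3.
have W0 : 0 <= ((r / k) ^+ n)^-1 * (k `^ p * a).
  by rewrite mulr_ge0 ?invr_ge0 ?mulr_ge0 ?powR_ge0// ltW.
have := dyadic_energy_le_sobolev p1 (continuous_dprofile hg) (is_derive_profile hg) m r0 W0 sg1 h3.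
move=> /le_trans; apply; rewrite lee_fin -/c le_eqVlt; apply/orP; left; apply/eqP.
rewrite powRB; last by apply/implyP => _; rewrite gt_eqF.
rewrite powR_mulrn ?(ltW r0)// expr_div_n.
have [rn kn] : r ^+ n != 0 /\ k ^+ n != 0 by rewrite !gt_eqF ?exprn_gt0.
by field; rewrite rn kn.
Qed.

Lemma dyadic_energy_le_gagliardo n (p s : R) : 1 <= p -> 0 < s ->
  exists2 C, 0 < C & forall (f : R -> R) a, continuous f -> 0 < a ->
  (\int[leb n.+1]_x \int[leb n.+1]_y
    (`|f (enorm x) - f (enorm y)| `^ p / enorm (x - y) `^ (n.+1%:R + s * p))%:E <= a%:E)%E ->
  forall r, 0 < r -> dyadic_energy_le f p s r
    (((C * a) `^ p^-1 * r `^ (- ((n.+1%:R - s * p) / p))) `^ p * r `^ (1 - s * p)).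
Proof.
move=> p1 s0; have p0 : 0 < p by exact: lt_le_trans p1.
pose k : R := n.+1%:R; have k0 : 0 < k by rewrite ltr0n.
pose N : R := k + s * p; have N0 : 0 < N by rewrite addr_gt0// mulr_gt0.
pose C1 : R := (k * 32) `^ N / (1 - (2 `^ N)^-1).
have C10 : 0 < C1.
  rewrite divr_gt0 ?powR_gt0 ?mulr_gt0// subr_gt0 invf_lt1 ?powR_gt0//.
  by rewrite powR_expR// -[ltLHS]expR0 ltr_expR mulr_gt0// ln2_gt0.
have C0 : 0 < (8 * k) ^+ n * C1 * (2 * k) ^+ n
  by apply: mulr_gt0; [apply: mulr_gt0 => //|]; apply: exprn_gt0; exact: mulr_gt0.
exists ((8 * k) ^+ n * C1 * (2 * k) ^+ n) => //.
move=> f a cf a0 ha r r0 m.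
have Ba0 : 0 < (8 * k) ^+ n * C1 * (2 * k) ^+ n * a by exact: mulr_gt0.
rewrite (powR_annulus_energy n s s p0 Ba0 r0) subrr mul0r sub0r powRN powR_mulrn ?(ltW r0)//.
exact: (sum_near_energy_le p1 s0 cf m r0 ha).
Qed.

Lemma dyadic_energy_le_seminorm n (p s sg : R) : 1 <= p -> 0 < s -> sg < 1 -> (s != 1 -> sg = s) ->
  exists2 C, 0 < C & forall (g : 'rV[R]_n.+1 -> R) a, C1c_rad g -> 0 < a ->
  (seminorm s p g <= a%:E)%E -> forall r, 0 < r ->
  dyadic_energy_le (profile g) p sg r
    (((C * a) `^ p^-1 * r `^ (- ((n.+1%:R - s * p) / p))) `^ p * r `^ (1 - sg * p)).
Proof.
move=> p1 s0 sg1; have [->|s1] := eqVneq s 1 => sgs.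
  have [C C0 hC] := dyadic_energy_le_gradient n p1 sg1.
  by exists C => // g a hg a0; rewrite /seminorm eqxx; exact: hC.
have [C C0 hC] := dyadic_energy_le_gagliardo n p1 s0.
exists C => // g a hg a0; rewrite /seminorm (negbTE s1) (sgs isT) => ha.
apply: (hC _ _ (continuous_profile hg) a0).
apply: le_trans ha; rewrite le_eqVlt; apply/orP; left; apply/eqP.
apply: eq_integral => x _; apply: eq_integral => y _.
by rewrite -!profile_enorm.
Qed.

Lemma continuous_eq0_of_integral (f : R -> R) q r b : 0 < q -> continuous f -> r < b ->
  (\int[mu]_(y in `[r, b]) (`|f y| `^ q)%:E <= 0)%E -> f r = 0.
Proof.
move=> q0 cf rb h0; apply/eqP/negP => /negP fr.
have c0 : 0 < `|f r| / 2 by rewrite divr_gt0// normr_gt0.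
have mf : measurable_fun setT f by exact: continuous_measurable_fun.
have : \forall t \near r, `|f r - f t| < `|f r| / 2 by have /cvgrPdist_lt := cf r; apply.
move=> /nbhs_ballP[e /= e0 he].
pose h := Num.min (e / 2) (b - r).
have h0' : 0 < h by rewrite lt_min divr_gt0// subr_gt0.
have [h1 h2] : h <= e / 2 /\ h <= b - r by rewrite !ge_min !lexx orbT.
have rh : r < r + h by rewrite ltrDl.
suff : ((((`|f r| / 2) `^ q) * h)%:E <= (0 : \bar R))%E.
  by rewrite lee_fin leNgt mulr_gt0// powR_gt0.
apply: le_trans h0.
apply: (@le_trans _ _ (\int[mu]_(y in `[r, (r + h)%R]) ((`|f r| / 2) `^ q)%:E)%E).
  have -> : (\int[mu]_(y in `[r, (r + h)%R]) ((`|f r| / 2) `^ q)%:E =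
    ((`|f r| / 2) `^ q)%:E * mu `[r, (r + h)%R]%classic)%E by rewrite integral_cst.
  by rewrite lebesgue_measure_cc// -EFinM lee_fin; lra.
apply: (@le_trans _ _ (\int[mu]_(y in `[r, (r + h)%R]) (`|f y| `^ q)%:E)%E).
  apply: ge0_le_integral => //.
  - by apply: measurable_funTS; exact: measurable_powR_norm.
  move=> y; rewrite /= in_itv/= => /andP[ry yh]; rewrite lee_fin.
  rewrite ge0_ler_powR ?nnegrE ?(ltW q0) ?(ltW c0)//.
  have ye : `|r - y| < e.
    by rewrite distrC ger0_norm ?subr_ge0//; lra.
  have /= := he y ye; have := ler_normD (f r - f y) (f y).
  by rewrite subrK; lra.
apply: ge0_subset_integral => //.
- by apply: measurable_funTS; exact: measurable_powR_norm.
by move=> y; rewrite /= !in_itv/= => /andP[-> yh]/=; lra.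
Qed.

End seminorms.

(** * The inequality for radial functions *)

Section radial_gn.
Context {R : realType}.
Notation mu := (@lebesgue_measure R).
Local Notation leb := (lebesgue_rV R).

Lemma le0_of_le_powR (X K b : R) : 0 < K -> 0 < b ->
  (forall e, 0 < e -> X <= K * e `^ b) -> X <= 0.
Proof.
move=> K0 b0 h; rewrite leNgt; apply/negP => X0.
have h2 : 0 < X / (2 * K) by rewrite divr_gt0// mulr_gt0.
have := h ((X / (2 * K)) `^ b^-1); rewrite powR_gt0// => /(_ isT).
rewrite -powRrM mulVf ?gt_eqF// powRr1 ?(ltW h2)//.
have -> : K * (X / (2 * K)) = X / 2 by field; rewrite gt_eqF.
lra.
Qed.

Lemma powR_half_energy (B e q m r : R) : 0 < B -> 0 < e -> 0 < q -> 0 < r ->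
  ((B * e) `^ (2 * q)^-1 * r `^ (- m)) `^ q * r =
  B `^ 2^-1 * (r `^ (- m)) `^ q * r * e `^ 2^-1.
Proof.
move=> B0 e0 q0 r0; apply: ln_eq; [posr|posr|ln_expand].
by field; rewrite gt_eqF.
Qed.

(** On the right, everything before the parenthesis cancels by the scaling relation, and the
    parenthesis is the one-dimensional gap: the radial condition is that gap up to the factor (k -
    1) / g. *)
Lemma radial_exponentE (k g s p alpha b1 b2 : R) : k - 1 != 0 -> g != 0 ->
  (b1 * g + (k + alpha - 2) / (k - 1) * b2 * g - 1) * (k - 1) / g =
  (k - s * p) * b1 + (k + alpha) * b2 - k / g + ((s * p - 1) * b1 - 2 * b2 + g^-1).
Proof. by move=> k1 g0; field; rewrite g0 k1. Qed.

Section exponents.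
Variables (n : nat) (s gam p q alpha beta1 beta2 : R).
Hypotheses (hs0 : 0 < s) (hs1 : s <= 1) (hgam : 0 < gam)
  (hp : 1 <= p) (hq : 1 <= q) (halphad : alpha < n.+1%:R) (alpha0 : 0 < alpha)
  (hbeta1 : 0 < beta1) (hbeta2 : 0 < beta2)
  (hhom : beta1 * p + 2 * beta2 * q = 1)
  (hscal : (n.+1%:R - s * p) * beta1 + (n.+1%:R + alpha) * beta2 = n.+1%:R / gam)
  (hne : p * (n.+1%:R + alpha) - 2 * q * (n.+1%:R - s * p) != 0).
Hypothesis hexp : 0 < (s * p - 1) * beta1 - 2 * beta2 + gam^-1 \/
   (gam = q /\ q * (1 - s * p) = p).

Let k : R := n.+1%:R.
Let m1 := (k - s * p) / p.
Let m2 := (k + alpha) / (2 * q).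
Let tau := beta1 * p.
Let p0 : 0 < p. Proof. exact: lt_le_trans hp. Qed.
Let q0 : 0 < q. Proof. exact: lt_le_trans hq. Qed.
Let k0 : 0 < k. Proof. by rewrite ltr0n. Qed.
Let tau0 : 0 < tau. Proof. exact: mulr_gt0. Qed.
Let tau1E : 1 - tau = 2 * beta2 * q. Proof. by rewrite /tau; move: hhom; lra. Qed.
Let tau1 : tau < 1. Proof. by rewrite -subr_gt0 tau1E !mulr_gt0. Qed.

Let m12 : m1 != m2.
Proof.
apply/eqP => E; move/eqP : hne; apply.
have [pn qn] : p != 0 /\ q != 0 by rewrite !gt_eqF.
have -> : p * (n.+1%:R + alpha) - 2 * q * (n.+1%:R - s * p) = 2 * p * q * (m2 - m1).
  by rewrite /m1 /m2 -/k; field; rewrite pn qn.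
by rewrite E subrr mulr0.
Qed.

Let mtau : tau * m1 + (1 - tau) * m2 = k / gam.
Proof.
have [pn qn] : p != 0 /\ q != 0 by rewrite !gt_eqF.
by rewrite -hscal tau1E /tau /m1 /m2; field; rewrite pn qn.
Qed.

(** The amplitudes u and v stay arbitrary positive numbers, so that an energy equal to 0 can be
    approached by positive bounds and v can be chosen without the Coulomb energy. *)
Lemma radial_Lnorm_le : exists sg C, [/\ sg < 1, s != 1 -> sg = s, 0 < C &
  forall (g : 'rV[R]_n.+1 -> R) u v, C1c_rad g -> 0 < u -> 0 < v ->
  (forall r, 0 < r -> dyadic_energy_le (profile g) p sg r ((u * r `^ (- m1)) `^ p * r `^ (1 - sg * p))) ->
  (forall r, 0 < r -> (\int[mu]_(y in `[r, (r * 2)%R]) (`|profile g y| `^ q)%:E <=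
     ((v * r `^ (- m2)) `^ q * r)%:E)%E) ->
  ('N[leb n.+1]_(gam%:E)[EFin \o g] <= (C * (u `^ tau * v `^ (1 - tau)))%:E)%E].
Proof.
have hx : 0 < s * tau - tau / p + gam^-1 - (1 - tau) / q \/ (gam = q /\ q * (1 - s * p) = p).
  case: hexp => [h|]; [left|by right].
  rewrite tau1E /tau; have [pn qn] : p != 0 /\ q != 0 by rewrite !gt_eqF.
  rewrite (_ : _ - _ = (s * p - 1) * beta1 - 2 * beta2 + gam^-1)//.
  by field; rewrite pn qn gt_eqF.
have [sg [eps [sg0 sg1 sgs eps0 [gn1 gn2]]]] := gn_exponents hp hq hgam hs0 hs1 tau0 tau1 hx.
have D0 : 0 < k / gam by rewrite divr_gt0.
have gD : gam * (k / gam) = n.+1%:R by rewrite mulrC divfK// gt_eqF.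
have [C1 C10 hC1] := radial_profile_gn hp hq hgam D0 gD m12 mtau tau0 tau1 eps0 gn1 gn2.
have [C2 C20 hC2] := @integral_enorm_le R n.
exists sg, ((C2 * C1) `^ gam^-1); split => //; first by rewrite powR_gt0// mulr_gt0.
move=> g u v hg u0 v0 hA hE.
have [M M0 hM] := profile_support hg.
have cf := continuous_profile hg.
have lip r : 0 < r -> exists2 L, 0 <= L & forall y z, r <= y <= r * 2 ->
    r <= z <= r * 2 -> `|profile g y - profile g z| <= L * `|y - z|.
  by move=> r0; apply: profile_lipschitz => //; rewrite ler_peMr ?(ltW r0)// ler1n.
have H1 := hC1 _ u v M cf hM lip u0 v0 hA hE.
have mF : measurable_fun setT (fun t => (`|profile g t| `^ gam)%:E).
  by apply: measurable_powR_norm; exact: continuous_measurable_fun.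
have H2 := hC2 _ mF (fun t => powR_ge0 _ _).
have -> : ('N[leb n.+1]_(gam%:E)[EFin \o g] =
    (\int[leb n.+1]_x (`|profile g (enorm x)| `^ gam)%:E) `^ gam^-1)%E.
  rewrite unlock; congr (poweR _ _).
  by under eq_integral => x _ do rewrite /comp (profile_enorm hg).
have {}H2 : (\int[leb n.+1]_x (`|profile g (enorm x)| `^ gam)%:E <=
    (C2 * C1 * (u `^ tau * v `^ (1 - tau)) `^ gam)%:E)%E.
  apply: (le_trans H2); rewrite -mulrA [leRHS]EFinM.
  apply: lee_wpmul2l; first by rewrite lee_fin ltW.
  apply: le_trans H1; rewrite le_eqVlt; apply/orP; left; apply/eqP.
  apply: eq_integral => t; rewrite inE/= in_itv/= andbT => t0.
  by rewrite (gtr0_norm t0) EFinM.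
have I0 : (0 <= \int[leb n.+1]_x (`|profile g (enorm x)| `^ gam)%:E)%E.
  by apply: integral_ge0 => x _; rewrite lee_fin powR_ge0.
apply: (@le_trans _ _ ((C2 * C1 * (u `^ tau * v `^ (1 - tau)) `^ gam)%:E `^ gam^-1)%E).
  apply: gt0_ler_poweR => //.
  - by rewrite invr_ge0 ltW.
  - by rewrite in_itv/= I0 leey.
  - by rewrite in_itv/= leey andbT (le_trans I0).
rewrite poweR_EFin lee_fin powRM ?powR_ge0 ?mulr_ge0 ?(ltW C10) ?(ltW C20)//.
rewrite -[(_ `^ gam) `^ _]powRrM divff ?gt_eqF// powRr1 ?mulr_ge0 ?powR_ge0//.
Qed.

Lemma radial_gagliardo_nirenberg : exists2 C, 0 < C &
  forall g : 'rV[R]_n.+1 -> R, C1c_rad g ->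
  ('N[leb n.+1]_(gam%:E)[EFin \o g] <=
   C%:E * Wdot_norm s p g `^ (beta1 * p) * coulomb_energy alpha q g `^ beta2)%E.
Proof.
have [sg [C0 [sg1 sgs C00 hC0]]] := radial_Lnorm_le.
have [CA CA0 hA] := dyadic_energy_le_seminorm n hp hs0 sg1 sgs.
have [CE CE0 hE] := annulus_powR_le_coulomb q0 halphad.
have b1 : tau / p = beta1 by rewrite /tau mulfK// gt_eqF.
have b2 : (2 * q)^-1 * (1 - tau) = beta2.
  have qn : q != 0 by rewrite gt_eqF.
  by rewrite tau1E; field.
have uE x : (x `^ p^-1) `^ tau = x `^ beta1 by rewrite -powRrM mulrC b1.
have vE x : (x `^ (2 * q)^-1) `^ (1 - tau) = x `^ beta2 by rewrite -powRrM b2.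
pose C := C0 * (CA `^ beta1 * CE `^ beta2).
have C1 : 0 < C by rewrite mulr_gt0// mulr_gt0 ?powR_gt0.
exists C => // g hg; rewrite Wdot_normE -poweRrM mulrCA mulVf ?gt_eqF// mulr1.
set A := seminorm s p g; set E := coulomb_energy alpha q g.
have A0 : (0 <= A)%E by exact: seminorm_ge0.
have E0 : (0 <= E)%E by exact: coulomb_energy_ge0.
have rhs0 : (0 <= C%:E * A `^ beta1 * E `^ beta2)%E.
  by rewrite !mule_ge0 ?poweR_ge0// lee_fin ltW.
have hEg e : 0 < e -> (E <= e%:E)%E -> forall r, 0 < r ->
    (\int[mu]_(y in `[r, (r * 2)%R]) (`|profile g y| `^ q)%:E <=
    (((CE * e) `^ (2 * q)^-1 * r `^ (- m2)) `^ q * r)%:E)%E.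
  move=> e0; rewrite /E {1}(profileE hg) => Ee.
  exact: (hE _ _ (continuous_profile hg) e0 Ee).
have [M M0 hM] := profile_support hg.
have [B B0 hB] := profile_bounded hg.
have m20 : 0 < m2 by rewrite divr_gt0 ?mulr_gt0// addr_gt0.
have cf := continuous_profile hg.
have LNe0 : (('N[leb n.+1]_(gam%:E)[EFin \o g] <= 0) ->
    ('N[leb n.+1]_(gam%:E)[EFin \o g] <= C%:E * A `^ beta1 * E `^ beta2))%E.
  by move=> /le_trans; apply.
(* The convention [+oo * 0 = 0] forbids discarding an infinite factor before the
   vanishing ones have been ruled out. *)
have [Ez|En] := eqVneq E 0%E.
  apply: LNe0.
  have f0 r : 0 < r -> profile g r = 0.
    move=> r0; apply: (@continuous_eq0_of_integral _ _ q r (r * 2)) => //.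
      by rewrite ltr_pMr// ltr1n.
    pose K := CE `^ 2^-1 * (r `^ (- m2)) `^ q * r.
    have K0 : 0 < K by rewrite !mulr_gt0 ?powR_gt0.
    have key e : 0 < e -> (\int[mu]_(y in `[r, (r * 2)%R]) (`|profile g y| `^ q)%:E <=
        (K * e `^ 2^-1)%:E)%E.
      move=> e0; have Ee : (E <= e%:E)%E by rewrite Ez lee_fin ltW.
      apply: (le_trans (hEg e e0 Ee r r0)); rewrite lee_fin le_eqVlt; apply/orP; left; apply/eqP.
      exact: powR_half_energy.
    have J0 : (0 <= \int[mu]_(y in `[r, (r * 2)%R]) (`|profile g y| `^ q)%:E)%E.
      by apply: integral_ge0 => y _; rewrite lee_fin powR_ge0.
    have := key 1 ltr01; move: J0 key; case: (\int[mu]_(y in _) _)%E => [l| |]//= l0 key _.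
    by rewrite lee_fin; apply: (@le0_of_le_powR l K 2^-1) => //; rewrite invr_gt0.
  have fz : profile g 0 = 0.
    have [L L0 hL] := @profile_lipschitz _ _ _ hg 0 1 ler01.
    apply/eqP; rewrite -normr_le0; apply/ler_addgt0Pr => e e0; rewrite add0r.
    pose z := Num.min 1 (e / (L + 1)).
    have L1 : 0 < L + 1 by rewrite ltr_wpDl.
    have z0 : 0 < z by rewrite lt_min ltr01 divr_gt0.
    have [z1 z2] : z <= 1 /\ z <= e / (L + 1) by rewrite !ge_min !lexx orbT.
    have := hL 0 z; rewrite lexx ler01 (ltW z0) z1 (f0 z z0) subr0 sub0r normrN (gtr0_norm z0) => /(_ isT isT).
    move=> /le_trans; apply; rewrite -[leRHS](divfK (lt0r_neq0 L1)) mulrC.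
    apply: ler_pM => //; first exact: ltW.
    by rewrite lerDl.
  have -> : EFin \o g = cst 0%E.
    apply/funext => x /=; congr EFin; rewrite (profile_enorm hg).
    have [x0|x0] := eqVneq (enorm x) 0; first by rewrite x0.
    by rewrite f0// lt_neqAle eq_sym x0 enorm_ge0.
  by rewrite Lnorm0// eqe gt_eqF.
have [Az|An] := eqVneq A 0%E.
  apply: LNe0.
  (* The Coulomb energy has not been shown finite, so v comes from boundedness and compact support:
     as m2 > 0, v r^(-m2) is at least B for r <= M. Letting the bound e of the seminorm tend to 0
     then annihilates the norm of g. *)
  pose v := B * M `^ m2.
  have v0 : 0 < v by rewrite mulr_gt0 ?powR_gt0.
  have hv r : 0 < r -> (\int[mu]_(y in `[r, (r * 2)%R]) (`|profile g y| `^ q)%:E <=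
      ((v * r `^ (- m2)) `^ q * r)%:E)%E.
    move=> r0.
    have r2 : r < r * 2 by rewrite ltr_pMr// ltr1n.
    apply: (@le_trans _ _ (\int[mu]_(y in `[r, (r * 2)%R]) ((v * r `^ (- m2)) `^ q)%:E)%E).
      apply: ge0_le_integral => //.
      - by apply: measurable_funTS; apply: measurable_powR_norm; exact: continuous_measurable_fun.
      move=> y; rewrite /= in_itv/= => /andP[ry _]; rewrite lee_fin.
      have vr0 : 0 <= v * r `^ (- m2) by rewrite mulr_ge0 ?powR_ge0// ltW.
      apply: ge0_ler_powR; rewrite ?nnegrE ?(ltW q0)//.
      have [My|yM] := leP M y; first by rewrite hM// normr0.
      rewrite (le_trans (hB _ _)) ?(le_trans (ltW r0))// /v -mulrA ler_peMr ?(ltW B0)//.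
      rewrite powRN -ler_pdivrMr ?invr_gt0 ?powR_gt0// div1r invrK.
      by rewrite ge0_ler_powR ?nnegrE ?(ltW m20) ?(ltW r0) ?(ltW M0)// ltW// (le_lt_trans ry).
    have -> : (\int[mu]_(y in `[r, (r * 2)%R]) ((v * r `^ (- m2)) `^ q)%:E =
      ((v * r `^ (- m2)) `^ q)%:E * mu `[r, (r * 2)%R]%classic)%E by rewrite integral_cst.
    by rewrite lebesgue_measure_cc// -EFinM lee_fin ler_wpM2l ?powR_ge0//; lra.
  have key e : 0 < e -> ('N[leb n.+1]_(gam%:E)[EFin \o g] <=
      (C0 * CA `^ beta1 * v `^ (1 - tau) * e `^ beta1)%:E)%E.
    move=> e0; have Ae : (A <= e%:E)%E by rewrite Az lee_fin ltW.
    have ue0 : 0 < (CA * e) `^ p^-1 by rewrite powR_gt0// mulr_gt0.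
    apply: (le_trans (hC0 g _ _ hg ue0 v0 (hA g e hg e0 Ae) hv)).
    rewrite lee_fin uE powRM ?(ltW CA0) ?(ltW e0)// le_eqVlt; apply/orP; left; apply/eqP; ring.
  have L0 := Lnorm_ge0 (leb n.+1) gam%:E (EFin \o g).
  have := key 1 ltr01; move: L0 key; case: ('N[_]_ _ [_])%E => [l| |]//= l0 key _.
  rewrite lee_fin; apply: (@le0_of_le_powR l (C0 * CA `^ beta1 * v `^ (1 - tau)) beta1) => //.
  by rewrite !mulr_gt0 ?powR_gt0.
have Ap : (0 < A)%E by rewrite lt0e An.
have Ep : (0 < E)%E by rewrite lt0e En.
have [AE|] := boolP ((A \is a fin_num) && (E \is a fin_num)).
  move/andP : AE => [Af Ef].
  pose a := fine A; pose e := fine E.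
  have aE : A = a%:E by rewrite fineK.
  have eE : E = e%:E by rewrite fineK.
  have a0 : 0 < a by rewrite -lte_fin -aE.
  have e0 : 0 < e by rewrite -lte_fin -eE.
  have ua0 : 0 < (CA * a) `^ p^-1 by rewrite powR_gt0// mulr_gt0.
  have ve0 : 0 < (CE * e) `^ (2 * q)^-1 by rewrite powR_gt0// mulr_gt0.
  have Aa : (A <= a%:E)%E by rewrite aE.
  have Ee : (E <= e%:E)%E by rewrite eE.
  apply: (le_trans (hC0 g _ _ hg ua0 ve0 (hA g a hg a0 Aa) (hEg e e0 Ee))).
  rewrite aE eE !poweR_EFin -!EFinM lee_fin uE vE !powRM ?(ltW CA0) ?(ltW CE0) ?(ltW a0) ?(ltW e0)//.
  by rewrite /C le_eqVlt; apply/orP; left; apply/eqP; ring.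
rewrite negb_and => AE.
suff -> : (C%:E * A `^ beta1 * E `^ beta2 = +oo)%E by rewrite leey.
have b10 : beta1 != 0 by rewrite gt_eqF.
have b20 : beta2 != 0 by rewrite gt_eqF.
have Ab : (0 < C%:E * A `^ beta1)%E by rewrite mule_gt0 ?lte_fin// poweR_gt0.
have Eb : (0 < E `^ beta2)%E by rewrite poweR_gt0.
case/orP : AE => [Af|Ef].
  have -> : A = +oo%E by move: Af A0; case: (A).
  by rewrite poweRyr// gt0_muley ?lte_fin// gt0_mulye.
have -> : E = +oo%E by move: Ef E0; case: (E).
by rewrite poweRyr// gt0_muley.
Qed.

End exponents.
End radial_gn.

Theorem theorem1p3 (R : realType) (d : nat) (s gamma p q alpha beta1 beta2 : R)
  (hd : (2 <= d)%N) (hs0 : 0 < s) (hs1 : s <= 1) (hgamma : 1 < gamma)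
  (hp : 1 <= p) (hq : 1 <= q) (halpha1 : 1 < alpha) (halphad : alpha < d%:R)
  (hbeta1 : 0 < beta1) (hbeta2 : 0 < beta2)
  (hhom : beta1 * p + 2 * beta2 * q = 1)
  (hscal : (d%:R - s * p) * beta1 + (d%:R + alpha) * beta2 = d%:R / gamma)
  (hne : p * (d%:R + alpha) - 2 * q * (d%:R - s * p) != 0)
  (hrad :
     beta1 * gamma + (d%:R + alpha - 2) / (d%:R - 1) * beta2 * gamma > 1 \/
     (beta1 * gamma + (d%:R + alpha - 2) / (d%:R - 1) * beta2 * gamma = 1 /\
      q * (1 - s * p) = p)) :
  exists2 C : R, 0 < C &
    forall g : 'rV[R]_d -> R, C1c_rad g ->
      ('N[lebesgue_rV R d]_(gamma%:E)[EFin \o g] <=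
       C%:E * Wdot_norm s p g `^ (beta1 * p) *
       coulomb_energy alpha q g `^ beta2)%E.
Proof.
case: d hd halphad hscal hne hrad => // n hn halphad hscal hne hrad.
have g0 : 0 < gamma by exact: lt_trans hgamma.
have d1 : 0 < n.+1%:R - 1 :> R by rewrite subr_gt0 ltr1n.
set S := beta1 * gamma + _ in hrad.
have SE : (S - 1) * (n.+1%:R - 1) / gamma = (s * p - 1) * beta1 - 2 * beta2 + gamma^-1.
  rewrite (radial_exponentE s p alpha beta1 beta2 (lt0r_neq0 d1) (lt0r_neq0 g0)).
  by rewrite hscal subrr add0r.
apply: radial_gagliardo_nirenberg => //.
  exact: lt_trans halpha1.
case: hrad => [h|[h crit]]; [left|right; split => //].
  by rewrite -SE divr_gt0// mulr_gt0// subr_gt0.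
(* In the equality case the gap is 0; with s p - 1 = - p / q and the homogeneity relation it reads 1
   / [gamma] = 1 / q. *)
move: SE; rewrite h subrr !mul0r => SE.
have q0 : 0 < q by exact: lt_le_trans hq.
have sp : s * p - 1 = - (p / q) by rewrite -[X in X / _]crit mulrAC divff ?gt_eqF// mul1r opprB.
have : gamma^-1 = q^-1.
  have -> : q^-1 = (beta1 * p + 2 * beta2 * q) / q by rewrite hhom div1r.
  have -> : gamma^-1 = 2 * beta2 - (s * p - 1) * beta1.
    by apply/eqP; rewrite -subr_eq0; apply/eqP; rewrite [RHS]SE; ring.
  by rewrite sp; field; rewrite gt_eqF.
exact: invr_inj.
Qed.
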